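(* Suppose Assumptions 1 and 2 hold. Let $X$ be a solution in law of $$\left\{\begin{array}{l}X_t=X_0+\int_0^t\chi_v(s,X_s)\,dB_s+\frac12L_t^X(0),\quad t\in[0,T],\\ v(t,\cdot)=\text{law density of }X_t,\quad t\in[0,T],\\ \chi_v(s,x)\in\Phi(v(s,x))\quad ds\otimes dx\text{-a.e.},\\ X\ge0,\\ v(0,\cdot)=u_0.\end{array}\right.$$ Then $v$ is the generalized solution of $$\partial_t u\in\tfrac12\partial^2_{xx}\beta(u)\ \text{ on }(0,T]\times\mathbb{R}_+,\qquad u(0,\cdot)=u_0,\qquad \partial_x(\beta(u))(t,0)=0,\ t\in(0,T].$$
   Context: Let $T>0$ and $\mathbb{R}_+=[0,\infty)$. Assumption 1: (i) $u_0\in L^1(\mathbb{R}_+)\cap L^\infty(\mathbb{R}_+)$ is a probability density; (ii) $\beta:\mathbb{R}_+\to\mathbb{R}_+$ is monotone increasing (non-decreasing, possibly discontinuous) with $\beta(0)=0$; (iii) there is a constant $c$ with $|\beta(u)|\le cu$ for all $u\ge 0$. The function $\beta$ is identified with the maximal monotone graph obtained by filling the gaps, i.e. $\beta(x)$ is identified with $[\beta(x-),\beta(x+)]$. $\Phi$ denotes the non-negative graph $u\mapsto\sqrt{\beta(u)/u}$, $u>0$ (so $\beta(u)=\Phi^2(u)u$), extended to $0$ by $\Phi(0)=[\liminf_{x\to0+}\Phi(x),\limsup_{x\to0+}\Phi(x)]$. Assumption 2: at least one of the following holds. (i) $\beta$ is non-degenerate: there is $c_0>0$ with $\Phi(x)\ge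 c_0$ for every $x>0$. (ii) $\beta$ is degenerate, i.e. $\lim_{u\to0+}\Phi(u)=0$, and there is a discrete ordered set $\{e_k\}\subset\mathbb{R}_+\cup\{+\infty\}$, whose successive open intervals $(e_k,e_{k+1})$ cover $\mathbb{R}_+$ up to the points $e_k$, such that $u_0$ has locally bounded variation on each $(e_k,e_{k+1})$. (iii) $\beta$ is strictly increasing after some zero: there is $u_c\ge0$ such that $\beta=0$ on $[0,u_c)$ and $\beta$ is strictly increasing on $[u_c,\infty)$. A solution in law of the system consists of a filtered probability space carrying a Brownian motion $B$ and a continuous semimartingale $X$, together with measurable functions $v,\chi_v$ on $[0,T]\times\mathbb{R}_+$, satisfying all the listed relations. $L^X(0)$ is the (right) local time of $X$ at $0$, i.e. $L_t^X(0)=\lim_{\varepsilon\to0}\frac1\varepsilon\int_0^t1_{\{X_s\in[0,\varepsilon)\}}\,d\langle X\rangle_s$. $C_0^\infty(\mathbb{R}_+)$ is the set of restrictions to $\mathbb{R}_+$ of smooth compactly supported functions on $\mathbb{R}$. Generalized solution: $u\in L^1([0,T]\times\mathbb{R}_+)$ for which there is $\eta_u\in L^1([0,T]\times\mathbb{R}_+)$ with $\eta_u\in\beta(u)$ $dt\otimes dx$-a.e., such that for every $\varphi\in C_0^\infty(\mathbb{R}_+)$ with $\varphi'(0)=0$ and almost every $t\in[0,T]$, $$\int_0^\infty\varphi(x)u(t,x)dx=\int_0^\infty\varphi(x)u_0(x)dx+\frac12\int_0^t\int_0^\infty\varphi''(x)\eta_u(s,x)\,dx\,ds.$$ (The paper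 shows that under Assumption 1 the generalized solution is unique.) *)

(* Defs.v *)
From HB Require Import structures.
From mathcomp Require Import all_boot all_order all_algebra.
From mathcomp Require Import all_classical all_reals all_analysis.

Set Implicit Arguments.
Unset Strict Implicit.
Unset Printing Implicit Defensive.

Import Order.TTheory GRing.Theory Num.Theory.
Import numFieldNormedType.Exports.

Local Open Scope classical_set_scope.
Local Open Scope ring_scope.

(* Functions on the half-line, on [0, T] or on [0, T] x [0, +oo[ are encoded as
   total functions of which only the values on these domains matter. *)

Section porous_medium.
Variable R : realType.
Implicit Types (beta u w phi : R -> R).

Local Notation mu := (@lebesgue_measure R).

Definition half_line : set R := `[0, +oo[%classic.

Definition space_time (T : R) : set (R * R) := `[0, T]%classic `*` half_line.

(* The maximal monotone graph of beta, x |-> [beta(x-), beta(x+)]; since beta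
   lives on [0, +oo[, beta(0-) is read as beta(0). *)
Definition beta_graph beta (x : R) : set R :=
  [set y | [/\ 0 <= x,
     (if x == 0 then beta 0 else lim (beta z @[z --> x^'-])) <= y &
     y <= lim (beta z @[z --> x^'+])]].

(* The graph Phi on ]0, +oo[; it is empty at the points x <= 0. *)
Definition Phi_pos beta (x : R) : set R :=
  [set p | 0 < x /\ exists2 y, beta_graph beta x y & p = Num.sqrt (y / x)].

(* Lower and upper limits of a multivalued map along a filter: compare with
   [limf_einf] and [limf_esup], the image f @` V being replaced by the union of
   the sets G x for x in V. *)
Definition graph_liminf (G : R -> set R) (F : set_system R) : \bar R :=
  ereal_sup [set ereal_inf (EFin @` \bigcup_(x in V) G x) | V in F].

Definition graph_limsup (G : R -> set R) (F : set_system R) : \bar R :=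
  ereal_inf [set ereal_sup (EFin @` \bigcup_(x in V) G x) | V in F].

Definition Phi beta (x : R) : set R :=
  if x == 0 then
    [set p | (graph_liminf (Phi_pos beta) 0^'+ <= p%:E)%E /\
             (p%:E <= graph_limsup (Phi_pos beta) 0^'+)%E]
  else Phi_pos beta x.

(* f is a Lebesgue probability density on [0, +oo[. *)
Definition density_on_half_line (f : R -> R) : Prop :=
  [/\ measurable_fun half_line f,
      {ae mu, forall x : R, 0 <= x -> 0 <= f x} &
      (\int[mu]_(x in half_line) (f x)%:E = 1)%E].

Record assumption1 beta u0 : Prop := {
  u0_L1 : mu.-integrable half_line (EFin \o u0) ;
  u0_Linfty : exists K : R, {ae mu, forall x : R, 0 <= x -> `|u0 x| <= K} ;
  u0_density : density_on_half_line u0 ;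
  beta_ge0 : forall x : R, 0 <= x -> 0 <= beta x ;
  beta_nondecreasing : {in `[0, +oo[ &, {homo beta : x y / x <= y}} ;
  beta_at0 : beta 0 = 0 ;
  beta_linear : exists c : R, forall x : R, 0 <= x -> `|beta x| <= c * x }.

Definition nondegenerate beta : Prop :=
  exists2 c0 : R, 0 < c0 & forall x p : R, 0 < x -> Phi beta x p -> c0 <= p.

Definition degenerate beta : Prop :=
  forall e : R, 0 < e -> \forall x \near 0^'+, forall p, Phi beta x p -> `|p| < e.

(* A finite family e_0 < ... < e_n = +oo is padded by e_k = +oo for k > n.
   The family cannot accumulate at some x in [0, +oo[: the covering condition
   would fail at x. *)
Definition discrete_subdivision (e : nat -> \bar R) : Prop :=
  [/\ forall k, (0 <= e k)%E,
      forall k, (e k < e k.+1)%E \/ (e k = +oo%E /\ e k.+1 = +oo%E) &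
      forall x : R, 0 <= x ->
        exists k, e k = x%:E \/ ((e k < x%:E)%E /\ (x%:E < e k.+1)%E)].

(* u0 being a class of functions modulo a.e. equality, it is some
   representative of u0 that has locally bounded variation. *)
Definition piecewise_locally_BV u0 : Prop :=
  exists e : nat -> \bar R, discrete_subdivision e /\
  exists w : R -> R, {ae mu, forall x : R, 0 <= x -> w x = u0 x} /\
    forall k (a b : R), (e k < a%:E)%E -> a <= b -> (b%:E < e k.+1)%E ->
      bounded_variation a b w.

Definition strictly_increasing_after_zero beta : Prop :=
  exists uc : R, [/\ 0 <= uc, (forall x : R, 0 <= x < uc -> beta x = 0) &
    {in `[uc, +oo[ &, {homo beta : x y / x < y}}].

Definition assumption2 beta u0 : Prop :=
  [\/ nondegenerate beta,
      degenerate beta /\ piecewise_locally_BV u0 |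
      strictly_increasing_after_zero beta].

Definition test_function phi : Prop :=
  (forall n (x : R), derivable (phi^`(n))%classic x 1) /\
  compact (closure [set x | phi x != 0]).

Definition generalized_solution (T : R) beta u0 (u : R * R -> R) : Prop :=
  (mu \x mu)%E.-integrable (space_time T) (EFin \o u) /\
  exists eta : R * R -> R, [/\
    (mu \x mu)%E.-integrable (space_time T) (EFin \o eta),
    {ae (mu \x mu)%E, forall z, space_time T z ->
       beta_graph beta (u z) (eta z)} &
    forall phi, test_function phi -> (phi^`())%classic 0 = 0 ->
    {ae mu, forall t : R, 0 <= t <= T ->
      (\int[mu]_(x in half_line) (phi x * u (t, x))%:E =
       \int[mu]_(x in half_line) (phi x * u0 x)%:E +
       (2^-1)%:E * \int[mu]_(s in `[0%R, t])
                     \int[mu]_(x in half_line) ((phi^`(2))%classic x * eta (s, x))%:E)%E}].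

End porous_medium.

Section stochastic.
Context (R : realType) (d : measure_display) (Omega : measurableType d).
Variables (P : probability Omega R) (T : R).
Implicit Types (F : R -> set_system Omega) (A B H I L M N Q X : R -> Omega -> R).

Local Notation mu := (@lebesgue_measure R).

Definition filtration F : Prop :=
  [/\ forall t : R, 0 <= t <= T -> sigma_algebra setT (F t),
      forall t : R, 0 <= t <= T -> F t `<=` measurable &
      forall s t : R, 0 <= s -> s <= t -> t <= T -> F s `<=` F t].

Definition measurable_wrt (G : set_system Omega) (f : Omega -> R) : Prop :=
  forall C : set R, measurable C -> G (f @^-1` C).

Definition adapted F X : Prop :=
  forall t : R, 0 <= t <= T -> measurable_wrt (F t) (X t).

Definition continuous_paths X : Prop :=
  {ae P, forall w, {within `[0, T], continuous (X ^~ w)}}.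

Definition brownian_motion F B : Prop :=
  [/\ adapted F B, continuous_paths B, {ae P, forall w, B 0 w = 0},
      forall s t : R, 0 <= s -> s < t -> t <= T -> forall C : set R, measurable C ->
        P ((B t \- B s) @^-1` C) = normal_prob 0 (Num.sqrt (t - s)) C &
      forall s t : R, 0 <= s -> s < t -> t <= T ->
        forall (D : set Omega) (C : set R), F s D -> measurable C ->
        P (D `&` (B t \- B s) @^-1` C) = (P D * P ((B t \- B s)%R @^-1` C))%E].

Definition martingale F M : Prop :=
  [/\ adapted F M,
      forall t : R, 0 <= t <= T -> P.-integrable setT (EFin \o M t) &
      forall s t : R, 0 <= s -> s <= t -> t <= T -> forall D, F s D ->
        (\int[P]_(w in D) (M t w)%:E = \int[P]_(w in D) (M s w)%:E)%E].

Definition stopping_time F (tau : Omega -> \bar R) : Prop :=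
  (forall w, (0 <= tau w)%E) /\
  forall t : R, 0 <= t <= T -> F t [set w | (tau w <= t%:E)%E].

Definition stopped M (tau : Omega -> \bar R) : R -> Omega -> R :=
  fun t w => M (fine (mine t%:E (tau w))) w.

Definition continuous_local_martingale F M : Prop :=
  [/\ adapted F M, continuous_paths M &
    exists tau : nat -> Omega -> \bar R,
      [/\ forall n, stopping_time F (tau n),
          {ae P, forall w, forall n, (tau n w <= tau n.+1 w)%E},
          {ae P, forall w, exists n, (T%:E <= tau n w)%E} &
          forall n, martingale F (stopped M (tau n))]].

Definition continuous_semimartingale F X : Prop :=
  [/\ adapted F X, continuous_paths X &
    exists M A,
      [/\ continuous_local_martingale F M /\ {ae P, forall w, M 0 w = 0},
          adapted F A /\ continuous_paths A,
          {ae P, forall w, A 0 w = 0},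
          {ae P, forall w, bounded_variation 0 T (A ^~ w)} &
          {ae P, forall w, forall t : R, 0 <= t <= T ->
             X t w = X 0 w + M t w + A t w}]].

(* Convergence in probability to 0 of nonnegative functions, expressed with the
   outer measure of P so that no measurability is presupposed. *)
Definition cvg0_in_probability (f : nat -> Omega -> \bar R) : Prop :=
  forall e : R, 0 < e ->
    ((P^*)%mu [set w | (e%:E <= f n w)%E] @[n --> \oo] --> 0)%E.

(* A subdivision 0 = t_0 < ... < t_m = T of [0, T] is encoded by the sequence
   s = [:: t_1; ...; t_m] such that [itv_partition 0 T s]. *)
Definition subdiv (s : seq R) (i : nat) : R := nth T (0 :: s) i.

(* The value at time r of sum_i xi_i 1_{]t_i, t_(i+1)]} and its integral
   sum_i xi_i (B_(t_(i+1) /\ r) - B_(t_i /\ r)). *)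
Definition simple_process (s : seq R) (xi : nat -> Omega -> R) :
    R -> Omega -> R :=
  fun r w => \sum_(i < size s)
    xi i w * \1_(`]subdiv s i, subdiv s i.+1]%classic : set R) r.

Definition simple_integral B (s : seq R) (xi : nat -> Omega -> R) :
    R -> Omega -> R :=
  fun r w => \sum_(i < size s)
    xi i w * (B (Num.min (subdiv s i.+1) r) w - B (Num.min (subdiv s i) r) w).

Definition predictable_simple F (s : seq R) (xi : nat -> Omega -> R) : Prop :=
  [/\ itv_partition 0 T s,
      forall i, (i < size s)%N -> measurable_wrt (F (subdiv s i)) (xi i) &
      exists K : R, forall i w, (i < size s)%N -> `|xi i w| <= K].

(* I is (a continuous version of) the Ito integral of H with respect to B. *)
Definition ito_integral F B H I : Prop :=
  [/\ forall t : R, 0 <= t <= T -> measurable_fun setT (I t),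
      continuous_paths I &
    exists (s : nat -> seq R) (xi : nat -> nat -> Omega -> R),
      [/\ forall n, predictable_simple F (s n) (xi n),
          cvg0_in_probability (fun n w =>
            (\int[mu]_(r in `[0%R, T])
               ((simple_process (s n) (xi n) r w - H r w)%R ^+ 2)%:E)%E) &
          forall t : R, 0 <= t <= T -> cvg0_in_probability (fun n w =>
            `|simple_integral B (s n) (xi n) t w - I t w|%:E)]].

Definition mesh (s : seq R) : R :=
  \big[Num.max/0]_(i < size s) (subdiv s i.+1 - subdiv s i).

Definition quadratic_variation X Q : Prop :=
  [/\ forall t : R, 0 <= t <= T -> measurable_fun setT (Q t),
      continuous_paths Q,
      {ae P, forall w, Q 0 w = 0},
      {ae P, forall w, {in `[0, T] &, {homo Q ^~ w : r t / r <= t}}} &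
      forall s : nat -> seq R, (forall n, itv_partition 0 T (s n)) ->
        mesh (s n) @[n --> \oo] --> (0 : R) ->
        forall t : R, 0 <= t <= T -> cvg0_in_probability (fun n w =>
          `|\sum_(i < size (s n))
              (X (Num.min (subdiv (s n) i.+1) t) w -
               X (Num.min (subdiv (s n) i) t) w) ^+ 2 - Q t w|%:E)].

(* L is the right local time at 0 of X. The measure d<X> on [0, T] is the
   Lebesgue-Stieltjes measure of the path of <X> frozen outside of [0, T]. *)
Definition local_time0 X L : Prop :=
  [/\ forall t : R, 0 <= t <= T -> measurable_fun setT (L t),
      continuous_paths L &
    exists Q, quadratic_variation X Q /\
      forall t : R, 0 <= t <= T ->
      {ae P, forall w, exists G : cumulative R R,
        (forall r, G r = Q (Num.min T (Num.max 0 r)) w) /\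
        ((e^-1)%:E * \int[lebesgue_stieltjes_measure G]_(r in `[0%R, t])
            (\1_[set r' | 0 <= X r' w < e] r)%:E)%E
          @[e --> 0^'+] --> (L t w)%:E}].

Record solution_in_law (beta u0 : R -> R) F B X (v chi : R * R -> R) : Prop := {
  sol_filtration : filtration F ;
  sol_brownian : brownian_motion F B ;
  sol_semimartingale : continuous_semimartingale F X ;
  sol_v_measurable : measurable_fun (space_time T) v ;
  sol_chi_measurable : measurable_fun (space_time T) chi ;
  sol_equation : exists I L,
    [/\ ito_integral F B (fun s w => chi (s, X s w)) I,
        local_time0 X L &
        {ae P, forall w, forall t : R, 0 <= t <= T ->
          X t w = X 0 w + I t w + 2^-1 * L t w}] ;
  sol_density : forall t : R, 0 <= t <= T ->
    density_on_half_line (fun x => v (t, x)) /\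
    forall C : set R, measurable C ->
      (P (X t @^-1` C) = \int[mu]_(x in C `&` @half_line R) (v (t, x))%:E)%E ;
  sol_chi_Phi : {ae (mu \x mu)%E, forall z, space_time T z ->
    Phi beta (v z) (chi z)} ;
  sol_ge0 : {ae P, forall w, forall t : R, 0 <= t <= T -> 0 <= X t w} ;
  sol_initial : {ae mu, forall x : R, 0 <= x -> v (0, x) = u0 x} }.

End stochastic.

(* Main.v *)
(* Let phi be a test function with phi' 0 = 0. Along a fine subdivision,
   phi (X t) - phi (X 0) is a sum of increments of phi due to the Ito integral
   and of increments due to the local time L. Since L only grows while X
   vanishes, where phi' = 0, the expectation of the latter sum tends to 0; the
   domination comes from E (L t - L 0) < oo, which is seen by taking atan for
   phi. As chi is bounded by the square root of c, the simple integrands that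
   approximate chi (s, X s) may be clipped, hence converge in L^2, and a second
   order Taylor expansion of the first sum yields
     E phi (X t) = E phi (X 0) + 1/2 E int_0^t phi'' (X s) chi (s, X s) ^ 2 ds.
   Since v (s, .) is the density of X s, this is the weak formulation with
   eta = chi ^ 2 * v. *)
Require Import Defs.
From HB Require Import structures.
From mathcomp Require Import all_boot all_order all_algebra.
From mathcomp Require Import all_classical all_reals all_analysis.
From mathcomp Require Import measurable_realfun ring lra.

Set Implicit Arguments.
Unset Strict Implicit.
Unset Printing Implicit Defensive.

Import Order.TTheory GRing.Theory Num.Theory.
Import numFieldNormedType.Exports.

Local Open Scope classical_set_scope.
Local Open Scope ring_scope.


(** * Expectations *)

Section expectation.
Context (R : realType) (d : measure_display) (Omega : measurableType d).
Variable P : probability Omega R.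
Implicit Types (X Y Z : Omega -> R).

(** The Ito integral is known only as a limit in probability of simple integrals, so no moment of it
    and no isometry is given. These are recovered from the simple integrals: a truncated form of
    Fatou's lemma carries square integrability over to the increments of [I], with an error measured
    by the L^2 distance between the integrands. That distance is additive over adjacent intervals,
    hence does not accumulate along a grid. The n-th grid must be fine and must also refine the
    break points of the n-th simple integrand, which is why the grids depend on n. A second obstacle
    is that [chi] is controlled only almost everywhere in (s, x), whereas the equation reads it
    along paths. As X s has a density, almost every path spends no time in the exceptional set. This
    rests on Fubini's theorem, hence on a jointly measurable modification of [X]. The constant c is
    the linear growth rate of [beta]: the graph at x lies in [0, c x], so Phi lies in [0, sqrt c],
    also at 0, where only upper and lower limits are available. *)

Definition integrable_rv Y := P.-integrable setT (EFin \o Y).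

Lemma integrable_rv_measurable Y : integrable_rv Y -> measurable_fun setT Y.
Proof. by move=> /measurable_int/measurable_EFinP. Qed.

Lemma integrable_rv_le Y Z : measurable_fun setT Y -> integrable_rv Z ->
  (forall w, `|Y w| <= Z w) -> integrable_rv Y.
Proof.
move=> mY iZ YZ; apply: (le_integrable measurableT _ _ iZ).
  exact/measurable_EFinP.
by move=> w _ /=; rewrite lee_fin (le_trans (YZ w))// ler_norm.
Qed.

Lemma integrable_rv_cst c : integrable_rv (cst c).
Proof. exact: finite_measure_integrable_cst. Qed.

Lemma integrable_rv_bounded Y M : measurable_fun setT Y ->
  (forall w, `|Y w| <= M) -> integrable_rv Y.
Proof. by move=> mY YM; apply: (integrable_rv_le mY (integrable_rv_cst M)). Qed.

Lemma integrable_rvD Y Z : integrable_rv Y -> integrable_rv Z ->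
  integrable_rv (fun w => Y w + Z w).
Proof. exact: integrableD. Qed.

Lemma integrable_rvB Y Z : integrable_rv Y -> integrable_rv Z ->
  integrable_rv (fun w => Y w - Z w).
Proof. exact: integrableB. Qed.

Lemma integrable_rvZ c Y : integrable_rv Y -> integrable_rv (fun w => c * Y w).
Proof. exact: integrableZl. Qed.

Lemma integrable_rv_norm Y : integrable_rv Y -> integrable_rv (fun w => `|Y w|).
Proof. exact: integrable_norm. Qed.

Lemma expD Y Z : integrable_rv Y -> integrable_rv Z ->
  \int[P]_w (Y w + Z w) = \int[P]_w Y w + \int[P]_w Z w.
Proof. by move=> iY iZ; rewrite RintegralD. Qed.

Lemma expB Y Z : integrable_rv Y -> integrable_rv Z ->
  \int[P]_w (Y w - Z w) = \int[P]_w Y w - \int[P]_w Z w.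
Proof. by move=> iY iZ; rewrite RintegralB. Qed.

Lemma expZ c Y : integrable_rv Y ->
  \int[P]_w (c * Y w) = c * \int[P]_w Y w.
Proof. by move=> iY; rewrite RintegralZl. Qed.

Lemma exp_cst c : \int[P]_w cst c w = c.
Proof.
rewrite (Rintegral_cst P measurableT c).
by rewrite [X in fine X](_ : _ = 1%E) ?mulr1//; exact: probability_setT.
Qed.

Lemma exp_le Y Z : integrable_rv Y -> integrable_rv Z ->
  (forall w, Y w <= Z w) -> \int[P]_w Y w <= \int[P]_w Z w.
Proof. by move=> iY iZ YZ; apply: le_Rintegral. Qed.

Lemma exp_ge0 Y : (forall w, 0 <= Y w) -> 0 <= \int[P]_w Y w.
Proof. by move=> Y0; apply: Rintegral_ge0. Qed.

Lemma exp_ae_eq Y Z : measurable_fun setT Y -> measurable_fun setT Z ->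
  {ae P, forall w, Y w = Z w} -> \int[P]_w Y w = \int[P]_w Z w.
Proof.
move=> mY mZ YZ; congr fine; apply: ae_eq_integral => //;
  [exact/measurable_EFinP|exact/measurable_EFinP|].
by apply: filterS YZ => w YZ _; rewrite YZ.
Qed.

Lemma integrable_rv_ae_eq Y Z : measurable_fun setT Z -> integrable_rv Y ->
  {ae P, forall w, Y w = Z w} -> integrable_rv Z.
Proof.
move=> mZ /integrableP[mY iY] YZ; apply/integrableP; split.
  exact/measurable_EFinP.
rewrite (le_lt_trans _ iY)//.
rewrite le_eqVlt; apply/orP; left; apply/eqP.
apply: ae_eq_integral => //; do ?[exact: measurableT_comp].
- by apply: measurableT_comp => //; exact/measurable_EFinP.
- by apply: filterS YZ => w /= -> _.
Qed.

Lemma exp_norm_le Y Z : integrable_rv Y -> integrable_rv Z ->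
  (forall w, `|Y w| <= Z w) -> `|\int[P]_w Y w| <= \int[P]_w Z w.
Proof.
move=> iY iZ YZ; apply: le_trans (le_normr_Rintegral measurableT iY) _.
by apply: exp_le => //; exact: integrable_rv_norm.
Qed.

(** Markov's inequality: [Y] is compared with [e] times the indicator of [A]. *)
Lemma exp_indic_le Y (A : set Omega) e : measurable A -> integrable_rv Y ->
  0 <= e -> (forall w, 0 <= Y w) -> (forall w, A w -> e <= Y w) ->
  e * fine (P A) <= \int[P]_w Y w.
Proof.
move=> mA iY e0 Y0 AY.
have mI : measurable_fun setT (\1_A : Omega -> R) by exact: measurable_indic.
have iI : integrable_rv (\1_A : Omega -> R).
  apply: (@integrable_rv_bounded _ 1) => // w.
  by rewrite /indic; case: (_ \in _); rewrite ?normr1 ?normr0.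
have -> : fine (P A) = \int[P]_w (\1_A : Omega -> R) w.
  by rewrite /Rintegral integral_indic// setIT.
rewrite -expZ//; apply: exp_le => //; first exact: integrable_rvZ.
move=> w; rewrite /indic; case: (boolP (w \in A)) => [|_]; last by rewrite mulr0.
by rewrite inE mulr1 => /AY.
Qed.

Definition square_integrable Y :=
  measurable_fun setT Y /\ integrable_rv (fun w => Y w ^+ 2).

Lemma square_integrable_bounded Y M : measurable_fun setT Y ->
  (forall w, `|Y w| <= M) -> square_integrable Y.
Proof.
move=> mY YM; split=> //; apply: (@integrable_rv_bounded _ (M ^+ 2)).
  exact: measurable_funX.
by move=> w; rewrite normrX lerXn2r// ?nnegrE// (le_trans _ (YM w)).
Qed.

Lemma integrable_rvM Y Z : square_integrable Y -> square_integrable Z ->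
  integrable_rv (fun w => Y w * Z w).
Proof.
move=> [mY iY] [mZ iZ].
apply: (@integrable_rv_le _ (fun w => Y w ^+ 2 + Z w ^+ 2)).
- exact: measurable_funM.
- exact: integrable_rvD.
- by move=> w; rewrite ler_norml; apply/andP; split; nra.
Qed.

Lemma square_integrableE Y : square_integrable Y -> integrable_rv Y.
Proof.
move=> sY; have := integrable_rvM sY (@square_integrable_bounded (cst 1) 1 _ _).
rewrite (_ : (fun _ => _) = Y); last by apply/funext => w; rewrite /= mulr1.
by apply => // w; rewrite /= normr1.
Qed.

Lemma square_integrableD Y Z : square_integrable Y -> square_integrable Z ->
  square_integrable (fun w => Y w + Z w).
Proof.
move=> sY sZ; have iYZ := integrable_rvM sY sZ; case: sY sZ => mY iY [mZ iZ].
split; first exact: measurable_funD.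
rewrite (_ : (fun _ => _) = (fun w => (Y w ^+ 2 + Z w ^+ 2) + 2 * (Y w * Z w))).
  by apply: integrable_rvD; [exact: integrable_rvD|exact: integrable_rvZ].
by apply/funext => w; ring.
Qed.

Lemma square_integrable_boundedM Y Z M : measurable_fun setT Y ->
  (forall w, `|Y w| <= M) -> square_integrable Z ->
  square_integrable (fun w => Y w * Z w).
Proof.
move=> mY YM [mZ iZ]; split; first exact: measurable_funM.
apply: (@integrable_rv_le _ (fun w => M ^+ 2 * Z w ^+ 2)).
- by apply: measurable_funX; exact: measurable_funM.
- exact: integrable_rvZ.
- move=> w; rewrite normrX normrM exprMn -[leRHS]ger0_norm; last first.
    by rewrite mulr_ge0// sqr_ge0.
  rewrite normrM 2!normrX ler_wpM2r ?sqr_ge0// lerXn2r ?nnegrE//.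
  by rewrite (le_trans (YM w))// ler_norm.
Qed.

(** From [l * |Y| <= l ^+ 2 + Y ^+ 2]. As [l] is free, this does the work of the Cauchy-Schwarz
    inequality in passing from a small second moment to a small first moment. *)
Lemma exp_sqr_le Y : square_integrable Y ->
  forall l, 0 < l -> \int[P]_w `|Y w| <= l + l^-1 * \int[P]_w (Y w ^+ 2).
Proof.
move=> sY l l0; have [mY iY] := sY.
rewrite -[X in X + _]exp_cst -expZ// -expD//; last 2 first.
  exact: integrable_rv_cst.
  exact: integrable_rvZ.
apply: exp_le => //.
- exact/integrable_rv_norm/square_integrableE.
- by apply: integrable_rvD; [exact: integrable_rv_cst|exact: integrable_rvZ].
- move=> w /=; rewrite -(ler_pM2l l0) mulrDr mulVKf ?gt_eqF// -[Y w ^+ 2]real_normK ?num_real//.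
  by have := sqr_ge0 (`|Y w| - l); nra.
Qed.

End expectation.

(** * Convergence in probability *)

Section convergence_in_probability.
Context (R : realType) (d : measure_display) (Omega : measurableType d).
Variable P : probability Omega R.
Implicit Types (f g h : nat -> Omega -> \bar R) (Y : Omega -> R)
  (Z : nat -> Omega -> R).

(** Union bound for the outer measure, since the events need not be measurable; the null set on
    which the implication fails adds nothing. The threshold [e'] may depend on [e] but not on
    [n]. *)
Lemma cvg0_probability_or f g h :
  (forall e : R, 0 < e -> exists2 e' : R, 0 < e' &
    forall n, {ae P, forall w, (e%:E <= f n w)%E ->
      (e'%:E <= g n w)%E \/ (e'%:E <= h n w)%E}) ->
  cvg0_in_probability P g -> cvg0_in_probability P h ->
  cvg0_in_probability P f.
Proof.
move=> fgh cg ch e e0; have [e' e'0 H] := fgh e e0.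
apply: (@squeeze_cvge _ _ _ _ (cst 0%E) _
  (fun n => ((P^*)%mu [set w | (e'%:E <= g n w)%E] +
             (P^*)%mu [set w | (e'%:E <= h n w)%E])%E)); last 2 first.
- exact: cvg_cst.
- by rewrite -[0%E]adde0; apply: cvgeD => //; [exact: cg|exact: ch].
apply: nearW => n; rewrite mu_ext_ge0//=.
have [N [mN N0 HN]] := H n.
apply: (@le_trans _ _ ((P^*)%mu (([set w | (e'%:E <= g n w)%E] `|`
    [set w | (e'%:E <= h n w)%E]) `|` N))%E).
  apply: le_mu_ext => w /= ef.
  have [|nH] := pselect ((e'%:E <= g n w)%E \/ (e'%:E <= h n w)%E).
    by left.
  by right; apply: HN => /= /(_ ef).
rewrite (le_trans (outer_measureU2 _ _ _))//.
have N0' : (P^*)%mu N = 0%E by rewrite (measurable_mu_extE P mN).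
change ((P^*)%mu ([set w | (e'%:E <= g n w)%E] `|`
  [set w | (e'%:E <= h n w)%E]) + (P^*)%mu N <= (P^*)%mu [set w | (e'%:E <= g n w)%E] +
  (P^*)%mu [set w | (e'%:E <= h n w)%E])%E.
by rewrite N0' adde0; exact: outer_measureU2.
Qed.

Lemma cvg0_probability_le f g :
  (forall e : R, 0 < e -> exists2 e' : R, 0 < e' &
    forall n, {ae P, forall w, (e%:E <= f n w)%E -> (e'%:E <= g n w)%E}) ->
  cvg0_in_probability P g -> cvg0_in_probability P f.
Proof.
move=> fg cg; apply: (cvg0_probability_or _ cg cg) => e /fg[e' e'0 H].
by exists e' => // n; apply: filterS (H n) => w Hw /Hw; left.
Qed.

(** Bounded convergence, from [Z n <= e / 2 + M * 1_A] with [A] the event [e / 2 <= Z n], whose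
    probability tends to 0. *)
Lemma cvg0_exp_bounded Z M : (forall n, measurable_fun setT (Z n)) ->
  (forall n w, 0 <= Z n w <= M) ->
  cvg0_in_probability P (fun n w => (Z n w)%:E) ->
  \int[P]_w Z n w @[n --> \oo] --> (0 : R).
Proof.
move=> mZ ZM cZ.
have iZ n : integrable_rv P (Z n).
  apply: (@integrable_rv_bounded _ _ _ _ _ M) => // w.
  by have /andP[? ?] := ZM n w; rewrite ger0_norm.
have M0 : 0 <= M by have /andP[z0 zM] := ZM 0%N point; exact: le_trans z0 zM.
apply/cvgr0Pnorm_le => /= e e0.
have e20 : 0 < e / 2 by rewrite divr_gt0.
(* [M] may be 0: here and in similar choices below, 1 is added to keep the denominator positive. *)
have /fine_cvgP[_ /cvgr0Pnorm_le/(_ (e / 2 / (M + 1)))] := cZ _ e20.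
move=> /(_ (divr_gt0 e20 (ltr_wpDl M0 ltr01))).
apply: filterS => n /= Hn.
have mA : measurable [set w | e / 2 <= Z n w].
  rewrite (_ : [set _ | _] = Z n @^-1` `[e / 2, +oo[%classic).
    by rewrite -[X in measurable X]setTI; exact: mZ.
  by apply/seteqP; split => w /=; rewrite in_itv/= andbT.
rewrite (_ : [set w | _] = [set w | e / 2 <= Z n w]) in Hn; last first.
  by apply/seteqP; split => w /=; rewrite lee_fin.
rewrite measurable_mu_extE// ger0_norm ?fine_ge0// in Hn.
rewrite ger0_norm; last by apply: exp_ge0 => w; case/andP : (ZM n w).
pose A := [set w | e / 2 <= Z n w].
have iA : integrable_rv P (\1_A : Omega -> R).
  apply: (@integrable_rv_bounded _ _ _ _ _ 1) => [|w].
    exact: measurable_indic.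
  by rewrite /indic; case: (_ \in _); rewrite ?normr1 ?normr0.
apply: (@le_trans _ _ (\int[P]_w (e / 2 + M * (\1_A : Omega -> R) w))).
  apply: exp_le => //.
    apply: integrable_rvD; first exact: integrable_rv_cst.
    exact: integrable_rvZ.
  move=> w; rewrite indicE; have /andP[Z0 ZnM] := ZM n w.
  case: (boolP (w \in A)) => [_|]; first by rewrite mulr1 (le_trans ZnM)// ler_wpDl// ltW.
  by rewrite notin_setE /A/= => /negP; rewrite -ltNge mulr0 addr0 => /ltW.
rewrite expD; [|exact: integrable_rv_cst|exact: integrable_rvZ].
rewrite exp_cst expZ//.
have -> : \int[P]_w (\1_A : Omega -> R) w = fine (P A).
  by rewrite /Rintegral integral_indic// setIT.
rewrite {2}(splitr e) lerD2l (le_trans (ler_wpM2l M0 Hn))//.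
by rewrite mulrCA ler_piMr ?(ltW e20)// ler_pdivrMr ?mul1r ?lerDl// ltr_wpDl.
Qed.

(** The rank from which [Y w <= Z n w] may depend on [w]; it still puts [Y] below the lower limit of
    the [Z n]. These are nonnegative only almost surely, hence the positive parts [Z']. *)
Lemma fatou_eventually Y Z C : measurable_fun setT Y ->
  (forall n, measurable_fun setT (Z n)) ->
  (forall w, 0 <= Y w) -> (forall n, integrable_rv P (Z n)) ->
  {ae P, forall w n, 0 <= Z n w} ->
  (forall n, \int[P]_w Z n w <= C) ->
  {ae P, forall w, \forall n \near \oo, Y w <= Z n w} ->
  integrable_rv P Y /\ \int[P]_w Y w <= C.
Proof.
move=> mY mZ Y0 iZ Z0 ZC YZ.
pose Z' n w := Num.max 0 (Z n w).
have mZ' n : measurable_fun setT (EFin \o Z' n).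
  by apply/measurable_EFinP; exact: measurable_maxr.
have iZ' n : (\int[P]_w (Z' n w)%:E <= C%:E)%E.
  rewrite -[leLHS]fineK; last first.
    apply: integrable_fin_num => //.
    apply: integrable_rv_ae_eq (iZ n) _; first exact/measurable_EFinP.
    by apply: filterS Z0 => w /(_ n) /max_idPr.
  rewrite lee_fin (le_trans _ (ZC n))// le_eqVlt; apply/orP; left; apply/eqP.
  apply: exp_ae_eq => //; first exact/measurable_EFinP.
  by apply: filterS Z0 => w /(_ n) /max_idPr.
have lY : (\int[P]_w (Y w)%:E <= C%:E)%E.
  have mE : measurable_fun setT (fun w => limn_einf (fun n => (Z' n w)%:E)).
    have cE w : einfs (fun n => (Z' n w)%:E) @ \oo --> limn_einf (fun n => (Z' n w)%:E).
      by rewrite limn_einf_lim; exact: is_cvg_einfs.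
    apply: (emeasurable_fun_cvg (fun n w => einfs (fun n => (Z' n w)%:E) n)) => //.
    exact: (measurable_fun_einfs mZ').
  apply: (@le_trans _ _ (\int[P]_w limn_einf (fun n => (Z' n w)%:E))%E).
    apply: ae_ge0_le_integral => //.
    - by move=> w _; rewrite lee_fin.
    - exact/measurable_EFinP.
    - move=> w _; rewrite limn_einf_lim; apply: lime_ge.
        exact: is_cvg_einfs.
      apply: nearW => n; apply: le_ereal_inf_tmp => _ [m _ <-].
      by rewrite lee_fin /Z' le_max lexx.
    - apply: filterS YZ => w [N _ HN] _.
      rewrite limn_einf_lim; apply: lime_ge; first exact: is_cvg_einfs.
      exists N => // n /= Nn; apply: le_ereal_inf_tmp => _ [m /= nm <-].
      by rewrite lee_fin /Z' le_max HN ?orbT//= (leq_trans Nn).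
  apply: le_trans (@fatou _ _ _ P _ measurableT (fun n => EFin \o Z' n) mZ' _) _.
    by move=> n w _; rewrite lee_fin le_max lexx.
  rewrite limn_einf_lim; apply: lime_le; first exact: is_cvg_einfs.
  apply: nearW => n; apply: le_trans (iZ' n); apply: ereal_inf_lbound.
  by rewrite /sdrop; exists n => //=.
have iY : integrable_rv P Y.
  apply/integrableP; split; first exact/measurable_EFinP.
  under eq_integral do rewrite /= ger0_norm//.
  by rewrite (le_lt_trans lY)// ltry.
by split=> //; rewrite -lee_fin /Rintegral fineK//; exact: integrable_fin_num.
Qed.

(** The truncations of [Y w] are equal to [Y w] from some rank on, so the uniform bound passes to
    [Y] by Fatou's lemma. *)
Lemma integrable_rv_truncated Y C : measurable_fun setT Y ->
  (forall w, 0 <= Y w) ->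
  (forall n : nat, \int[P]_w Num.min (Y w) n%:R <= C) ->
  integrable_rv P Y /\ \int[P]_w Y w <= C.
Proof.
move=> mY Y0 H; apply: (@fatou_eventually _ (fun n w => Num.min (Y w) n%:R)) => //.
- by move=> n; exact: measurable_minr.
- move=> n; apply: (@integrable_rv_bounded _ _ _ _ _ n%:R).
    exact: measurable_minr.
  by move=> w; rewrite ger0_norm ?ge_min ?lexx ?orbT// le_min Y0/=.
- by apply/aeW => w n; rewrite le_min Y0/=.
- apply/aeW => w; near=> n; rewrite le_min lexx/=.
  by near: n; exact: nbhs_infty_ger.
Unshelve. all: by end_near. Qed.

(** No almost surely convergent subsequence is extracted. Truncating at the level [K = sqrt N] makes
    the squared difference [D n] bounded, so its expectation tends to 0; then
    [c(Y)^2 <= 2 c(Z)^2 + 2 D], and [N] is arbitrary. The factor 2 in the conclusion comes from this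
    inequality. *)
Lemma fatou_square_in_probability Y Z C : measurable_fun setT Y ->
  (forall n, square_integrable P (Z n)) ->
  cvg0_in_probability P (fun n w => `|Z n w - Y w|%:E) ->
  (\forall n \near \oo, \int[P]_w (Z n w ^+ 2) <= C) ->
  square_integrable P Y /\ \int[P]_w (Y w ^+ 2) <= 2 * C.
Proof.
move=> mY sZ cZ ZC.
suff [? ?] : integrable_rv P (fun w => Y w ^+ 2) /\ \int[P]_w (Y w ^+ 2) <= 2 * C.
  by [].
have mZ n := (sZ n).1.
apply: integrable_rv_truncated.
- exact: measurable_funX.
- by move=> w; exact: sqr_ge0.
move=> N; pose K : R := Num.sqrt N%:R.
have K0 : 0 <= K by exact: sqrtr_ge0.
have K2 : K ^+ 2 = N%:R by rewrite sqr_sqrtr.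
pose c (x : R) := Num.max (- K) (Num.min K x).
have mc : measurable_fun setT c.
  by apply: measurable_maxr => //; exact: measurable_minr.
have cK x : `|c x| <= K.
  by rewrite ler_norml /c le_max lexx/= ge_max ge_min lexx/= andbT; lra.
have cE x : [\/ x <= - K /\ c x = - K, - K <= x <= K /\ c x = x | K <= x /\ c x = K].
  rewrite /c; case: (leP x (- K)) => h1.
    by constructor 1; rewrite min_r ?max_l//; lra.
  case: (leP x K) => h2; first by constructor 2; rewrite (ltW h1)/= max_r // ltW.
  by constructor 3; rewrite (ltW h2) max_r//; lra.
have cB x y : `|c x - c y| <= `|x - y|.
  rewrite ler_norml; have /andP[? ?] : - `|x - y| <= x - y <= `|x - y|.
    by rewrite -ler_norml.
  by case: (cE x) => -[? ->]; case: (cE y) => -[? ->]; apply/andP; split; lra.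
have mcY : measurable_fun setT (c \o Y) by exact: measurableT_comp.
have mcZ n : measurable_fun setT (c \o Z n) by exact: measurableT_comp.
pose D n w := (c (Z n w) - c (Y w)) ^+ 2.
have mD n : measurable_fun setT (D n).
  by apply: measurable_funX; exact: (measurable_funB (mcZ n) mcY).
have D4 n w : 0 <= D n w <= 4 * N%:R.
  rewrite sqr_ge0/= /D -K2; have := cK (Z n w); have := cK (Y w).
  by rewrite !ler_norml => /andP[? ?] /andP[? ?]; nra.
have iD n : integrable_rv P (D n).
  apply: (@integrable_rv_bounded _ _ _ _ _ (4 * N%:R)) => // w.
  by have /andP[? ?] := D4 n w; rewrite ger0_norm.
have cD : \int[P]_w D n w @[n --> \oo] --> (0 : R).
  apply: (@cvg0_exp_bounded _ (4 * N%:R)) => //.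
  apply: cvg0_probability_le cZ => e e0; exists (Num.sqrt e).
    by rewrite sqrtr_gt0.
  move=> n; apply/aeW => w; rewrite !lee_fin => eD.
  rewrite (le_trans _ (cB _ _))// -sqrtr_sqr ler_wsqrtr//.
have lim : 2 * C + 2 * \int[P]_w D n w @[n --> \oo] --> 2 * C + 2 * 0.
  by apply: cvgD; [exact: cvg_cst|apply: cvgM => //; exact: cvg_cst].
rewrite -[leRHS]addr0 -[X in _ <= _ + X](mulr0 2).
apply: (cvgr_to_ge lim).
apply: filterS ZC => n Hn.
rewrite (le_trans _ (lerD (ler_wpM2l (ler0n _ 2) Hn) (lexx _)))//.
have [_ iZ] := sZ n.
rewrite -expZ// -[X in _ <= _ + X]expZ// -expD; [|exact: integrable_rvZ|exact: integrable_rvZ].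
apply: exp_le.
- apply: (@integrable_rv_bounded _ _ _ _ _ N%:R).
    by apply: measurable_minr => //; exact: measurable_funX.
  by move=> w; rewrite ger0_norm ?ge_min ?lexx ?orbT// le_min sqr_ge0/=.
- by apply: integrable_rvD; exact: integrable_rvZ.
- move=> w; apply: (@le_trans _ _ (c (Y w) ^+ 2)).
    by rewrite -K2 ge_min; apply/orP; case: (cE (Y w)) => -[? ->];
      [right|left|right]; nra.
  have : c (Z n w) ^+ 2 <= Z n w ^+ 2.
    have := cB (Z n w) 0; have -> : c 0 = 0.
      by rewrite /c min_r// max_r// oppr_le0.
    rewrite !subr0 => h; rewrite -(real_normK (num_real (c (Z n w)))).
    by rewrite -(real_normK (num_real (Z n w))) lerXn2r// nnegrE.
  (* With y = c (Y w) and z = c (Z n w): 2 z^2 + 2 (z - y)^2 - y^2 = (2 z - y)^2. *)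
  by rewrite /D; have := sqr_ge0 (2 * c (Z n w) - c (Y w)); lra.
Qed.

End convergence_in_probability.

(** * Laws with a density, independence *)

Section density.
Context d (T : measurableType d) (R : realType).
Variables (nu mu : {measure set T -> \bar R}) (g : T -> R).
Hypothesis mg : measurable_fun setT g.
Hypothesis g0 : forall x, 0 <= g x.
Hypothesis nuE : forall A, measurable A -> nu A = (\int[mu]_(x in A) (g x)%:E)%E.

Import HBNNSimple.

Let integral_density_nnsfun (f : {nnsfun T >-> R}) :
  (\int[nu]_x (f x)%:E = \int[mu]_x (f x * g x)%:E)%E.
Proof.
under [LHS]eq_integral do rewrite fimfunE -fsumEFin//.
rewrite [LHS]ge0_integral_fsum//; last 2 first.
  - by move=> r; exact/measurable_EFinP/measurableT_comp.
  - by move=> n x _; rewrite EFinM nnfun_muleindic_ge0.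
under [RHS]eq_integral.
  move=> x xD; rewrite EFinM fimfunE -fsumEFin// muleC ge0_mule_fsumr; last first.
    by move=> r; rewrite EFinM nnfun_muleindic_ge0.
  over.
rewrite [RHS]ge0_integral_fsum//; last 2 first.
  - move=> r; apply: emeasurable_funM; first exact/measurable_EFinP.
    by apply/measurable_EFinP; apply/measurableT_comp => //.
  - move=> n x _; rewrite EFinM mule_ge0//; last by rewrite nnfun_muleindic_ge0.
    by rewrite lee_fin.
apply: eq_fsbigr => r _.
under [RHS]eq_integral do rewrite EFinM muleCA.
have [r0|r0] := ltP r 0.
  rewrite preimage_nnfun0// integral0_eq => [|x _]; last first.
    by rewrite indic0 mulr0.
  by rewrite integral0_eq// => x _; rewrite indic0 !mule0.
rewrite ge0_integralZl//; last 2 first.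
  - by apply: emeasurable_funM; exact/measurable_EFinP.
  - by move=> x _; rewrite mule_ge0// lee_fin.
under [LHS]eq_integral do rewrite EFinM.
rewrite ge0_integralZl//; last by exact/measurable_EFinP/measurable_indic.
congr (_ * _)%E; rewrite integral_indic// setIT nuE//.
rewrite integral_mkcond; apply: eq_integral => x _.
by rewrite patchE indicE; case: (_ \in _); rewrite ?mule1 ?mule0.
Qed.

(** Linearity settles the simple functions; both sides then pass to the limit by monotone
    convergence. *)
Lemma ge0_integral_density (f : T -> R) :
  measurable_fun setT f -> (forall x, 0 <= f x) ->
  (\int[nu]_x (f x)%:E = \int[mu]_x (f x * g x)%:E)%E.
Proof.
move=> mf f0.
have mF : measurable_fun setT (EFin \o f) by exact/measurable_EFinP.
pose f_ := nnsfun_approx measurableT mF.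
have cf x : (f_ n x)%:E @[n --> \oo] --> (f x)%:E.
  by apply: (cvg_nnsfun_approx measurableT mF) => // y _; rewrite lee_fin.
have ndf x m n : (m <= n)%N -> f_ m x <= f_ n x.
  by move=> mn; apply/lefP/nd_nnsfun_approx.
transitivity (limn (fun n => \int[nu]_x (f_ n x)%:E)%E).
  rewrite -monotone_convergence//=.
  - by apply: eq_integral => x _; apply/esym/cvg_lim => //; exact: cf.
  - by move=> n; exact/measurable_EFinP/measurable_funTS.
  - by move=> n ? _; rewrite lee_fin.
  - by move=> x _ m n mn; rewrite lee_fin ndf.
transitivity (limn (fun n => \int[mu]_x (f_ n x * g x)%:E)%E).
  by apply: congr_lim; apply/funext => n /=; exact: integral_density_nnsfun.
rewrite -monotone_convergence//=.
- apply: eq_integral => x _; apply: cvg_lim => //.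
  under eq_fun do rewrite EFinM.
  by rewrite EFinM; apply: cvgeZr => //; exact: cf.
- move=> n; apply/measurable_EFinP; apply: measurable_funM => //.
- by move=> n ? _; rewrite lee_fin mulr_ge0.
- by move=> x _ m n mn; rewrite lee_fin ler_wpM2r// ndf.
Qed.

(** Since [g] is nonnegative, the positive and negative parts of [f * g] are those of [f] times [g].
    The two parts match separately, so the identity holds in the extended reals without
    integrability of [f]. *)
Lemma integral_density (f : T -> R) : measurable_fun setT f ->
  (\int[nu]_x (f x)%:E = \int[mu]_x (f x * g x)%:E)%E.
Proof.
move=> mf; rewrite integralE [RHS]integralE; congr (_ - _)%E.
- transitivity (\int[nu]_x (Num.max (f x) 0)%:E)%E.
    by apply: eq_integral => x _; rewrite funeposE EFin_max.
  rewrite ge0_integral_density//; last first.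
  - by move=> x; rewrite le_max lexx orbT.
  - exact: measurable_maxr.
  apply: eq_integral => x _; rewrite funeposE -EFin_max; congr _%:E.
  by rewrite maxr_pMl// mul0r.
- transitivity (\int[nu]_x (Num.max (- f x) 0)%:E)%E.
    by apply: eq_integral => x _; rewrite funenegE EFin_max.
  rewrite ge0_integral_density//; last first.
  - by move=> x; rewrite le_max lexx orbT.
  - by apply: measurable_maxr => //; exact: measurableT_comp.
  apply: eq_integral => x _; rewrite funenegE -EFinN -EFin_max; congr _%:E.
  by rewrite maxr_pMl// mul0r mulNr.
Qed.

End density.

Section law.
Context (R : realType) (d : measure_display) (Omega : measurableType d).
Variable P : probability Omega R.
Implicit Types Y Z : Omega -> R.

Lemma integral_law_density Y (g f : R -> R) : measurable_fun setT Y ->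
  measurable_fun setT g -> (forall x, 0 <= g x) ->
  (forall C, measurable C ->
    P (Y @^-1` C) = (\int[lebesgue_measure]_(x in C) (g x)%:E)%E) ->
  measurable_fun setT f ->
  (\int[P]_w (f (Y w))%:E = \int[lebesgue_measure]_x (f x * g x)%:E)%E.
Proof.
move=> mY mg g0 PY mf.
pose mY' := isMeasurableFun.Build _ _ _ (measurableTypeR R) _ mY.
pose Y' : {mfun Omega >-> measurableTypeR R} := HB.pack Y mY'.
transitivity (\int[distribution P Y']_x (f x)%:E)%E; last first.
  exact: (@integral_density _ (measurableTypeR R) _ (distribution P Y') lebesgue_measure).
rewrite integralE [RHS]integralE.
have mE : measurable_fun [set: measurableTypeR R] (EFin \o f) by exact/measurable_EFinP.
congr (_ - _)%E.
- rewrite (ge0_integral_distribution Y' (measurable_funepos mE))//.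
  by apply: eq_integral => w _; rewrite /= !funeposE.
- rewrite (ge0_integral_distribution Y' (measurable_funeneg mE))//.
  by apply: eq_integral => w _; rewrite /= !funenegE.
Qed.

(** The joint law agrees with the product of the laws on rectangles, hence everywhere; Tonelli's
    theorem concludes. *)
Lemma integral_indep Y Z (f : R * R -> \bar R) :
  measurable_fun setT Y -> measurable_fun setT Z ->
  (forall A C, measurable A -> measurable C ->
    P (Y @^-1` A `&` Z @^-1` C) = (P (Y @^-1` A) * P (Z @^-1` C))%E) ->
  measurable_fun setT f -> (forall x, 0 <= f x)%E ->
  (\int[P]_w f (Y w, Z w) = \int[P]_w \int[P]_w' f (Y w, Z w'))%E.
Proof.
move=> mY mZ YZ mf f0.
pose mY' := isMeasurableFun.Build _ _ _ _ _ mY.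
pose Y' : {mfun Omega >-> R} := HB.pack Y mY'.
pose mZ' := isMeasurableFun.Build _ _ _ _ _ mZ.
pose Z' : {mfun Omega >-> R} := HB.pack Z mZ'.
have mYZ : measurable_fun setT (fun w => (Y w, Z w)).
  exact: measurable_fun_pair.
pose mYZ' := isMeasurableFun.Build _ _ _ _ _ mYZ.
pose YZ' : {mfun Omega >-> (R * R)%type} := HB.pack (fun w => (Y w, Z w)) mYZ'.
transitivity (\int[distribution P YZ']_z f z)%E.
  by rewrite ge0_integral_distribution.
rewrite (eq_measure_integral (distribution P Y' \x distribution P Z')%E); last first.
  move=> A mA _; apply/esym; apply: product_measure_unique => //; exact: YZ.
rewrite fubini_tonelli1//.
rewrite ge0_integral_distribution//; last 2 first.
- exact: measurable_fun_fubini_tonelli_F.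
- by move=> x; apply: integral_ge0.
apply: eq_integral => w _ /=; rewrite /fubini_F ge0_integral_distribution//.
exact: measurableT_comp.
Qed.

(** Independence is inherited by the positive and negative parts, to which Tonelli's theorem
    applies. The four products are then recombined. *)
Lemma exp_indep Y Z : integrable_rv P Y -> integrable_rv P Z ->
  (forall A C, measurable A -> measurable C ->
    P (Y @^-1` A `&` Z @^-1` C) = (P (Y @^-1` A) * P (Z @^-1` C))%E) ->
  integrable_rv P (fun w => Y w * Z w) /\
  \int[P]_w (Y w * Z w) = \int[P]_w Y w * \int[P]_w Z w.
Proof.
move=> iY iZ YZ.
have mY := integrable_rv_measurable iY; have mZ := integrable_rv_measurable iZ.
have ge0 (u v : R -> R) : measurable_fun setT u -> measurable_fun setT v ->
  (forall x, 0 <= u x <= `|x|) -> (forall x, 0 <= v x <= `|x|) ->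
  integrable_rv P (fun w => u (Y w) * v (Z w)) /\
  \int[P]_w (u (Y w) * v (Z w)) = \int[P]_w u (Y w) * \int[P]_w v (Z w).
  move=> mu mv u0 v0.
  have iu : integrable_rv P (fun w => u (Y w)).
    apply: integrable_rv_le (integrable_rv_norm iY) _.
      exact: measurableT_comp.
    by move=> w /=; case/andP: (u0 (Y w)) => ? ?; rewrite ger0_norm.
  have iv : integrable_rv P (fun w => v (Z w)).
    apply: integrable_rv_le (integrable_rv_norm iZ) _.
      exact: measurableT_comp.
    by move=> w /=; case/andP: (v0 (Z w)) => ? ?; rewrite ger0_norm.
  have u0' x : 0 <= u x by case/andP : (u0 x).
  have v0' x : 0 <= v x by case/andP : (v0 x).
  have muv : measurable_fun setT (fun w => u (Y w) * v (Z w)).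
    by apply: measurable_funM; exact: measurableT_comp.
  have E : (\int[P]_w (u (Y w) * v (Z w))%:E =
      \int[P]_w (u (Y w))%:E * \int[P]_w (v (Z w))%:E)%E.
    rewrite (@integral_indep Y Z (fun z => (u z.1 * v z.2)%:E))//=; last 2 first.
    - by apply/measurable_EFinP/measurable_funM; exact: measurableT_comp.
    - by move=> x; rewrite lee_fin mulr_ge0.
    rewrite muleC -ge0_integralZl//; last 3 first.
    - by apply/measurable_EFinP; exact: measurableT_comp.
    - by move=> w _; rewrite lee_fin.
    - by apply: integral_ge0 => w _; rewrite lee_fin.
    apply: eq_integral => w _; under eq_integral do rewrite EFinM.
    rewrite ge0_integralZl//.
    - by rewrite muleC.
    - by apply/measurable_EFinP; exact: measurableT_comp.
    - by move=> w' _; rewrite lee_fin.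
    - by rewrite lee_fin.
  have fu := integrable_fin_num measurableT iu.
  have fv := integrable_fin_num measurableT iv.
  split; last by rewrite /Rintegral E fineM.
  apply/integrableP; split; first exact/measurable_EFinP.
  under eq_integral do rewrite /= ger0_norm ?mulr_ge0//.
  by rewrite E ltey_eq fin_numM.
pose p (x : R) := Num.max x 0; pose n (x : R) := Num.max (- x) 0.
have mp : measurable_fun setT p by exact: measurable_maxr.
have mn : measurable_fun setT n.
  by apply: measurable_maxr => //; exact: measurableT_comp.
have pP x : 0 <= p x <= `|x|.
  by rewrite le_max lexx orbT /= ge_max ler_norm normr_ge0.
have nP x : 0 <= n x <= `|x|.
  by rewrite le_max lexx orbT /= ge_max -normrN ler_norm normr_ge0.
have pn x : x = p x - n x.
  by rewrite /p /n; case: (leP x 0) => x0; [rewrite max_l; lra|rewrite max_r; lra].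
have i1 (u : R -> R) (V : Omega -> R) : measurable_fun setT u -> integrable_rv P V ->
    (forall x, 0 <= u x <= `|x|) -> integrable_rv P (fun w => u (V w)).
  move=> mu iV uP; apply: integrable_rv_le (integrable_rv_norm iV) _.
    exact: (measurableT_comp mu (integrable_rv_measurable iV)).
  by move=> w /=; case/andP: (uP (V w)) => ? ?; rewrite ger0_norm.
have [ipp epp] := ge0 p p mp mp pP pP.
have [ipn epn] := ge0 p n mp mn pP nP.
have [inp enp] := ge0 n p mn mp nP pP.
have [inn enn] := ge0 n n mn mn nP nP.
have YZE : (fun w => Y w * Z w) = (fun w => (p (Y w) * p (Z w) - p (Y w) * n (Z w)) -
    (n (Y w) * p (Z w) - n (Y w) * n (Z w))).
  by apply/funext => w; rewrite {1}(pn (Y w)) {1}(pn (Z w)); ring.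
split; first by rewrite YZE; do 2?apply: integrable_rvB.
rewrite [LHS](_ : _ = \int[P]_w ((p (Y w) * p (Z w) - p (Y w) * n (Z w)) -
    (n (Y w) * p (Z w) - n (Y w) * n (Z w)))); last first.
  by congr (Rintegral _ _ _); exact: YZE.
rewrite expB; [|exact: integrable_rvB|exact: integrable_rvB].
rewrite expB// expB// epp epn enp enn.
have -> : \int[P]_w Y w = \int[P]_w p (Y w) - \int[P]_w n (Y w).
  rewrite -expB; [|exact: i1|exact: i1].
  by apply: eq_Rintegral => w _; exact: pn.
have -> : \int[P]_w Z w = \int[P]_w p (Z w) - \int[P]_w n (Z w).
  rewrite -expB; [|exact: i1|exact: i1].
  by apply: eq_Rintegral => w _; exact: pn.
ring.
Qed.

End law.

(** * Taylor expansions *)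

Section taylor.
Context (R : realType).
Implicit Types (f : R -> R) (x h M : R).

Lemma mean_value_bound f f1 (a b M : R) : (forall x, is_derive x (1 : R) f (f1 x)) ->
  (forall y, `|y - a| <= `|b - a| -> `|f1 y| <= M) ->
  `|f b - f a| <= M * `|b - a|.
Proof.
move=> df fM.
have cf : forall u v, {within `[u, v], continuous f}.
  move=> u v; apply: derivable_within_continuous => x _.
  exact: (@ex_derive _ _ _ _ _ _ _ (df x)).
have H u v : u <= v -> exists2 c, u <= c <= v & f v - f u = f1 c * (v - u).
  move=> uv; have [c cuv ->] := MVT_segment uv (fun x _ => df x) (cf u v).
  by exists c => //; move: cuv; rewrite in_itv.
have [ab|/ltW ba] := leP a b.
  have [c /andP[ac cb] ->] := H _ _ ab.
  rewrite normrM ler_wpM2r// fM// !ger0_norm ?subr_ge0//; lra.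
have [c /andP[bc ca]] := H _ _ ba; rewrite -(distrC (f a)) => ->.
rewrite normrM (distrC b) ler_wpM2r// fM// (distrC b) (distrC c) !ger0_norm ?subr_ge0//; lra.
Qed.

(** The mean value bound is applied to [f] minus its linear part at [x], whose derivative is
    estimated by the same bound. The sharp factor 1/2 is given up; the next order repeats the
    argument. *)
Lemma taylor_order1 f f1 f2 x h M :
  (forall x, is_derive x (1 : R) f (f1 x)) ->
  (forall x, is_derive x (1 : R) f1 (f2 x)) ->
  (forall y, `|y - x| <= `|h| -> `|f2 y| <= M) ->
  `|f (x + h) - f x - f1 x * h| <= M * `|h| ^+ 2.
Proof.
move=> df df1 fM.
pose G := fun y => f y - f1 x * y.
have dG y : is_derive y (1 : R) G (f1 y - f1 x).
  apply: is_derive_eq (is_deriveB (df y) (is_deriveZ (f1 x) (is_derive_id y 1))) _.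
  by rewrite /GRing.scale/= mulr1.
have E : f (x + h) - f x - f1 x * h = G (x + h) - G x by rewrite /G; ring.
rewrite E; have := @mean_value_bound G _ x (x + h) (M * `|h|) dG.
rewrite (addrC x) addrK -mulrA -expr2; apply => y yh.
have M0 : 0 <= M by rewrite (le_trans (normr_ge0 (f2 x)))// fM// subrr normr0.
apply: le_trans (@mean_value_bound f1 f2 x y M df1 _) _.
  by move=> z zy; apply: fM; exact: le_trans yh.
by rewrite ler_wpM2l.
Qed.

Lemma taylor_order2 f f1 f2 f3 x h M :
  (forall x, is_derive x (1 : R) f (f1 x)) ->
  (forall x, is_derive x (1 : R) f1 (f2 x)) ->
  (forall x, is_derive x (1 : R) f2 (f3 x)) ->
  (forall y, `|y - x| <= `|h| -> `|f3 y| <= M) ->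
  `|f (x + h) - f x - f1 x * h - 2^-1 * f2 x * h ^+ 2| <= M * `|h| ^+ 3.
Proof.
move=> df df1 df2 fM.
pose G := fun y => f y - f1 x * y - 2^-1 * f2 x * (y - x) ^+ 2.
have dG y : is_derive y (1 : R) G (f1 y - f1 x - f2 x * (y - x)).
  have dx := is_deriveB (is_derive_id y (1 : R)) (is_derive_cst x y (1 : R)).
  apply: is_derive_eq (is_deriveB (is_deriveB (df y) (is_deriveZ (f1 x)
    (is_derive_id y 1))) (is_deriveZ (2^-1 * f2 x) (is_deriveM dx dx))) _.
  rewrite /GRing.scale/= mulr1; change ((id - cst x) y) with (y - x).
  by rewrite subr0 !mulr1; field.
have E : f (x + h) - f x - f1 x * h - 2^-1 * f2 x * h ^+ 2 = G (x + h) - G x.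
  by rewrite /G; ring.
rewrite E; have := @mean_value_bound G _ x (x + h) (M * `|h| ^+ 2) dG.
rewrite (addrC x) addrK -mulrA -exprSr; apply => y yh.
have M0 : 0 <= M by rewrite (le_trans (normr_ge0 (f3 x)))// fM// subrr normr0.
rewrite -[in f1 y](subrKC x y).
apply: le_trans (@taylor_order1 f1 f2 f3 x (y - x) M df1 df2 _) _.
  by move=> z zy; apply: fM; exact: le_trans yh.
by rewrite ler_wpM2l// lerXn2r// nnegrE.
Qed.

End taylor.

(** * Moments of Gaussian variables *)

Section gaussian_moments.
Context (R : realType).

Lemma expR_norm_le (x : R) : expR `|x| <= expR x + expR (- x).
Proof.
by case: (ger0P x) => _; rewrite ?lerDl ?lerDr expR_ge0.
Qed.

(** This is [1 + y <= expR y] at [y = |x| / k], raised to the power [k]. It is the origin of the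
    constants 27 = 3^3 and 256 = 4^4 below. *)
Lemma norm_expr_le_expR (k : nat) (x : R) : (0 < k)%N ->
  `|x| ^+ k <= k%:R ^+ k * expR `|x|.
Proof.
move=> k0; have kR : (0 : R) < k%:R by rewrite ltr0n.
have {1}-> : `|x| = k%:R * (`|x| / k%:R) by rewrite mulrC divfK ?gt_eqF.
have -> : expR `|x| = expR (`|x| / k%:R) ^+ k.
  by rewrite -expRM_natl mulrC divfK ?gt_eqF.
rewrite exprMn ler_wpM2l ?exprn_ge0// lerXn2r ?nnegrE ?expR_ge0 ?divr_ge0//.
by rewrite (le_trans _ (expR_ge1Dx _))// lerDr.
Qed.

Lemma expR_taylor_order2 (x : R) :
  `|expR x - 1 - x - 2^-1 * x ^+ 2| <= expR `|x| * `|x| ^+ 3.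
Proof.
have dE (y : R) : is_derive y (1 : R) expR (expR y) by exact: is_derive_expR.
have := @taylor_order2 R expR expR expR expR 0 x (expR `|x|) dE dE dE.
rewrite add0r expR0 mul1r mulr1; apply => y.
by rewrite subr0 => yx; rewrite ger0_norm ?expR_ge0// ler_expR (le_trans (ler_norm y)).
Qed.

Lemma expR_taylor_order1 (x : R) : 0 <= x -> expR x - 1 - x <= expR x * x ^+ 2.
Proof.
move=> x0; have dE (y : R) : is_derive y (1 : R) expR (expR y) by exact: is_derive_expR.
have := @taylor_order1 R expR expR expR 0 x (expR `|x|) dE dE.
rewrite add0r expR0 mul1r (ger0_norm x0) => H; apply: le_trans (ler_norm _) (H _) => y.
by rewrite subr0 => yx; rewrite ger0_norm ?expR_ge0// ler_expR (le_trans (ler_norm y)).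
Qed.

Context (d : measure_display) (Omega : measurableType d).
Variables (P : probability Omega R) (Z : Omega -> R) (sigma : R).
Hypotheses (mZ : measurable_fun setT Z) (sigma0 : 0 < sigma).
Hypothesis lawZ : forall C, measurable C -> P (Z @^-1` C) = normal_prob 0 sigma C.

(** Completing the square: [expR (l * x)] times the centred density is
    [expR (l ^+ 2 * sigma ^+ 2 / 2)] times the density of mean [l * sigma ^+ 2]. *)
Lemma normal_mgf (l : R) : (\int[P]_w (expR (l * Z w))%:E =
  (expR (l ^+ 2 * sigma ^+ 2 / 2))%:E)%E.
Proof.
have s0 : sigma != 0 by rewrite gt_eqF.
have ml : measurable_fun setT (fun x : R => expR (l * x)).
  by apply: measurableT_comp => //; exact: measurable_funM.
rewrite (integral_law_density mZ (measurable_normal_pdf 0 sigma) _ lawZ ml);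
  last by move=> x; exact: normal_pdf_ge0.
rewrite (eq_integral (fun x : measurableTypeR R => (expR (l ^+ 2 * sigma ^+ 2 / 2))%:E *
    (normal_pdf (l * sigma ^+ 2) sigma x)%:E)%E); last first.
  move=> x _; rewrite -EFinM !normal_pdfE// /normal_fun mulrCA -expRD.
  rewrite [in RHS]mulrCA -expRD; congr (_ * expR _)%:E.
  by rewrite -[sigma ^+ 2 *+ 2]mulr_natr; field.
rewrite ge0_integralZl//.
- by rewrite integral_normal_pdf mule1.
- by apply/measurable_EFinP; exact: measurable_normal_pdf.
- by move=> x _; rewrite lee_fin normal_pdf_ge0.
Qed.

Lemma integrable_expR_normal (l : R) : integrable_rv P (fun w => expR (l * Z w)).
Proof.
apply/integrableP; split.
  apply/measurable_EFinP; apply: measurableT_comp => //.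
  exact: measurable_funM.
under eq_integral do rewrite /= ger0_norm ?expR_ge0//.
by rewrite normal_mgf ltry.
Qed.

Lemma exp_expR_normal (l : R) :
  \int[P]_w expR (l * Z w) = expR (l ^+ 2 * sigma ^+ 2 / 2).
Proof. by rewrite /Rintegral normal_mgf. Qed.

Lemma integrable_norm_normal (k : nat) : (0 < k)%N ->
  integrable_rv P (fun w => `|Z w| ^+ k).
Proof.
move=> k0; apply: (@integrable_rv_le _ _ _ _ _
  (fun w => k%:R ^+ k * (expR (1 * Z w) + expR (-1 * Z w)))).
- by apply: measurable_funX; exact: measurableT_comp.
- by apply: integrable_rvZ; apply: integrable_rvD; exact: integrable_expR_normal.
- move=> w; rewrite ger0_norm ?exprn_ge0// (le_trans (norm_expr_le_expR _ k0))//.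
  by rewrite ler_wpM2l ?exprn_ge0// mul1r mulN1r expR_norm_le.
Qed.

Lemma integrable_normal : integrable_rv P Z.
Proof.
apply: integrable_rv_le (integrable_norm_normal (isT : 0 < 1)%N) _ => //.
Qed.

Lemma integrable_normal2 : integrable_rv P (fun w => Z w ^+ 2).
Proof.
apply: integrable_rv_le (integrable_norm_normal (isT : 0 < 2)%N) _.
  exact: measurable_funX.
by move=> w; rewrite normrX.
Qed.

Lemma integrable_normal4 : integrable_rv P (fun w => Z w ^+ 4).
Proof.
apply: integrable_rv_le (integrable_norm_normal (isT : 0 < 4)%N) _.
  exact: measurable_funX.
by move=> w; rewrite normrX.
Qed.

(** For |l| <= 1 the cubic remainder e^|lz| |lz|^3 is at most |l|^3 * 27 e^(2|z|), and [W] dominates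
    27 e^(2|z|). *)
Let W w := 27 * (expR (2 * Z w) + expR (-2 * Z w)).

Let iW : integrable_rv P W.
Proof.
by apply: integrable_rvZ; apply: integrable_rvD; exact: integrable_expR_normal.
Qed.

(* The first two moments are read off the Laplace transform
   l |-> expR (l ^+ 2 * sigma ^+ 2 / 2) as l tends to 0. *)
Let normal_taylor (l : R) : `|l| <= 1 ->
  `|expR (l ^+ 2 * sigma ^+ 2 / 2) - 1 - l * \int[P]_w Z w -
    2^-1 * l ^+ 2 * \int[P]_w (Z w ^+ 2)| <= `|l| ^+ 3 * \int[P]_w W w.
Proof.
move=> l1.
pose Y w := expR (l * Z w) - 1 - l * Z w - 2^-1 * l ^+ 2 * Z w ^+ 2.
have i1 := integrable_expR_normal l.
have i2 : integrable_rv P (fun w => expR (l * Z w) - 1).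
  by apply: integrable_rvB => //; exact: integrable_rv_cst.
have i3 := integrable_rvZ l integrable_normal.
have i4 := integrable_rvZ (2^-1 * l ^+ 2) integrable_normal2.
have i5 := integrable_rvB i2 i3.
have iY : integrable_rv P Y by exact: integrable_rvB.
have <- : \int[P]_w Y w = expR (l ^+ 2 * sigma ^+ 2 / 2) - 1 - l * \int[P]_w Z w -
    2^-1 * l ^+ 2 * \int[P]_w (Z w ^+ 2).
  rewrite /Y (expB i5 i4) (expB i2 i3) (expB i1 (integrable_rv_cst P 1)).
  by rewrite exp_cst exp_expR_normal (expZ _ integrable_normal) (expZ _ integrable_normal2).
rewrite -expZ//; apply: exp_norm_le => //; first exact: integrable_rvZ.
move=> w; have -> : Y w = expR (l * Z w) - 1 - l * Z w - 2^-1 * (l * Z w) ^+ 2.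
  by rewrite /Y; ring.
apply: le_trans (expR_taylor_order2 _) _.
have lZ : `|l * Z w| <= `|Z w| by rewrite normrM ler_piMl.
rewrite [in X in _ * X]normrM exprMn mulrCA ler_wpM2l ?exprn_ge0//.
apply: (@le_trans _ _ (expR `|Z w| * (3%:R ^+ 3 * expR `|Z w|))).
  rewrite ler_pM ?expR_ge0 ?exprn_ge0// ?ler_expR//.
  exact: norm_expr_le_expR.
rewrite mulrCA -expRD (_ : `|Z w| + `|Z w| = `|2 * Z w|); last first.
  by rewrite normrM ger0_norm// mulr_natl mulr2n.
have -> : (3%:R ^+ 3 : R) = 27 by rewrite -natrX.
by rewrite /W ler_wpM2l// mulNr expR_norm_le.
Qed.

(** The expansions at [l] and [- l] are subtracted: the even terms cancel, which leaves |m| <= l^2 C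
    for every l in ]0, 1]. *)
Lemma exp_normal : \int[P]_w Z w = 0.
Proof.
set m := \int[P]_w Z w; set C := \int[P]_w W w.
have H (l : R) : 0 < l <= 1 -> `|m| <= l ^+ 2 * C.
  move=> /andP[l0 l1]; have l1' : `|l| <= 1 by rewrite gtr0_norm.
  have h1 := normal_taylor l1'.
  have := @normal_taylor (- l); rewrite normrN sqrrN => /(_ l1') h2.
  rewrite -(ler_pM2l l0) -{1}(gtr0_norm l0) -normrM mulrA -exprS.
  move: h1 h2; rewrite -/m -/C (gtr0_norm l0) !ler_norml => /andP[? ?] /andP[? ?].
  by apply/andP; split; lra.
apply/eqP; rewrite -normr_le0; apply/ler_addgt0Pl => e e0; rewrite addr0.
have C0 : 0 <= C.
  by apply: exp_ge0 => w; rewrite /W mulr_ge0// addr_ge0// expR_ge0.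
pose l := Num.min 1 (e / (C + 1)).
have l0 : 0 < l by rewrite lt_min ltr01 divr_gt0// ltr_wpDl.
have l1 : l <= 1 by rewrite ge_min lexx.
apply: le_trans (H l _) _; first by rewrite l0.
have : l * (C + 1) <= e.
  by rewrite -ler_pdivlMr ?ltr_wpDl// ge_min lexx orbT.
by nra.
Qed.

(** With x = l^2 sigma^2 / 2, the Laplace transform satisfies 0 <= e^x - 1 - x <= e^x x^2, which is
    of order l^4. Comparison with the expansion of the expectation and division by l^2 give |m -
    sigma^2| <= l D. *)
Lemma exp_normal2 : \int[P]_w (Z w ^+ 2) = sigma ^+ 2.
Proof.
set m := \int[P]_w (Z w ^+ 2); set C := \int[P]_w W w.
pose D := 2 * C + expR (sigma ^+ 2) * sigma ^+ 4.
have H (l : R) : 0 < l <= 1 -> `|m - sigma ^+ 2| <= l * D.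
  move=> /andP[l0 l1]; have l1' : `|l| <= 1 by rewrite gtr0_norm.
  have h1 := normal_taylor l1'.
  have h2 : 0 <= l ^+ 2 * sigma ^+ 2 / 2.
    by rewrite divr_ge0// mulr_ge0// sqr_ge0.
  have h3 := expR_taylor_order1 h2.
  have h4 := expR_ge1Dx (l ^+ 2 * sigma ^+ 2 / 2).
  have h5 : expR (l ^+ 2 * sigma ^+ 2 / 2) <= expR (sigma ^+ 2).
    rewrite ler_expR ler_pdivrMr// mulrC ler_wpM2l ?sqr_ge0//; nra.
  have l20 : 0 < l ^+ 2 by rewrite exprn_gt0.
  rewrite -(ler_pM2l l20) -{1}(gtr0_norm l20) -normrM.
  move: h1; rewrite exp_normal mulr0 subr0 -/m -/C (gtr0_norm l0).
  rewrite !ler_norml => /andP[h6 h7].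
  have h8 : expR (l ^+ 2 * sigma ^+ 2 / 2) * (l ^+ 2 * sigma ^+ 2 / 2) ^+ 2 <=
      l ^+ 3 * (expR (sigma ^+ 2) * sigma ^+ 4) / 2.
    apply: (@le_trans _ _ (expR (sigma ^+ 2) * (l ^+ 2 * sigma ^+ 2 / 2) ^+ 2)).
      by rewrite ler_wpM2r// sqr_ge0.
    rewrite [in leRHS](mulrCA (l ^+ 3)) -[leRHS]mulrA ler_wpM2l ?expR_ge0//.
    have -> : (l ^+ 2 * sigma ^+ 2 / 2) ^+ 2 = (l / 2) * (l ^+ 3 * sigma ^+ 4 / 2).
      by field.
    rewrite ler_piMl//; last by lra.
    by rewrite divr_ge0// mulr_ge0// exprn_ge0// ltW.
  have -> : l ^+ 2 * (l * D) = l ^+ 3 * (2 * C + expR (sigma ^+ 2) * sigma ^+ 4).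
    by rewrite /D; ring.
  rewrite !mulrDr mulrN.
  set e := expR _ in h3 h4 h6 h7 h8 *.
  by apply/andP; split; lra.
apply/eqP; rewrite -subr_eq0 -normr_le0; apply/ler_addgt0Pl => e e0; rewrite addr0.
have C0 : 0 <= C.
  by apply: exp_ge0 => w; rewrite /W mulr_ge0// addr_ge0// expR_ge0.
have D0 : 0 <= D.
  by rewrite addr_ge0// mulr_ge0 ?expR_ge0 ?exprn_even_ge0//.
pose l := Num.min 1 (e / (D + 1)).
have l0 : 0 < l by rewrite lt_min ltr01 divr_gt0// ltr_wpDl.
have l1 : l <= 1 by rewrite ge_min lexx.
apply: le_trans (H l _) _; first by rewrite l0.
have : l * (D + 1) <= e.
  by rewrite -ler_pdivlMr ?ltr_wpDl// ge_min lexx orbT.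
by nra.
Qed.

(** An upper bound of the right order in [sigma] suffices. For the reduced variable,
    [y ^+ 4 <= 256 * (expR y + expR (- y))], and each exponential has expectation [expR 2^-1]. *)
Lemma exp_normal4 : \int[P]_w (Z w ^+ 4) <= 512 * expR 2^-1 * sigma ^+ 4.
Proof.
have s4 : 0 < sigma ^+ 4 by rewrite exprn_gt0.
apply: (@le_trans _ _ (\int[P]_w (sigma ^+ 4 *
  (256 * (expR (sigma^-1 * Z w) + expR (- sigma^-1 * Z w)))))).
  have i := integrable_rvD (integrable_expR_normal sigma^-1) (integrable_expR_normal (- sigma^-1)).
  apply: exp_le => [||w].
  - exact: integrable_normal4.
  - by do 2 apply: integrable_rvZ.
  - have -> : Z w ^+ 4 = sigma ^+ 4 * (`|sigma^-1 * Z w|) ^+ 4.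
      rewrite -normrX ger0_norm ?exprn_even_ge0// exprMn mulrA -exprMn divff ?gt_eqF//.
      by rewrite expr1n mul1r.
    rewrite (ler_wpM2l (ltW s4))// (le_trans (norm_expr_le_expR _ (isT : 0 < 4)%N))//.
    have -> : (4%:R ^+ 4 : R) = 256 by rewrite -natrX.
    by rewrite ler_wpM2l// mulNr expR_norm_le.
have i := integrable_rvD (integrable_expR_normal sigma^-1) (integrable_expR_normal (- sigma^-1)).
rewrite (expZ _ (integrable_rvZ 256 i)) (expZ _ i) expD; [|exact: integrable_expR_normal..].
rewrite !exp_expR_normal sqrrN exprVn mulVf ?expf_neq0 ?gt_eqF// mul1r.
by rewrite le_eqVlt; apply/orP; left; apply/eqP; ring.
Qed.

End gaussian_moments.

(** * Fubini's theorem for bounded functions of time and chance *)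

Section bounded_fubini.
Context (R : realType) (d : measure_display) (Omega : measurableType d).
Variable P : probability Omega R.
Local Notation mu := (@lebesgue_measure R).
Variables (I : set (measurableTypeR R)) (g : R -> Omega -> R) (M : R).
Hypotheses (mI : measurable I) (I_fin : (mu I < +oo)%E).
Hypothesis mg : measurable_fun (I `*` [set: Omega])
  (fun z : measurableTypeR R * Omega => g z.1 z.2).
Hypothesis gM : forall r w, I r -> `|g r w| <= M.

(** Extension by zero outside of [I], to which Fubini's theorem on the whole product applies. *)
Let G := (fun z : measurableTypeR R * Omega => g z.1 z.2) \_ (I `*` [set: Omega]).

Let mG : measurable_fun setT G.
Proof. by apply/(measurable_restrictT _ _).1 => //; exact: measurableX. Qed.

Let mG1 r : measurable_fun setT (fun w => G (r, w)).
Proof. exact: (measurableT_comp mG (pair1_measurable r)). Qed.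

Let mG2 w : measurable_fun setT (fun r => G (r, w)).
Proof. exact: (measurableT_comp mG (pair2_measurable w)). Qed.

Let GE r w : G (r, w) = (g ^~ w \_ I) r.
Proof.
rewrite /G !patchE; case: ifPn => [|].
  by rewrite inE => -[/= Ir _]; rewrite mem_set.
by rewrite notin_setE; case: ifPn => //; rewrite inE => Ir /=; case.
Qed.

Lemma measurable_section w : measurable_fun I (g ^~ w).
Proof.
apply: (eq_measurable_fun (fun r => G (r, w))) => [r|].
  by rewrite inE => Ir; rewrite GE patchE mem_set.
exact: measurable_funTS (mG2 w).
Qed.

Lemma integrable_section w : mu.-integrable I (EFin \o g ^~ w).
Proof.
apply: measurable_bounded_integrable => //; first exact: measurable_section.
exists M; split; first exact: num_real.
by move=> x Mx r /= Ir; rewrite (le_trans (gM _ Ir))// ltW.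
Qed.

Let iG : (mu \x P)%E.-integrable setT (EFin \o G).
Proof.
apply/integrableP; split; first exact/measurable_EFinP.
rewrite fubini_tonelli1//; last by apply: measurableT_comp => //; exact/measurable_EFinP.
apply: (@le_lt_trans _ _ (\int[mu]_r (M * \1_I r)%:E)%E).
  apply: ge0_le_integral => //.
  - by move=> r _; exact: integral_ge0.
  - apply: measurable_fun_fubini_tonelli_F => //.
    by apply: measurableT_comp => //; exact/measurable_EFinP.
  - by apply/measurable_EFinP; apply: measurable_funM => //; exact: measurable_indic.
  - move=> r _ /=; rewrite /fubini_F/=.
    apply: (@le_trans _ _ (\int[P]_w (M * \1_I r)%:E)%E).
      apply: ge0_le_integral => //.
      + by apply/measurable_EFinP; apply: measurableT_comp => //; exact: mG1.
      + move=> w _; rewrite lee_fin GE patchE indicE; case: ifPn; rewrite ?normr0 ?mulr0//.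
        by rewrite inE mulr1; exact: gM.
    by rewrite integral_cst// [X in (_ * X)%E](_ : _ = 1%E) ?mule1//; exact: probability_setT.
under eq_integral do rewrite EFinM.
rewrite integralZl//; last first.
  apply/integrableP; split; first exact/measurable_EFinP/measurable_indic.
  under eq_integral do rewrite /= ger0_norm//.
  by rewrite integral_indic// setIT.
rewrite integral_indic// setIT ltey_eq fin_numM// ge0_fin_numE//.
Qed.

Let sectE w : (\int[mu]_(r in I) (g r w)%:E = \int[mu]_r (G (r, w))%:E)%E.
Proof.
rewrite integral_mkcond; apply: eq_integral => r _.
by rewrite GE !patchE; case: ifP.
Qed.

Let sectP r : I r -> (\int[P]_w (g r w)%:E = \int[P]_w (G (r, w))%:E)%E.
Proof. by move=> Ir; apply: eq_integral => w _; rewrite GE patchE mem_set. Qed.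

Lemma measurable_integral_section :
  measurable_fun setT (fun w => \int[mu]_(r in I) g r w).
Proof.
apply: (eq_measurable_fun (fun w => fine (fubini_G mu (EFin \o G) w))) => [w _|].
  by rewrite /Rintegral sectE.
by apply: measurableT_comp => //; exact: (measurable_fubini_G iG).
Qed.

Lemma exp_integral_section :
  (\int[P]_w (\int[mu]_(r in I) g r w)%:E =
   \int[mu]_(r in I) \int[P]_w (g r w)%:E)%E.
Proof.
transitivity (\int[P]_w \int[mu]_r (G (r, w))%:E)%E.
  apply: eq_integral => w _; rewrite -sectE /Rintegral fineK//.
  by apply: integrable_fin_num => //; exact: integrable_section.
rewrite -(Fubini iG) [RHS]integral_mkcond; apply: eq_integral => r _.
rewrite patchE; case: ifPn; first by rewrite inE => Ir; rewrite sectP.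
rewrite notin_setE => nIr; apply: integral0_eq => w _.
by rewrite /= GE patchE memNset.
Qed.

Lemma measurable_exp_section :
  measurable_fun I (fun r => \int[P]_w (g r w)%:E)%E.
Proof.
apply: (eq_measurable_fun (fubini_F P (EFin \o G))) => [r|].
  rewrite inE => Ir; apply: eq_integral => w _.
  by rewrite /= GE patchE mem_set.
exact: measurable_funTS (measurable_fubini_F iG).
Qed.

Lemma integral_section_bound w : `|\int[mu]_(r in I) g r w| <= M * fine (mu I).
Proof.
apply: le_trans (le_normr_Rintegral mI (integrable_section w)) _.
rewrite -Rintegral_cst//; apply: le_Rintegral => //.
- exact/integrable_norm/integrable_section.
- apply: measurable_bounded_integrable => //.
  exists `|M|; split; first exact: num_real.
  by move=> x Mx r /= Ir; rewrite ltW.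
- by move=> r; exact: gM.
Qed.

End bounded_fubini.

(** * Brownian increments *)

Section adapted.
Context (R : realType) (d : measure_display) (Omega : measurableType d).
Variables (T : R) (F : R -> set_system Omega).
Hypothesis hF : filtration T F.
Implicit Types f g : Omega -> R.

(** Since [F t] is already a sigma-algebra, it coincides with the one it generates. Measurability
    with respect to [F t] thus becomes ordinary measurability on another measurable space, and the
    closure properties below follow. *)
Lemma measurable_wrtP t f : 0 <= t <= T ->
  measurable_wrt (F t) f <-> measurable_fun [set: g_sigma_algebraType (F t)] f.
Proof.
move=> tT; have [/(_ t tT) sF _ _] := hF.
have E : <<s F t >> = F t by exact: sigma_algebra_id.
split=> [mf _ Y mY|mf Y mY].
  by rewrite setTI; change (<<s F t >> (f @^-1` Y)); rewrite E; exact: mf.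
have := mf measurableT Y mY; rewrite setTI.
by change (<<s F t >> (f @^-1` Y) -> F t (f @^-1` Y)); rewrite E.
Qed.

Lemma measurable_wrt_measurable t f : 0 <= t <= T -> measurable_wrt (F t) f ->
  measurable_fun setT f.
Proof.
move=> tT mf _ Y mY; rewrite setTI; have [_ /(_ t tT) + _] := hF.
by apply; exact: mf.
Qed.

Lemma measurable_wrt_le s t f : 0 <= s -> s <= t -> t <= T ->
  measurable_wrt (F s) f -> measurable_wrt (F t) f.
Proof. by move=> s0 st tT mf Y mY; have [_ _ /(_ s t s0 st tT)] := hF; apply; exact: mf. Qed.

Lemma measurable_wrt_cst t c : 0 <= t <= T -> measurable_wrt (F t) (cst c : Omega -> R).
Proof. by move=> tT; apply/(measurable_wrtP _ tT); exact: measurable_cst. Qed.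

Lemma measurable_wrt_comp t (u : R -> R) f : measurable_fun setT u ->
  measurable_wrt (F t) f -> measurable_wrt (F t) (fun w => u (f w)).
Proof.
move=> mu mf Y mY; have := mf (u @^-1` Y); apply.
by rewrite -[X in measurable X]setTI; exact: mu.
Qed.

Lemma measurable_wrtD t f g : 0 <= t <= T -> measurable_wrt (F t) f ->
  measurable_wrt (F t) g -> measurable_wrt (F t) (fun w => f w + g w).
Proof.
move=> tT /(measurable_wrtP _ tT) mf /(measurable_wrtP _ tT) mg.
by apply/(measurable_wrtP _ tT); exact: measurable_funD.
Qed.

Lemma measurable_wrtB t f g : 0 <= t <= T -> measurable_wrt (F t) f ->
  measurable_wrt (F t) g -> measurable_wrt (F t) (fun w => f w - g w).
Proof.
move=> tT /(measurable_wrtP _ tT) mf /(measurable_wrtP _ tT) mg.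
by apply/(measurable_wrtP _ tT); exact: measurable_funB.
Qed.

Lemma measurable_wrtM t f g : 0 <= t <= T -> measurable_wrt (F t) f ->
  measurable_wrt (F t) g -> measurable_wrt (F t) (fun w => f w * g w).
Proof.
move=> tT /(measurable_wrtP _ tT) mf /(measurable_wrtP _ tT) mg.
by apply/(measurable_wrtP _ tT); exact: measurable_funM.
Qed.

End adapted.

Section brownian_increments.
Context (R : realType) (d : measure_display) (Omega : measurableType d).
Variables (P : probability Omega R) (T : R) (F : R -> set_system Omega).
Variable B : R -> Omega -> R.
Hypothesis hF : filtration T F.
Hypothesis hB : brownian_motion P T F B.
Implicit Types (s t : R) (Y : Omega -> R).

Let adB t : 0 <= t <= T -> measurable_wrt (F t) (B t).
Proof. by move=> tT; have [/(_ t tT)] := hB. Qed.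

Lemma measurable_wrt_increment s t : 0 <= s -> s <= t -> t <= T ->
  measurable_wrt (F t) (fun w => B t w - B s w).
Proof.
move=> s0 st tT; have t0 := le_trans s0 st; have sT := le_trans st tT.
have t0T : 0 <= t <= T by rewrite t0.
apply: (measurable_wrtB hF t0T); first exact: adB.
by apply: (measurable_wrt_le hF s0 st tT); apply: adB; rewrite s0.
Qed.

Lemma measurable_increment s t : 0 <= s -> s <= t -> t <= T ->
  measurable_fun setT (fun w => B t w - B s w).
Proof.
move=> s0 st tT; apply: (@measurable_wrt_measurable _ _ _ T F hF t).
  by rewrite tT (le_trans s0 st).
exact: measurable_wrt_increment.
Qed.

Lemma increment_law s t : 0 <= s -> s < t -> t <= T -> forall C, measurable C ->
  P ((fun w => B t w - B s w) @^-1` C) = normal_prob 0 (Num.sqrt (t - s)) C.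
Proof. by move=> s0 st tT; have [_ _ _ + _] := hB; exact. Qed.

Lemma exp_increment_indep s t Y (u : R -> R) : 0 <= s -> s < t -> t <= T ->
  measurable_wrt (F s) Y -> integrable_rv P Y -> measurable_fun setT u ->
  integrable_rv P (fun w => u (B t w - B s w)) ->
  integrable_rv P (fun w => Y w * u (B t w - B s w)) /\
  \int[P]_w (Y w * u (B t w - B s w)) =
    \int[P]_w Y w * \int[P]_w u (B t w - B s w).
Proof.
move=> s0 st tT FY iY mu iu; apply: exp_indep => // A C mA mC.
have [_ _ _ _ /(_ s t s0 st tT (Y @^-1` A) (u @^-1` C))] := hB; apply.
  exact: FY.
by rewrite -[X in measurable X]setTI; exact: mu.
Qed.

Lemma integrable_increment s t : 0 <= s -> s <= t -> t <= T ->
  [/\ integrable_rv P (fun w => B t w - B s w),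
      integrable_rv P (fun w => (B t w - B s w) ^+ 2) &
      integrable_rv P (fun w => (B t w - B s w) ^+ 4)].
Proof.
(* The Gaussian moments require a positive standard deviation, so the empty interval is treated
   apart, here and below. *)
move=> s0; rewrite le_eqVlt => /predU1P[<-|st] tT.
  have E k : (fun w => (B s w - B s w) ^+ k) = cst (0 ^+ k) :> (Omega -> R).
    by apply/funext => w; rewrite subrr.
  by split; [have := E 1%N; under eq_fun do rewrite expr1; move=> ->|rewrite E|rewrite E];
    exact: integrable_rv_cst.
have m := measurable_increment s0 (ltW st) tT.
have l := increment_law s0 st tT.
have v0 : 0 < Num.sqrt (t - s) by rewrite sqrtr_gt0 subr_gt0.
split.
- exact: integrable_normal m v0 l.
- exact: integrable_normal2 m v0 l.
- exact: integrable_normal4 m v0 l.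
Qed.

Lemma square_integrable_increment s t : 0 <= s -> s <= t -> t <= T ->
  square_integrable P (fun w => B t w - B s w).
Proof.
by move=> s0 st tT; split; [exact: measurable_increment|case: (integrable_increment s0 st tT)].
Qed.

Lemma exp_increment s t Y : 0 <= s -> s <= t -> t <= T ->
  measurable_wrt (F s) Y -> integrable_rv P Y ->
  \int[P]_w (Y w * (B t w - B s w)) = 0.
Proof.
move=> s0; rewrite le_eqVlt => /predU1P[<-|st] tT FY iY.
  by under eq_Rintegral do rewrite subrr mulr0; rewrite exp_cst.
have [i _ _] := integrable_increment s0 (ltW st) tT.
have [_ ->] := exp_increment_indep s0 st tT FY iY (@measurable_id _ _ setT) i.
rewrite (exp_normal (measurable_increment s0 (ltW st) tT) _ (increment_law s0 st tT)).
  by rewrite mulr0.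
by rewrite sqrtr_gt0 subr_gt0.
Qed.

Lemma exp_increment2 s t Y : 0 <= s -> s <= t -> t <= T ->
  measurable_wrt (F s) Y -> integrable_rv P Y ->
  integrable_rv P (fun w => Y w * (B t w - B s w) ^+ 2) /\
  \int[P]_w (Y w * (B t w - B s w) ^+ 2) = \int[P]_w Y w * (t - s).
Proof.
move=> s0; rewrite le_eqVlt => /predU1P[<-|st] tT FY iY.
  rewrite (_ : (fun _ => _) = cst 0); last first.
    by apply/funext => w; rewrite subrr expr0n mulr0.
  rewrite subrr mulr0; split; first exact: integrable_rv_cst.
  exact: exp_cst.
have [_ i _] := integrable_increment s0 (ltW st) tT.
have [? ->] := exp_increment_indep s0 st tT FY iY (exprn_measurable 2) i.
split=> //; rewrite (exp_normal2 (measurable_increment s0 (ltW st) tT) _ (increment_law s0 st tT)).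
  by rewrite sqr_sqrtr// subr_ge0 ltW.
by rewrite sqrtr_gt0 subr_gt0.
Qed.

Lemma exp_increment4 s t : 0 <= s -> s <= t -> t <= T ->
  \int[P]_w ((B t w - B s w) ^+ 4) <= 512 * expR 2^-1 * (t - s) ^+ 2.
Proof.
move=> s0; rewrite le_eqVlt => /predU1P[<-|st] tT.
  by under eq_Rintegral do rewrite subrr expr0n; rewrite exp_cst subrr expr0n mulr0.
apply: le_trans (exp_normal4 (measurable_increment s0 (ltW st) tT) _ (increment_law s0 st tT)) _.
  by rewrite sqrtr_gt0 subr_gt0.
by rewrite (exprM _ 2 2) sqr_sqrtr// subr_ge0 ltW.
Qed.

End brownian_increments.

(** * Simple integrands *)

Section simple_processes.
Context (R : realType) (d : measure_display) (Omega : measurableType d).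
Variables (P : probability Omega R) (T : R) (F : R -> set_system Omega).
Variable B : R -> Omega -> R.
Local Notation mu := (@lebesgue_measure R).
Implicit Types (a b c r s t K : R) (h J : R -> Omega -> R).

(* On ]a, b], h is constant in time, with a value known at time a, and J is its
   stochastic integral. *)
Definition elementary_on K h J a b : Prop :=
  [/\ [/\ 0 <= a, a < b & b <= T], measurable_wrt (F a) (h b),
      (forall w, `|h b w| <= K) &
      forall w r, a <= r <= b -> (a < r -> h r w = h b w) /\
        J r w - J a w = h b w * (B r w - B a w)].

(** Closure under concatenation replaces an explicit list of break points: restriction to a
    subinterval, differences, the martingale property and the isometry are all proved by induction,
    and no common refinement has to be written down. *)
Inductive simple_on K h J : R -> R -> Prop :=
| simple_on_refl a : 0 <= a <= T -> simple_on K h J a a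
| simple_on_elementary a b : elementary_on K h J a b -> simple_on K h J a b
| simple_on_cat a c b : simple_on K h J a c -> simple_on K h J c b ->
    simple_on K h J a b.

Lemma simple_on_range K h J a b : simple_on K h J a b ->
  [/\ 0 <= a, a <= b & b <= T].
Proof.
elim=> [{}a /andP[]|{}a {}b [[? ? ?] _ _ _]|{}a c {}b _ [? ? ?] _ [? ? ?]].
- by split.
- by split=> //; exact: ltW.
- by split=> //; lra.
Qed.

Lemma lebesgue_measure_itvoc a b : a <= b -> fine (mu `]a, b]%classic) = b - a.
Proof.
move=> ab; rewrite lebesgue_measure_itv/= lte_fin; case: ltP => //= ba.
by apply/eqP; rewrite eq_sym subr_eq0 eq_le ab ba.
Qed.

Lemma lebesgue_measure_itvoc_fin a b : (mu `]a, b]%classic < +oo)%E.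
Proof. by rewrite lebesgue_measure_itv/=; case: ifP => _; rewrite ?ltry. Qed.

Lemma itvoc_setU a c b : a <= c -> c <= b ->
  `]a, b]%classic = `]a, c]%classic `|` `]c, b]%classic :> set R.
Proof.
move=> ac cb; apply/seteqP; split=> r /=; rewrite !in_itv/=.
  move=> /andP[ar rb]; case: (leP r c) => rc; [left|right]; apply/andP; split => //.
by case=> /andP[? ?]; apply/andP; split; lra.
Qed.

Lemma itvoc_disj a c b : [disjoint `]a, c]%classic & (`]c, b]%classic : set R)].
Proof.
apply/disj_setPS => r /= []; rewrite !in_itv/= => /andP[_ rc] /andP[cr _].
by have := lt_le_trans cr rc; rewrite ltxx.
Qed.

Lemma measurable_itvoc_setX a c b (g : R -> Omega -> R) : a <= c -> c <= b ->
  measurable_fun (`]a, c]%classic `*` setT) (fun z : measurableTypeR R * Omega => g z.1 z.2) ->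
  measurable_fun (`]c, b]%classic `*` setT) (fun z : measurableTypeR R * Omega => g z.1 z.2) ->
  measurable_fun (`]a, b]%classic `*` setT) (fun z : measurableTypeR R * Omega => g z.1 z.2).
Proof.
move=> ac cb m1 m2.
have -> : `]a, b]%classic `*` [set: Omega] =
    (`]a, c]%classic `*` setT) `|` (`]c, b]%classic `*` setT) :> set (measurableTypeR R * Omega).
  rewrite (itvoc_setU ac cb); apply/seteqP; split=> -[r w] /=.
    by move=> [[?|?] _]; [left|right].
  by move=> [[? _]|[? _]]; split=> //; [left|right].
by apply/measurable_funU => //; apply: measurableX.
Qed.

Lemma elementary_on_sub K h J a b a' b' : elementary_on K h J a b ->
  a <= a' -> a' < b' -> b' <= b -> filtration T F -> elementary_on K h J a' b'.
Proof.
move=> [[a0 ab bT] Fh hK H] aa' ab' bb' hF.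
have E w : h b' w = h b w by apply: (H w b' _).1; lra.
have Ef : h b' = h b by apply/funext.
split.
- by split; lra.
- by rewrite Ef; apply: (measurable_wrt_le hF a0 aa') => //; lra.
- by move=> w; rewrite E.
- move=> w r /andP[ar rb]; rewrite E; split=> [ar'|].
    by apply: (H w r _).1; lra.
  have /andP[h1 h2] : a <= r <= b by lra.
  have /andP[h3 h4] : a <= a' <= b by lra.
  have [_ e1] : (a < r -> h r w = h b w) /\ J r w - J a w = h b w * (B r w - B a w).
    by apply: H; rewrite h1.
  have [_ e2] : (a < a' -> h a' w = h b w) /\ J a' w - J a w = h b w * (B a' w - B a w).
    by apply: H; rewrite h3.
  by lra.
Qed.

Hypothesis hF : filtration T F.

Lemma simple_on_sub K h J a b a' b' : simple_on K h J a b ->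
  a <= a' -> a' <= b' -> b' <= b -> simple_on K h J a' b'.
Proof.
move=> H; elim: H a' b' => [{}a aT|{}a {}b ab|{}a c {}b ac IH1 cb IH2] a' b' aa' ab' bb'.
- have -> : b' = a by lra.
  have -> : a' = a by lra.
  by constructor 1.
- move: ab' bb'; rewrite le_eqVlt => /predU1P[<-|ab'] bb'.
    by case: ab => [[? ? ?] _ _ _]; constructor 1; lra.
  by constructor 2; exact: (elementary_on_sub ab aa' ab' bb' hF).
- case: (leP b' c) => bc; first exact: IH1.
  case: (leP c a') => ca; first exact: IH2.
  by apply: (@simple_on_cat _ _ _ _ c); [apply: IH1|apply: IH2] => //; lra.
Qed.

Lemma elementary_onB K h J K' h' J' a b : elementary_on K h J a b ->
  elementary_on K' h' J' a b ->
  elementary_on (K + K') (fun r w => h r w - h' r w) (fun r w => J r w - J' r w) a b.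
Proof.
move=> [ab Fh hK H] [_ Fh' hK' H']; split => //.
- apply: (measurable_wrtB hF) => //; case: ab => *; lra.
- by move=> w; rewrite (le_trans (ler_normB _ _))// lerD.
- move=> w r arb; have [e1 e2] := H w r arb; have [e1' e2'] := H' w r arb.
  by split=> [ar|]; [rewrite e1 ?e1'|lra].
Qed.

(** Nested inductions produce the common refinement: each integrand is cut at the break points of
    the other. *)
Lemma simple_onB K h J K' h' J' a b : simple_on K h J a b ->
  simple_on K' h' J' a b ->
  simple_on (K + K') (fun r w => h r w - h' r w) (fun r w => J r w - J' r w) a b.
Proof.
move=> H; elim: H => [{}a aT|{}a {}b ab H'|{}a c {}b ac IH1 cb IH2 H'].
- by move=> _; constructor 1.
- elim: H' ab => [{}a aT|{}a {}b ab' ab|{}a c {}b ac IH1 cb IH2 ab].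
  + by move=> _; constructor 1.
  + by constructor 2; exact: elementary_onB.
  + have [a0 ac' cT] := simple_on_range ac; have [c0 cb' bT] := simple_on_range cb.
    (* Elementary intervals are nonempty, so a cut at an end point must be discarded. *)
    have [eac|nac] := eqVneq a c; first by subst c; exact: IH2.
    have [ecb|ncb] := eqVneq c b; first by subst c; exact: IH1.
    apply: (@simple_on_cat _ _ _ _ c).
      by apply/IH1/(elementary_on_sub ab) => //; rewrite lt_neqAle nac.
    by apply/IH2/(elementary_on_sub ab) => //; rewrite lt_neqAle ncb.
- have [a0 ac' cT] := simple_on_range ac; have [c0 cb' bT] := simple_on_range cb.
  apply: (@simple_on_cat _ _ _ _ c).
    by apply: IH1; exact: simple_on_sub H' _ _ _.
  by apply: IH2; exact: simple_on_sub H' _ _ _.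
Qed.

Lemma simple_on_bound K h J a b : simple_on K h J a b ->
  forall r w, a < r <= b -> `|h r w| <= K.
Proof.
elim=> [{}a _ r w|{}a {}b [_ _ hK H] r w /andP[ar rb]|{}a c {}b _ IH1 _ IH2 r w].
- by move=> /andP[ar ra]; have := lt_le_trans ar ra; rewrite ltxx.
- have [e _] : (a < r -> h r w = h b w) /\ J r w - J a w = h b w * (B r w - B a w).
    by apply: H; rewrite ltW.
  by rewrite (e ar).
- move=> /andP[ar rb]; case: (leP r c) => rc; first by apply: IH1; rewrite ar.
  by apply: IH2; rewrite rc.
Qed.

Lemma simple_on_measurable K h J a b : simple_on K h J a b ->
  measurable_fun (`]a, b]%classic `*` setT)
    (fun z : measurableTypeR R * Omega => h z.1 z.2).
Proof.
elim=> [{}a _|{}a {}b [[? ? ?] Fh hK H]|{}a c {}b ac IH1 cb IH2].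
- rewrite set_itvoc0 set0X; exact: measurable_fun_set0.
- apply: (eq_measurable_fun (fun z : measurableTypeR R * Omega => h b z.2)) => [z|].
    rewrite inE => -[/=]; rewrite in_itv/= => /andP[az zb] _.
    have [e _] : (a < z.1 -> h z.1 z.2 = h b z.2) /\ J z.1 z.2 - J a z.2 = h b z.2 * (B z.1 z.2 - B a z.2).
      by apply: H; rewrite ltW.
    by rewrite e.
  apply: measurable_funTS; apply: (measurableT_comp _ measurable_snd).
  by apply: (measurable_wrt_measurable hF _ Fh); lra.
- have [_ ac' _] := simple_on_range ac; have [_ cb' _] := simple_on_range cb.
  exact: (measurable_itvoc_setX ac' cb').
Qed.

Hypothesis hB : brownian_motion P T F B.

(** The three properties are carried together because concatenation mixes them: a test variable
    known at time [a] is also known at time [c], and can be tested against the second increment. *)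
Lemma simple_on_martingale K h J a b : simple_on K h J a b ->
  [/\ measurable_wrt (F b) (fun w => J b w - J a w),
      square_integrable P (fun w => J b w - J a w) &
      forall Y, measurable_wrt (F a) Y -> square_integrable P Y ->
        \int[P]_w (Y w * (J b w - J a w)) = 0].
Proof.
elim=> [{}a aT|{}a {}b [[a0 ab bT] Fh hK H]|{}a c {}b ac [m1 s1 e1] cb [m2 s2 e2]].
- have E : (fun w => J a w - J a w) = cst 0 by apply/funext => w; rewrite subrr.
  rewrite E; split; first exact: (measurable_wrt_cst hF).
    by apply: (@square_integrable_bounded _ _ _ _ _ 0) => // w; rewrite normr0.
  move=> Y _ _; rewrite -[RHS](exp_cst P); apply: eq_Rintegral => w _.
  by rewrite subrr mulr0.
- have E w : J b w - J a w = h b w * (B b w - B a w).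
    by apply: (H w b _).2; rewrite lexx ltW.
  have Ef : (fun w => J b w - J a w) = (fun w => h b w * (B b w - B a w)).
    exact/funext.
  have aT : 0 <= a <= T by lra.
  have bT' : 0 <= b <= T by lra.
  have mh := measurable_wrt_measurable hF aT Fh.
  rewrite Ef; split.
  + apply: (measurable_wrtM hF bT').
      exact: (measurable_wrt_le hF a0 (ltW ab) bT).
    exact: measurable_wrt_increment hF hB _ _ a0 (ltW ab) bT.
  + apply: (square_integrable_boundedM mh hK).
    exact: square_integrable_increment hF hB _ _ a0 (ltW ab) bT.
  + move=> Y FY sY.
    rewrite (_ : \int[P]_w _ = \int[P]_w (Y w * h b w * (B b w - B a w))); last first.
      by apply: eq_Rintegral => w _; rewrite E mulrA.
    apply: (exp_increment hF hB a0 (ltW ab) bT).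
      exact: (measurable_wrtM hF aT).
    exact: integrable_rvM sY (square_integrable_bounded P mh hK).
- have [a0 ac' cT] := simple_on_range ac; have [c0 cb' bT] := simple_on_range cb.
  have E : (fun w => J b w - J a w) = (fun w => (J c w - J a w) + (J b w - J c w)).
    by apply/funext => w; ring.
  rewrite E; split.
  + apply: (measurable_wrtD hF); [lra| |exact: m2].
    exact: (measurable_wrt_le hF c0 cb' bT).
  + exact: square_integrableD.
  + move=> Y FY sY.
    rewrite (_ : \int[P]_w _ = \int[P]_w (Y w * (J c w - J a w) + Y w * (J b w - J c w))).
      rewrite expD; [|exact: integrable_rvM|exact: integrable_rvM].
      by rewrite e1// e2 ?addr0//; exact: (measurable_wrt_le hF a0 ac' cT).
    by apply: eq_Rintegral => w _; rewrite -mulrDr; congr (_ * _); ring.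
Qed.

Lemma simple_on_sqr_section K h J a b : simple_on K h J a b ->
  [/\ measurable_fun (`]a, b]%classic `*` setT)
        (fun z : measurableTypeR R * Omega => h z.1 z.2 ^+ 2),
      (forall (r : measurableTypeR R) w, `]a, b]%classic r -> `|h r w ^+ 2| <= K ^+ 2),
      measurable_fun setT (fun w => \int[mu]_(r in `]a, b]) (h r w ^+ 2)) &
      forall w, 0 <= \int[mu]_(r in `]a, b]) (h r w ^+ 2) <= K ^+ 2 * (b - a)].
Proof.
move=> H; have [a0 ab bT] := simple_on_range H.
have m1 : measurable_fun (`]a, b]%classic `*` setT)
    (fun z : measurableTypeR R * Omega => h z.1 z.2 ^+ 2).
  by apply: measurable_funX; exact: (simple_on_measurable H).
have bd (r : measurableTypeR R) w : `]a, b]%classic r -> `|h r w ^+ 2| <= K ^+ 2.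
  rewrite /= in_itv/= => ar; rewrite normrX lerXn2r ?nnegrE//.
    by rewrite (le_trans _ (simple_on_bound H w ar)).
  exact: (simple_on_bound H w ar).
split=> //.
  exact: (@measurable_integral_section _ _ _ P _ (fun r w => h r w ^+ 2) (K ^+ 2) (measurable_itv _) (lebesgue_measure_itvoc_fin _ _)).
move=> w; rewrite Rintegral_ge0/=; last by move=> r _; exact: sqr_ge0.
rewrite -lebesgue_measure_itvoc//; apply: le_trans (ler_norm _) _.
exact: (@integral_section_bound _ _ _ _ (fun r w => h r w ^+ 2) (K ^+ 2) (measurable_itv _) (lebesgue_measure_itvoc_fin _ _)).
Qed.

Lemma ito_isometry K h J a b : simple_on K h J a b ->
  \int[P]_w ((J b w - J a w) ^+ 2) =
  \int[P]_w (\int[mu]_(r in `]a, b]) (h r w ^+ 2)).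
Proof.
elim=> [{}a aT|{}a {}b ab|{}a c {}b ac IH1 cb IH2].
- apply: eq_Rintegral => w _; rewrite subrr expr0n set_itvoc0.
  by rewrite Rintegral_set0.
- move: (ab) => [[a0 ab' bT] Fh hK H].
  have aT : 0 <= a <= T by lra.
  have mh := measurable_wrt_measurable hF aT Fh.
  transitivity (\int[P]_w ((h b w ^+ 2) * (B b w - B a w) ^+ 2)).
    by apply: eq_Rintegral => w _; rewrite (H w b _).2 ?lexx ?ltW// exprMn.
  have i2 : integrable_rv P (fun w => h b w ^+ 2).
    by have [] := square_integrable_bounded P mh hK.
  rewrite (exp_increment2 hF hB a0 (ltW ab') bT _ i2).2; last first.
    by apply: (@measurable_wrt_comp _ _ _ _ _ (fun x => x ^+ 2)) => //; exact: exprn_measurable.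
  rewrite mulrC -expZ//; apply: eq_Rintegral => w _.
  rewrite -(lebesgue_measure_itvoc (ltW ab')) mulrC -Rintegral_cst//.
  apply: eq_Rintegral => r; rewrite inE/= in_itv/= => /andP[ar rb].
  by rewrite (H w r _).1// (ltW ar).
- have [a0 ac' cT] := simple_on_range ac; have [c0 cb' bT] := simple_on_range cb.
  have [m1 s1 _] := simple_on_martingale ac.
  have [m2 s2 e2] := simple_on_martingale cb.
  have [m3 b3 m3' b3'] := simple_on_sqr_section ac.
  have [m4 b4 m4' b4'] := simple_on_sqr_section cb.
  have [m5 b5 _ _] := simple_on_sqr_section (simple_on_cat ac cb).
  transitivity (\int[P]_w ((J c w - J a w) ^+ 2 + ((J b w - J c w) ^+ 2 +
      2 * ((J c w - J a w) * (J b w - J c w))))).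
    by apply: eq_Rintegral => w _; ring.
  have i := integrable_rvM s1 s2.
  rewrite expD; [|by case: s1|by apply: integrable_rvD; [case: s2|exact: integrable_rvZ]].
  rewrite expD; [|by case: s2|exact: integrable_rvZ].
  (* Orthogonality: the increment over ]a, c] is known at time [c], hence is a test variable for the
     increment over ]c, b]. *)
  rewrite (expZ 2 i) (e2 _ m1 s1) mulr0 addr0 IH1 IH2.
  have i3 : integrable_rv P (fun w => \int[mu]_(r in `]a, c]) (h r w ^+ 2)).
    apply: (@integrable_rv_bounded _ _ _ _ _ (K ^+ 2 * (c - a))) => // w.
    by have /andP[? ?] := b3' w; rewrite ger0_norm.
  have i4 : integrable_rv P (fun w => \int[mu]_(r in `]c, b]) (h r w ^+ 2)).
    apply: (@integrable_rv_bounded _ _ _ _ _ (K ^+ 2 * (b - c))) => // w.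
    by have /andP[? ?] := b4' w; rewrite ger0_norm.
  rewrite -(expD i3 i4); apply: eq_Rintegral => w _.
  rewrite (itvoc_setU ac' cb') Rintegral_setU//.
    rewrite -(itvoc_setU ac' cb').
    exact: (@integrable_section _ _ _ _ (fun r w => h r w ^+ 2) (K ^+ 2) (measurable_itv _) (lebesgue_measure_itvoc_fin _ _)).
  exact: itvoc_disj.
Qed.

End simple_processes.

(** * Clipping to [-K, K] *)

Section clipping.
Context (R : realType).
Implicit Types K x y : R.

Definition clip K x : R := Num.max (- K) (Num.min K x).

Lemma clipP K x : 0 <= K ->
  [\/ x <= - K /\ clip K x = - K, - K <= x <= K /\ clip K x = x | K <= x /\ clip K x = K].
Proof.
move=> K0; rewrite /clip; case: (leP x (- K)) => h1.
  by constructor 1; rewrite min_r ?max_l//; lra.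
case: (leP x K) => h2; first by constructor 2; rewrite (ltW h1)/= max_r // ltW.
by constructor 3; rewrite (ltW h2) max_r//; lra.
Qed.

Lemma norm_clip_le K x : 0 <= K -> `|clip K x| <= K.
Proof. by move=> K0; rewrite ler_norml; case: (clipP x K0) => -[? ->]; lra. Qed.

Lemma clip_id K x : `|x| <= K -> clip K x = x.
Proof.
rewrite ler_norml => /andP[? ?]; have K0 : 0 <= K by lra.
by case: (clipP x K0) => -[? ->]; lra.
Qed.

Lemma clip0 K : 0 <= K -> clip K 0 = 0.
Proof. by move=> K0; rewrite clip_id// normr0. Qed.

Lemma clip_lipschitz K x y : 0 <= K -> `|clip K x - clip K y| <= `|x - y|.
Proof.
move=> K0; rewrite ler_norml; have /andP[? ?] : - `|x - y| <= x - y <= `|x - y|.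
  by rewrite -ler_norml.
by case: (clipP x K0) => -[? ->]; case: (clipP y K0) => -[? ->]; apply/andP; split; lra.
Qed.

Lemma measurable_clip K : measurable_fun setT (clip K).
Proof. by apply: measurable_maxr => //; exact: measurable_minr. Qed.

End clipping.

(** * Simple processes along a subdivision *)

Section subdivisions.
Context (R : realType) (d : measure_display) (Omega : measurableType d).
Variables (T : R) (F : R -> set_system Omega) (B : R -> Omega -> R).
Local Notation mu := (@lebesgue_measure R).
Variable s : seq R.
Hypothesis sT : itv_partition 0 T s.
Implicit Type xi : nat -> Omega -> R.
Local Notation sd := (subdiv T s).

Lemma subdiv_lt i : (i < size s)%N -> sd i < sd i.+1.
Proof.
by case: sT => /(pathP T) H _ /H.
Qed.

Lemma subdiv_le i j : (i <= j)%N -> (j <= size s)%N -> sd i <= sd j.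
Proof.
move=> ij js; rewrite -(subnK ij) addnC; have : (i + (j - i) <= size s)%N by rewrite subnKC.
elim: (j - i)%N => [|k IH]; first by rewrite addn0.
rewrite addnS => ks; apply: (le_trans (IH (ltnW ks))).
exact/ltW/subdiv_lt.
Qed.

Lemma subdiv0 : sd 0 = 0. Proof. by []. Qed.

Lemma subdiv_size : sd (size s) = T.
Proof. by case: sT => _ /eqP <-; rewrite /subdiv nth_last. Qed.

Lemma subdiv_range i : (i <= size s)%N -> 0 <= sd i <= T.
Proof.
move=> i_s; have := subdiv_le (leq0n i) i_s; have := subdiv_le i_s (leqnn _).
by rewrite subdiv_size => -> ->.
Qed.

Lemma simple_processE xi i r w : (i < size s)%N -> sd i < r <= sd i.+1 ->
  simple_process T s xi r w = xi i w.
Proof.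
move=> i_s /andP[ir ri]; rewrite /simple_process (bigD1 (Ordinal i_s))//= big1 ?addr0.
  by rewrite indicE mem_set ?mulr1//= in_itv/= ir.
move=> j ji; rewrite indicE memNset ?mulr0//= in_itv/= => /andP[jr rj].
have [|/ltnW ij|ij] := ltngtP i j.
- move=> ij; have := subdiv_le ij (ltnW (ltn_ord j)).
  by move=> /(le_trans ri)/(le_lt_trans)/(_ jr); rewrite ltxx.
- have : (j < i)%N by rewrite ltn_neqAle ij andbT.
  move=> ji'; have := subdiv_le ji' (ltnW i_s).
  by move=> /(le_trans rj)/(le_lt_trans)/(_ ir); rewrite ltxx.
- by move: ji; rewrite -val_eqE/= ij eqxx.
Qed.

Lemma simple_process0 xi r w : (forall i, (i < size s)%N -> ~ (sd i < r <= sd i.+1)) ->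
  simple_process T s xi r w = 0.
Proof.
move=> H; rewrite /simple_process big1// => i _.
by rewrite indicE memNset ?mulr0//= in_itv/=; exact/H/ltn_ord.
Qed.

(** The condition [u 0 = 0] takes care of the times outside of all cells, such as [r = 0], where the
    process has the value 0. *)
Lemma simple_process_comp xi (u : R -> R) r w : u 0 = 0 ->
  simple_process T s (fun i w => u (xi i w)) r w = u (simple_process T s xi r w).
Proof.
move=> u0; have [[i i_s ir]|H] := pselect (exists2 i, (i < size s)%N & sd i < r <= sd i.+1).
  by rewrite !(simple_processE _ _ i_s ir).
have H' i : (i < size s)%N -> ~ (sd i < r <= sd i.+1) by move=> i_s ir; apply: H; exists i.
by rewrite !simple_process0.
Qed.

Lemma simple_integral_incr xi i r w : (i < size s)%N -> sd i <= r <= sd i.+1 ->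
  simple_integral T B s xi r w - simple_integral T B s xi (sd i) w =
  xi i w * (B r w - B (sd i) w).
Proof.
move=> i_s /andP[ir ri]; rewrite /simple_integral -sumrB (bigD1 (Ordinal i_s))//= big1 ?addr0.
  rewrite (min_r ri) (min_l ir) (min_r (ltW (subdiv_lt i_s))) minxx subrr mulr0 subr0//.
move=> j ji; have [ij|ij|ij] := ltngtP i j.
- have h1 := subdiv_le ij (ltnW (ltn_ord j)).
  have h2 := subdiv_le (leqW ij) (ltn_ord j).
  have h3 := le_trans ir ri.
  by rewrite !min_r ?subrr ?mulr0 ?subrr//; lra.
- have h1 := subdiv_le ij (ltnW i_s).
  have h2 := subdiv_le (leqnSn j) (leq_trans ij (ltnW i_s)).
  by rewrite !min_l ?subrr//; lra.
- by move: ji; rewrite -val_eqE/= ij eqxx.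
Qed.

(** One elementary piece is appended per cell. The cells are closed on the right, so the value at
    [sd i.+1] is [xi i], which is known at the left end [sd i]. *)
Lemma simple_on_predictable xi K :
  (forall i, (i < size s)%N -> measurable_wrt (F (sd i)) (xi i)) ->
  (forall i w, (i < size s)%N -> `|xi i w| <= K) ->
  simple_on T F B K (simple_process T s xi) (simple_integral T B s xi) 0 T.
Proof.
move=> Fxi xiK.
suff H i : (i <= size s)%N ->
    simple_on T F B K (simple_process T s xi) (simple_integral T B s xi) 0 (sd i).
  by have := H _ (leqnn _); rewrite subdiv_size.
elim: i => [_|i IH i_s].
  by constructor 1; exact: (subdiv_range (leq0n _)).
apply: simple_on_cat (IH (ltnW i_s)) _; constructor 2.
have E w r : sd i < r <= sd i.+1 -> simple_process T s xi r w = xi i w.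
  exact: simple_processE.
have Ef : simple_process T s xi (sd i.+1) = xi i.
  by apply/funext => w; rewrite E// lexx subdiv_lt.
split.
- have /andP[? _] := subdiv_range (ltnW i_s); have /andP[_ ?] := subdiv_range i_s.
  by split=> //; exact: subdiv_lt.
- by rewrite Ef; exact: Fxi.
- by move=> w; rewrite Ef; exact: xiK.
- move=> w r /andP[ir ri]; rewrite Ef; split=> [ir'|]; first by rewrite E// ir'.
  by apply: simple_integral_incr => //; rewrite ir.
Qed.

Lemma integral_simple_process_sqr xi w :
  \int[mu]_(r in `]0, T]) (simple_process T s xi r w ^+ 2) =
  \sum_(i < size s) xi i w ^+ 2 * (sd i.+1 - sd i).
Proof.
have sc i : (i < size s)%N -> (\int[mu]_(r in `]sd i, sd i.+1]) (simple_process T s xi r w ^+ 2)%:E =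
    (xi i w ^+ 2 * (sd i.+1 - sd i))%:E)%E.
  move=> i_s; have lt_i := subdiv_lt i_s.
  rewrite (eq_integral (fun=> (xi i w ^+ 2)%:E)); last first.
    by move=> r; rewrite inE/= in_itv/= => ir; rewrite (simple_processE _ _ i_s ir).
  rewrite integral_cst// [RHS]EFinM; congr (_ * _)%E.
  by apply: (etrans (lebesgue_measure_itv _)); rewrite /= lte_fin lt_i.
suff H i : (i <= size s)%N ->
    (\int[mu]_(r in `]0%R, sd i]) (simple_process T s xi r w ^+ 2)%:E =
    (\sum_(j < i) xi j w ^+ 2 * (sd j.+1 - sd j))%:E)%E.
  by rewrite /Rintegral -{1}subdiv_size H.
elim: i => [_|i IH i_s]; first by rewrite subdiv0 set_itvoc0 integral_set0 big_ord0.
have si := subdiv_lt i_s; have /andP[s0 _] := subdiv_range (ltnW i_s).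
rewrite (itvoc_setU s0 (ltW si)) ge0_integral_setU//.
- by rewrite IH ?sc ?(ltnW i_s)// big_ord_recr.
- rewrite -(itvoc_setU s0 (ltW si)); apply/measurable_EFinP/measurable_funTS.
  apply: measurable_funX; apply: measurable_sum => j.
  by apply: measurable_funM => //; exact: measurable_indic.
- by move=> r _; rewrite lee_fin sqr_ge0.
- exact: itvoc_disj.
Qed.

End subdivisions.

(** * Approximation of the Ito integral *)

Section ito_approximation.
Context (R : realType) (d : measure_display) (Omega : measurableType d).
Variables (P : probability Omega R) (T : R) (F : R -> set_system Omega).
Variable B : R -> Omega -> R.
Local Notation mu := (@lebesgue_measure R).
Hypothesis hF : filtration T F.
Hypothesis hB : brownian_motion P T F B.
Hypothesis T0 : 0 < T.

(* The integrand is stopped just before its integrated square reaches dl: this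
   is predictable, and the isometry applies to the stopped integrand. *)
Lemma lenglart_simple (s : seq R) (xi : nat -> Omega -> R) (t dl e : R) :
  predictable_simple T F s xi -> 0 <= t <= T -> 0 < dl -> 0 < e ->
  ((P^*)%mu [set w | (e%:E <= `|simple_integral T B s xi t w|%:E)%E] <=
   (P^*)%mu [set w | (dl%:E <= (\int[mu]_(r in `]0, T]) (simple_process T s xi r w ^+ 2))%:E)%E] +
   (dl / e ^+ 2)%:E)%E.
Proof.
move=> [sT Fxi [K xiK]] tT dl0 e0.
pose sd := subdiv T s.
pose A i w := \sum_(j < i) xi j w ^+ 2 * (sd j.+1 - sd j).
pose eta i w := if A i.+1 w < dl then xi i w else 0.
have A_mono i w : (i < size s)%N -> A i w <= A i.+1 w.
  move=> i_s; rewrite /A big_ord_recr/= lerDl mulr_ge0 ?sqr_ge0// subr_ge0.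
  exact/ltW/(subdiv_lt sT).
have K0 : 0 <= K.
  have s0 : (0 < size s)%N.
    rewrite lt0n size_eq0; apply/negP => /eqP s0; have := subdiv_size sT.
    by rewrite s0/= /subdiv/= => T0'; move: T0; rewrite -T0' ltxx.
  exact: le_trans (normr_ge0 _) (xiK 0%N point s0).
have sd_le i j := @subdiv_le _ T s sT i j.
have sd_range i := @subdiv_range _ T s sT i.
have Fxi' i j : (i <= j)%N -> (j < size s)%N -> measurable_wrt (F (sd j)) (xi i).
  move=> ij js; apply: (measurable_wrt_le hF _ _ _ (Fxi i (leq_ltn_trans ij js))).
  - by case/andP : (sd_range i (ltnW (leq_ltn_trans ij js))).
  - exact: sd_le (ltnW js).
  - by case/andP : (sd_range j (ltnW js)).
(* The bound [i <= j.+1] is what makes the stopped integrand predictable: [A j.+1] involves the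
   coefficients up to index [j] only, all known at time [sd j]. *)
have FA i j : (i <= j.+1)%N -> (j < size s)%N -> measurable_wrt (F (sd j)) (A i).
  move=> + js; have sjT := sd_range j (ltnW js).
  elim: i => [_|i IH ij].
    have -> : A 0 = cst 0 by apply/funext => w; rewrite /A big_ord0.
    exact: (measurable_wrt_cst hF).
  have -> : A i.+1 = (fun w => A i w + xi i w ^+ 2 * (sd i.+1 - sd i)).
    by apply/funext => w; rewrite /A big_ord_recr.
  apply: (measurable_wrtD hF sjT (IH (ltnW ij))).
  apply: (@measurable_wrt_comp _ _ _ _ _ (fun x => x ^+ 2 * (sd i.+1 - sd i))).
    by apply: measurable_funM => //; exact: exprn_measurable.
  exact: Fxi'.
have Feta i : (i < size s)%N -> measurable_wrt (F (sd i)) (eta i).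
  move=> i_s; have siT := sd_range i (ltnW i_s).
  have -> : eta i = (fun w => xi i w * (\1_(`]-oo, dl[%classic : set R) (A i.+1 w))).
    apply/funext => w; rewrite /eta indicE; case: ifP => H.
      by rewrite mem_set ?mulr1//= in_itv.
    by rewrite memNset ?mulr0//= in_itv/= H.
  apply: (measurable_wrtM hF siT); first exact: Fxi'.
  apply: (@measurable_wrt_comp _ _ _ _ _ (\1_(`]-oo, dl[%classic : set R))).
    exact: measurable_indic.
  exact: FA.
have etaK i w : (i < size s)%N -> `|eta i w| <= K.
  by move=> i_s; rewrite /eta; case: ifP => _; rewrite ?normr0// xiK.
have sum_eta n w : (n <= size s)%N -> \sum_(i < n) eta i w ^+ 2 * (sd i.+1 - sd i) <= dl.
  suff H : (n <= size s)%N -> \sum_(i < n) eta i w ^+ 2 * (sd i.+1 - sd i) <= dl /\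
      (A n w < dl -> \sum_(i < n) eta i w ^+ 2 * (sd i.+1 - sd i) = A n w).
    by move=> ns; case: (H ns).
  elim: n => [_|n IH ns]; first by rewrite /A !big_ord0 ltW.
  have [IH1 IH2] := IH (ltnW ns).
  have An := A_mono n w ns.
  rewrite big_ord_recr/= {2 4}/eta; case: ifP => H.
    rewrite (IH2 (le_lt_trans An H)).
    by have <- : A n.+1 w = A n w + xi n w ^+ 2 * (sd n.+1 - sd n);
      [rewrite /A big_ord_recr|split=> //; exact: ltW].
  by rewrite expr0n/= mul0r addr0.
have H := simple_on_predictable B sT Feta etaK.
have [t0 tT'] := andP tT.
have Ht := simple_on_sub hF H (lexx 0) t0 tT'.
have J0 x w : simple_integral T B s x 0 w = 0.
  rewrite /simple_integral big1// => i _.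
  have /andP[h1 _] := sd_range i (ltnW (ltn_ord i)).
  have /andP[h2 _] := sd_range i.+1 (ltn_ord i).
  by rewrite !min_r// subrr mulr0.
pose J := simple_integral T B s eta.
have EJ : \int[P]_w (J t w ^+ 2) <= dl.
  have -> : \int[P]_w (J t w ^+ 2) = \int[P]_w ((J t w - J 0 w) ^+ 2).
    by apply: eq_Rintegral => w _; rewrite [J 0 w]J0 subr0.
  rewrite (ito_isometry hF hB Ht) -[leRHS](exp_cst P).
  have [m1 b1 m2 b2] := simple_on_sqr_section P hF Ht.
  apply: exp_le.
  - apply: (@integrable_rv_bounded _ _ _ _ _ (K ^+ 2 * (t - 0))) => // w.
    by have /andP[? ?] := b2 w; rewrite ger0_norm.
  - exact: integrable_rv_cst.
  move=> w /=; apply: le_trans (sum_eta (size s) w (leqnn _)).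
  rewrite -(integral_simple_process_sqr sT).
  have i2 := @integrable_section _ _ _ _ (fun r w => simple_process T s eta r w ^+ 2) (K ^+ 2) (measurable_itv _) (lebesgue_measure_itvoc_fin 0 T).
  have [m3 b3 _ _] := simple_on_sqr_section P hF H.
  have {}i2 := i2 m3 b3 w.
  rewrite (itvoc_setU t0 tT') Rintegral_setU//.
  - by rewrite lerDl Rintegral_ge0// => r _; exact: sqr_ge0.
  - by rewrite -(itvoc_setU t0 tT').
  - exact: itvoc_disj.
have [_ [mJ iJ] _] := simple_on_martingale hF hB Ht.
have mJ' : measurable_fun setT (J t).
  by move: mJ; under eq_fun do rewrite J0 subr0.
have iJ' : integrable_rv P (fun w => J t w ^+ 2).
  by move: iJ; under eq_fun do rewrite J0 subr0.
pose S := [set w | e <= `|J t w|].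
have mA : measurable S.
  have mn : measurable_fun setT (fun w => `|J t w|) by exact: measurableT_comp.
  rewrite (_ : S = (fun w => `|J t w|) @^-1` `[e, +oo[%classic).
    by rewrite -[X in measurable X]setTI; exact: mn.
  by apply/seteqP; split => w /=; rewrite in_itv/= andbT.
have cheb : e ^+ 2 * fine (P S) <= dl.
  apply: le_trans EJ; apply: exp_indic_le => //.
  - exact: sqr_ge0.
  - by move=> w; exact: sqr_ge0.
  - by move=> w /= eJ; rewrite -[leRHS]real_normK ?num_real// lerXn2r// nnegrE ltW.
(* When the total [A (size s) w] stays below [dl], no coefficient is stopped and both simple
   integrals coincide. The deviation event is therefore covered by that of the total and by [S],
   which is handled by Markov's inequality. *)
apply: (@le_trans _ _ ((P^*)%mu ([set w | (dl%:E <= (\int[mu]_(r in `]0, T]) (simple_process T s xi r w ^+ 2))%:E)%E] `|` S))%E).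
  apply: le_mu_ext => w /=; rewrite !lee_fin (integral_simple_process_sqr sT) -/(A (size s) w) => ew.
  case: (leP dl (A (size s) w)) => Adl; [by left|right].
  rewrite /S/= /J (_ : simple_integral T B s eta t w = simple_integral T B s xi t w)//.
  apply: eq_bigr => i _; congr (_ * _); rewrite /eta ifT//.
  apply: le_lt_trans Adl; have := ltn_ord i; move: (nat_of_ord i) => {i}.
  suff H' n i : (i.+1 + n = size s)%N -> A i.+1 w <= A (size s) w.
    by move=> i i_s; apply: (H' (size s - i.+1)%N); rewrite subnKC.
  elim: n i => [|n IH] i; first by rewrite addn0 => ->.
  move=> in_s; apply: le_trans (IH i.+1 _); last by rewrite addSn -addnS.
  by apply: A_mono; rewrite -in_s -addSnnS leq_addr.
apply: le_trans (outer_measureU2 _ _ _) _.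
apply: leeD => //.
change ((P^*)%mu S <= (dl / e ^+ 2)%:E)%E.
rewrite (measurable_mu_extE P mA) -[leLHS]fineK; last exact: fin_num_measure.
by rewrite lee_fin ler_pdivlMr ?exprn_gt0// mulrC.
Qed.

Lemma cvg0_simple_integral (s : nat -> seq R) (xi : nat -> nat -> Omega -> R) (t : R) :
  (forall n, predictable_simple T F (s n) (xi n)) -> 0 <= t <= T ->
  cvg0_in_probability P (fun n w =>
    (\int[mu]_(r in `]0, T]) (simple_process T (s n) (xi n) r w ^+ 2))%:E) ->
  cvg0_in_probability P (fun n w => `|simple_integral T B (s n) (xi n) t w|%:E).
Proof.
move=> ps tT c e e0.
pose V n dl := (P^*)%mu [set w | (dl%:E <= (\int[mu]_(r in `]0, T]) (simple_process T (s n) (xi n) r w ^+ 2))%:E)%E].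
have V_ge0 n dl : (0 <= V n dl)%E by exact: mu_ext_ge0.
have Vc dl : 0 < dl -> V n dl @[n --> \oo] --> 0%E by exact: c.
have le n dl : 0 < dl -> ((P^*)%mu [set w | (e%:E <= `|simple_integral T B (s n) (xi n) t w|%:E)%E] <=
    V n dl + (dl / e ^+ 2)%:E)%E.
  by move=> dl0; apply: lenglart_simple.
apply/fine_cvgP.
have e20 : 0 < e ^+ 2 by rewrite exprn_gt0.
have H (eps : R) : 0 < eps -> \forall n \near \oo, ((P^*)%mu [set w | (e%:E <= `|simple_integral T B (s n) (xi n) t w|%:E)%E] <= eps%:E)%E.
  (* This level makes the term [dl / e ^+ 2] equal to [eps / 2]. *)
  move=> eps0; pose dl := eps / 2 * e ^+ 2.
  have dl0 : 0 < dl by rewrite mulr_gt0// divr_gt0.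
  have /fine_cvgP[V1 /cvgr0Pnorm_le/(_ (eps / 2))] := Vc _ dl0.
  move=> /(_ (divr_gt0 eps0 (ltr0n _ 2))) V2.
  near=> n; apply: le_trans (le n _ dl0) _.
  have V3 : V n dl \is a fin_num by near: n.
  have V4 : `|fine (V n dl)| <= eps / 2 by near: n.
  rewrite -(fineK V3) -EFinD lee_fin (splitr eps) lerD//.
    by rewrite (le_trans (ler_norm _)).
  by rewrite /dl mulfK ?gt_eqF.
split.
  near=> n; rewrite ge0_fin_numE ?mu_ext_ge0//.
  apply: (@le_lt_trans _ _ 1%:E); last exact: ltry.
  by near: n; exact: H.
apply/cvgr0Pnorm_le => eps eps0; near=> n.
rewrite ger0_norm ?fine_ge0 ?mu_ext_ge0//=.
have : ((P^*)%mu [set w | (e%:E <= `|simple_integral T B (s n) (xi n) t w|%:E)%E] <= eps%:E)%E.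
  by near: n; exact: H.
move=> h; rewrite -lee_fin fineK// ge0_fin_numE ?mu_ext_ge0//.
by apply: le_lt_trans h _; exact: ltry.
Unshelve. all: by end_near. Qed.

Lemma ae_lebesgueS (A C : R -> Prop) : (forall r, A r -> C r) ->
  {ae mu, forall r, A r} -> {ae mu, forall r, C r}.
Proof.
move=> AC [N [mN N0 AN]]; exists N; split=> // r nC; apply: AN => /= Ar.
exact/nC/AC.
Qed.

(** An inequality only: [fine] sends [+oo] to 0. *)
Lemma fine_le_ereal (x : \bar R) : (0 <= x)%E -> ((fine x)%:E <= x)%E.
Proof. by case: x => [r|_|]//=; rewrite leey. Qed.

Lemma measurable_simple_process (s : seq R) (xi : nat -> Omega -> R) w (D : set R) :
  measurable_fun D (fun r => simple_process T s xi r w).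
Proof.
apply: measurable_funTS; apply: measurable_sum => j.
by apply: measurable_funM => //; exact: measurable_indic.
Qed.

(** Each coefficient splits into its clipped part [xk] and the excess [xd]. Where |H| <= K, the
    excess is at most the distance from the coefficient to [H], so the integral of the excess tends
    to 0 in probability and [I] is still the limit of the clipped integrals. The clipped integrands
    approach [clip K H] because clipping is 1-Lipschitz. The gain is a bound [K] independent of
    [n]. *)
Lemma ito_simple_approximation (H I : R -> Omega -> R) (K : R) : 0 <= K ->
  ito_integral P T F B H I ->
  {ae P, forall w, measurable_fun `[0, T] (H ^~ w) /\
    {ae mu, forall r, 0 <= r <= T -> `|H r w| <= K}} ->
  exists h J : nat -> R -> Omega -> R,
  [/\ forall n, simple_on T F B K (h n) (J n) 0 T,
      forall t, 0 <= t <= T -> cvg0_in_probability P (fun n w => `|J n t w - I t w|%:E) &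
      cvg0_in_probability P (fun n w =>
        (\int[mu]_(r in `]0%R, T]) ((h n r w - clip K (H r w)) ^+ 2)%:E)%E)].
Proof.
move=> K0 [_ _ [s [xi [ps cH cI]]]] good.
pose xk n i w := clip K (xi n i w).
pose xd n i w := xi n i w - clip K (xi n i w).
have c0 : clip K 0 = 0 by exact: clip0.
have spk n r w : simple_process T (s n) (xk n) r w = clip K (simple_process T (s n) (xi n) r w).
  by have [sT _ _] := ps n; exact: (@simple_process_comp _ _ _ T (s n) sT (xi n) (clip K) r w c0).
have spd n r w : simple_process T (s n) (xd n) r w =
    simple_process T (s n) (xi n) r w - clip K (simple_process T (s n) (xi n) r w).
  have [sT _ _] := ps n; apply: (@simple_process_comp _ _ _ T (s n) sT (xi n) (fun x => x - clip K x) r w).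
  by rewrite c0 subr0.
have mclip : measurable_fun setT (clip K) by exact: measurable_clip.
exists (fun n => simple_process T (s n) (xk n)), (fun n => simple_integral T B (s n) (xk n)).
have lei (Z Z' : R -> Omega -> R) w :
    measurable_fun `]0, T]%classic (Z ^~ w) -> measurable_fun `[0, T]%classic (Z' ^~ w) ->
    {ae mu, forall r, 0 <= r <= T -> `|Z r w| <= `|Z' r w|} ->
    (\int[mu]_(r in `]0%R, T]) (Z r w ^+ 2)%:E <= \int[mu]_(r in `[0%R, T]) (Z' r w ^+ 2)%:E)%E.
  move=> mZ mZ' ZZ'.
  have mZ'' : measurable_fun `]0, T]%classic (Z' ^~ w).
    by apply: measurable_funS mZ' => //; exact: subset_itv_oc_cc.
  rewrite -integral_itv_obnd_cbnd; last first.
    by apply/measurable_EFinP; exact: measurable_funX.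
  apply: ae_ge0_le_integral => //.
  - by move=> r _; rewrite lee_fin sqr_ge0.
  - by apply/measurable_EFinP; exact: measurable_funX.
  - by move=> r _; rewrite lee_fin sqr_ge0.
  - by apply/measurable_EFinP; exact: measurable_funX.
  - apply: (ae_lebesgueS _ ZZ') => r H' /=; rewrite in_itv/= => /andP[r0 rT].
    rewrite lee_fin -[leLHS]real_normK ?num_real// -[leRHS]real_normK ?num_real//.
    by rewrite lerXn2r ?nnegrE// H'// ltW.
split.
- move=> n; have [sT Fxi [M xiM]] := ps n; apply: simple_on_predictable => // [i i_s|i w _].
    by apply: measurable_wrt_comp (Fxi i i_s).
  exact: norm_clip_le.
- move=> t tT.
  have cD : cvg0_in_probability P (fun n w => `|simple_integral T B (s n) (xd n) t w|%:E).
    apply: cvg0_simple_integral => //.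
      move=> n; have [sT Fxi [M xiM]] := ps n; split=> //.
        move=> i i_s; apply: (@measurable_wrt_comp _ _ _ _ _ (fun x => x - clip K x)) (Fxi i i_s).
        exact: measurable_funB.
      exists (M + K) => i w i_s; apply: le_trans (ler_normB _ _) _.
      by apply: lerD; [exact: xiM|exact: norm_clip_le].
    apply: cvg0_probability_le cH => e e0; exists e => // n.
    apply: filterS good => w [mH HK] h; apply: le_trans h _.
    apply: le_trans (fine_le_ereal _) _.
      by apply: integral_ge0 => r _; rewrite lee_fin sqr_ge0.
    apply: (lei (simple_process T (s n) (xd n)) (fun r w => simple_process T (s n) (xi n) r w - H r w)).
    + exact: measurable_simple_process.
    + by apply: measurable_funB => //; exact: measurable_simple_process.
    + apply: (ae_lebesgueS _ HK) => r {}HK rT; rewrite spd; have := HK rT.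
      set x := simple_process _ _ _ _ _; set y := H r w => yK.
      case: (clipP x K0) => -[xk' ->]; rewrite ?subrr ?normr0//.
        move: yK; rewrite ler_norml => /andP[? ?].
        by rewrite !ler0_norm; lra.
      move: yK; rewrite ler_norml => /andP[? ?].
      by rewrite !ger0_norm; lra.
  apply: (cvg0_probability_or _ (cI t tT) cD) => e e0; exists (e / 2); first by rewrite divr_gt0.
  move=> n; apply/aeW => w; rewrite !lee_fin => h.
  case: (leP (e / 2) `|simple_integral T B (s n) (xi n) t w - I t w|) => h1; first by left.
  right.
  have E : simple_integral T B (s n) (xd n) t w =
      simple_integral T B (s n) (xi n) t w - simple_integral T B (s n) (xk n) t w.
    by rewrite /simple_integral -sumrB; apply: eq_bigr => i _; rewrite -mulrBl.
  have : `|simple_integral T B (s n) (xk n) t w - I t w| <=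
    `|simple_integral T B (s n) (xi n) t w - I t w| + `|simple_integral T B (s n) (xd n) t w|.
    rewrite (_ : simple_integral T B (s n) (xk n) t w - I t w =
      (simple_integral T B (s n) (xi n) t w - I t w) - simple_integral T B (s n) (xd n) t w).
      exact: ler_normB.
    by rewrite E; ring.
  lra.
- apply: cvg0_probability_le cH => e e0; exists e => // n.
  apply: filterS good => w [mH HK] h; apply: le_trans h _.
  apply: (lei (fun r w => simple_process T (s n) (xk n) r w - clip K (H r w)) (fun r w => simple_process T (s n) (xi n) r w - H r w)).
  + apply: measurable_funB; first exact: measurable_simple_process.
    apply: measurable_funS (measurableT_comp mclip mH) => //.
    exact: subset_itv_oc_cc.
  + by apply: measurable_funB => //; exact: measurable_simple_process.
  + by apply/aeW => r _; rewrite spk; exact: clip_lipschitz.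
Qed.

End ito_approximation.

(** * Bounded jointly measurable processes *)

Section bounded_processes.
Context (R : realType) (d : measure_display) (Omega : measurableType d).
Variables (P : probability Omega R) (T : R).
Local Notation mu := (@lebesgue_measure R).
Implicit Types (g : R -> Omega -> R) (M a b c : R).

(** Time 0 is left out: simple integrands are described on intervals open on the left, and their
    value at 0 is unconstrained. *)
Definition bounded_process g M : Prop :=
  measurable_fun (`]0, T]%classic `*` [set: Omega])
    (fun z : measurableTypeR R * Omega => g z.1 z.2) /\
  (forall r w, 0 < r <= T -> `|g r w| <= M).

Lemma bounded_process_section g M a b : bounded_process g M ->
  0 <= a -> a <= b -> b <= T ->
  [/\ forall w, mu.-integrable `]a, b] (EFin \o g ^~ w),
      measurable_fun setT (fun w => \int[mu]_(r in `]a, b]) g r w),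
      forall w, `|\int[mu]_(r in `]a, b]) g r w| <= M * (b - a) &
      integrable_rv P (fun w => \int[mu]_(r in `]a, b]) g r w)].
Proof.
move=> [mg gM] a0 ab bT.
have mg' : measurable_fun (`]a, b]%classic `*` [set: Omega])
    (fun z : measurableTypeR R * Omega => g z.1 z.2).
  apply: measurable_funS mg; first exact: measurableX.
  move=> -[r w] /= []; rewrite !in_itv/= => /andP[ar rb] _; split => //.
  by rewrite (le_lt_trans a0 ar) (le_trans rb bT).
have gM' (r : measurableTypeR R) w : `]a, b]%classic r -> `|g r w| <= M.
  rewrite /= in_itv/= => /andP[ar rb]; apply: gM.
  by rewrite (le_lt_trans a0 ar) (le_trans rb bT).
have mI : measurable (`]a, b]%classic : set (measurableTypeR R)) by [].
have fI := lebesgue_measure_itvoc_fin a b.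
have m1 := measurable_integral_section P mI fI mg' gM'.
have b1 w : `|\int[mu]_(r in `]a, b]) g r w| <= M * (b - a).
  by rewrite -(lebesgue_measure_itvoc ab); exact: (integral_section_bound mI fI mg' gM').
split=> // [w|]; first exact: (integrable_section mI fI mg' gM').
exact: (integrable_rv_bounded P m1 b1).
Qed.

Lemma bounded_process_cat g M a b c w : bounded_process g M ->
  0 <= a -> a <= c -> c <= b -> b <= T ->
  \int[mu]_(r in `]a, b]) g r w =
  \int[mu]_(r in `]a, c]) g r w + \int[mu]_(r in `]c, b]) g r w.
Proof.
move=> bg a0 ac cb bT; have [i _ _ _] := bounded_process_section bg a0 (le_trans ac cb) bT.
rewrite (itvoc_setU ac cb) Rintegral_setU//; last exact: itvoc_disj.
by rewrite -(itvoc_setU ac cb); exact: i.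
Qed.

Lemma bounded_processB g g' M M' : bounded_process g M -> bounded_process g' M' ->
  bounded_process (fun r w => g r w - g' r w) (M + M').
Proof.
move=> [m b] [m' b']; split; first exact: measurable_funB.
by move=> r w rT; rewrite (le_trans (ler_normB _ _))// lerD ?b ?b'.
Qed.

Lemma bounded_processM g g' M M' : bounded_process g M -> bounded_process g' M' ->
  bounded_process (fun r w => g r w * g' r w) (M * M').
Proof.
move=> [m b] [m' b']; split; first exact: measurable_funM.
by move=> r w rT; rewrite normrM ler_pM ?b ?b'.
Qed.

Lemma bounded_processX g M : bounded_process g M ->
  bounded_process (fun r w => g r w ^+ 2) (M ^+ 2).
Proof. by move=> b; rewrite expr2; exact: (bounded_processM b b). Qed.

End bounded_processes.

(** * Increments of the Ito integral as limits of simple integrals *)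

Section ito_integral_limit.
Context (R : realType) (d : measure_display) (Omega : measurableType d).
Variables (P : probability Omega R) (T : R) (F : R -> set_system Omega).
Variable B : R -> Omega -> R.
Local Notation mu := (@lebesgue_measure R).
Hypothesis hF : filtration T F.
Hypothesis hB : brownian_motion P T F B.
Hypothesis T0 : 0 < T.
Variables (K : R) (h J : nat -> R -> Omega -> R) (I H : R -> Omega -> R).
Hypothesis hJ : forall n, simple_on T F B K (h n) (J n) 0 T.
Hypothesis mI : forall t, 0 <= t <= T -> measurable_fun setT (I t).
Hypothesis cI : forall t, 0 <= t <= T ->
  cvg0_in_probability P (fun n w => `|J n t w - I t w|%:E).
Hypothesis bH : bounded_process T H K.
Hypothesis cH : cvg0_in_probability P (fun n w =>
  (\int[mu]_(r in `]0%R, T]) ((h n r w - H r w) ^+ 2)%:E)%E).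

Lemma simple_bounded_process n : bounded_process T (h n) K.
Proof.
split; first exact: (simple_on_measurable hF (hJ n)).
by move=> r w; apply: (simple_on_bound (hJ n)).
Qed.

Let bD n : bounded_process T (fun r w => (h n r w - H r w) ^+ 2) ((K + K) ^+ 2).
Proof. by apply: bounded_processX; apply: bounded_processB => //; exact: simple_bounded_process. Qed.

(** Squared L^2 distance of the integrands over ]a, b]. It is additive in the interval, so the
    errors of all cells of a grid sum up to at most the global error. *)
Definition simple_error n a b :=
  \int[P]_w \int[mu]_(r in `]a, b]) ((h n r w - H r w) ^+ 2).

Lemma simple_error_ge0 n a b : 0 <= simple_error n a b.
Proof. by apply: exp_ge0 => w; apply: Rintegral_ge0 => r _; exact: sqr_ge0. Qed.

Lemma simple_error_cat n a c b : 0 <= a -> a <= c -> c <= b -> b <= T ->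
  simple_error n a b = simple_error n a c + simple_error n c b.
Proof.
move=> a0 ac cb bT; have cT := le_trans cb bT; have c0 := le_trans a0 ac.
have [_ _ _ i1] := bounded_process_section P (bD n) a0 ac cT.
have [_ _ _ i2] := bounded_process_section P (bD n) c0 cb bT.
rewrite /simple_error -(expD i1 i2); apply: eq_Rintegral => w _.
exact: (bounded_process_cat P w (bD n)).
Qed.

Lemma simple_error_le n a b : 0 <= a -> a <= b -> b <= T ->
  simple_error n a b <= simple_error n 0 T.
Proof.
move=> a0 ab bT; rewrite (simple_error_cat n (lexx 0) a0 (le_trans ab bT) (lexx T)).
rewrite (simple_error_cat n a0 ab bT (lexx T)).
by rewrite addrCA lerDl addr_ge0 ?simple_error_ge0.
Qed.

(** Convergence in probability becomes convergence in expectation because both integrands are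
    bounded by [K]. *)
Lemma cvg_simple_error : simple_error n 0 T @[n --> \oo] --> (0 : R).
Proof.
have S n := bounded_process_section P (bD n) (lexx 0) (ltW T0) (lexx T).
apply: (@cvg0_exp_bounded _ _ _ _ _ ((K + K) ^+ 2 * (T - 0))).
- by move=> n; case: (S n).
- move=> n w; rewrite Rintegral_ge0/=; last by move=> r _; exact: sqr_ge0.
  by case: (S n) => _ _ /(_ w) + _; apply: le_trans; exact: ler_norm.
- apply: cvg0_probability_le cH => e e0; exists e => // n; apply/aeW => w h1.
  apply: (le_trans h1); apply: fine_le_ereal.
  by apply: integral_ge0 => r _; rewrite lee_fin sqr_ge0.
Qed.

(** The isometry is applied to the difference of two simple integrands, which are then both compared
    with [H]. *)
Lemma exp_simple_diff m n a b : 0 <= a -> a <= b -> b <= T ->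
  square_integrable P (fun w => (J m b w - J n b w) - (J m a w - J n a w)) /\
  \int[P]_w (((J m b w - J n b w) - (J m a w - J n a w)) ^+ 2) <=
  2 * simple_error m a b + 2 * simple_error n a b.
Proof.
move=> a0 ab bT.
have S := simple_on_sub hF (simple_onB hF (hJ m) (hJ n)) a0 ab bT.
have [_ s1 _] := simple_on_martingale hF hB S; split=> //.
rewrite (ito_isometry hF hB S).
have [im _ _ jm] := bounded_process_section P (bD m) a0 ab bT.
have [in_ _ _ jn] := bounded_process_section P (bD n) a0 ab bT.
have bd : bounded_process T (fun r w => (h m r w - h n r w) ^+ 2) ((K + K) ^+ 2).
  by apply: bounded_processX; apply: bounded_processB => //; exact: simple_bounded_process.
have [i0 _ _ j0] := bounded_process_section P bd a0 ab bT.
have jm2 := integrable_rvZ 2 jm; have jn2 := integrable_rvZ 2 jn.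
apply: (@le_trans _ _ (\int[P]_w (2 * (\int[mu]_(r in `]a, b]) ((h m r w - H r w) ^+ 2)) +
   2 * (\int[mu]_(r in `]a, b]) ((h n r w - H r w) ^+ 2))))); last first.
  by rewrite (expD jm2 jn2) (expZ 2 jm) (expZ 2 jn).
apply: (exp_le j0 (integrable_rvD jm2 jn2)).
move=> w; have mI' : measurable (`]a, b]%classic : set (measurableTypeR R)) by [].
have im2 := integrableZl mI' 2 (im w); have in2 := integrableZl mI' 2 (in_ w).
rewrite -(RintegralZl 2 mI' (im w)) -(RintegralZl 2 mI' (in_ w)) -(RintegralD mI' im2 in2).
apply: (le_Rintegral mI' (i0 w) (integrableD mI' im2 in2)).
- move=> r _; have := sqr_ge0 ((h m r w - H r w) + (h n r w - H r w)); nra.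
Qed.

(** As m grows, [J m - J n] tends to [I - J n] in probability while its second moment is at most 2
    err_n plus a vanishing term. Fatou's lemma doubles this into 4 err_n. Square integrability of
    the increments of [I] is a by-product. *)
Lemma exp_ito_approx n a b : 0 <= a -> a <= b -> b <= T ->
  square_integrable P (fun w => (I b w - I a w) - (J n b w - J n a w)) /\
  \int[P]_w (((I b w - I a w) - (J n b w - J n a w)) ^+ 2) <= 4 * simple_error n a b.
Proof.
move=> a0 ab bT; have aT := le_trans ab bT; have b0 := le_trans a0 ab.
have aT' : 0 <= a <= T by rewrite a0.
have bT' : 0 <= b <= T by rewrite b0.
have [mJ [sJm _] _] := simple_on_martingale hF hB (simple_on_sub hF (hJ n) a0 ab bT).
have mY : measurable_fun setT (fun w => (I b w - I a w) - (J n b w - J n a w)).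
  by apply: measurable_funB => //; apply: measurable_funB; exact: mI.
have key (eta : R) : 0 < eta ->
    square_integrable P (fun w => (I b w - I a w) - (J n b w - J n a w)) /\
    \int[P]_w (((I b w - I a w) - (J n b w - J n a w)) ^+ 2) <=
    2 * (2 * simple_error n a b + eta).
  move=> eta0.
  apply: (@fatou_square_in_probability _ _ _ P _ (fun m w => (J m b w - J n b w) - (J m a w - J n a w))) => //.
  - by move=> m; case: (exp_simple_diff m n a0 ab bT).
  - apply: (cvg0_probability_or _ (cI bT') (cI aT')) => e e0; exists (e / 2); first by rewrite divr_gt0.
    move=> m; apply/aeW => w; rewrite !lee_fin => H1.
    case: (leP (e / 2) `|J m b w - I b w|) => h1; [by left|right].
    have : `|(J m b w - J n b w) - (J m a w - J n a w) - ((I b w - I a w) - (J n b w - J n a w))| <=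
       `|J m b w - I b w| + `|J m a w - I a w|.
      rewrite (_ : (J m b w - J n b w) - (J m a w - J n a w) - ((I b w - I a w) - (J n b w - J n a w)) =
        (J m b w - I b w) - (J m a w - I a w)); first exact: ler_normB.
      by ring.
    lra.
  - have := cvg_simple_error => /cvgr0Pnorm_le/(_ (eta / 2)).
    move=> /(_ (divr_gt0 eta0 (ltr0n _ 2))); apply: filterS => m Hm.
    have [_ h1] := exp_simple_diff m n a0 ab bT.
    have h2 := simple_error_le m a0 ab bT.
    move: Hm; rewrite ger0_norm ?simple_error_ge0// => Hm; apply: (le_trans h1).
    rewrite addrC lerD2l -ler_pdivlMl// mulrC; exact: le_trans h2 Hm.
split; first by case: (key 1 ltr01).
apply/ler_addgt0Pl => e e0; have [_ h1] := key (e / 2) (divr_gt0 e0 (ltr0n _ 2)).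
by apply: (le_trans h1); move: (simple_error n a b) => x; lra.
Qed.

Lemma square_integrable_ito a b : 0 <= a -> a <= b -> b <= T ->
  square_integrable P (fun w => I b w - I a w).
Proof.
move=> a0 ab bT; have [s1 _] := exp_ito_approx 0 a0 ab bT.
have [_ s2 _] := simple_on_martingale hF hB (simple_on_sub hF (hJ 0%N) a0 ab bT).
have := square_integrableD s1 s2; congr (square_integrable P).
by apply/funext => w; rewrite subrK.
Qed.

(** The identity holds exactly for each simple integral, and the substitution of [J N] for [I] costs
    at most [M] times the mean absolute error. *)
Lemma exp_ito_martingale Y M a b : 0 <= a -> a <= b -> b <= T ->
  measurable_wrt (F a) Y -> (forall w, `|Y w| <= M) ->
  \int[P]_w (Y w * (I b w - I a w)) = 0.
Proof.
move=> a0 ab bT FY YM; have aT := le_trans ab bT.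
have aT' : 0 <= a <= T by rewrite a0.
have mY := measurable_wrt_measurable hF aT' FY.
have sY := square_integrable_bounded P mY YM.
have M0 : 0 <= M by apply: le_trans (YM point).
apply/eqP; rewrite -normr_le0; apply/ler_addgt0Pl => e e0; rewrite addr0.
(* Half of [e / (M + 1)] is spent on [l] itself; the choice of [N] spends the other half on the
   second moment divided by [l]. *)
pose l := e / 2 / (M + 1).
have l0 : 0 < l by rewrite divr_gt0 ?divr_gt0// ltr_wpDl.
have := cvg_simple_error => /cvgr0Pnorm_le/(_ (l * (e / 2 / (4 * (M + 1))))).
have c0 : 0 < l * (e / 2 / (4 * (M + 1))).
  by rewrite mulr_gt0// divr_gt0 ?divr_gt0// mulr_gt0// ltr_wpDl.
move=> /(_ c0)[N _ /(_ N (leqnn N))]; rewrite /= ger0_norm ?simple_error_ge0// => HN.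
have [s1 e1] := exp_ito_approx N a0 ab bT.
have [_ s2 e2] := simple_on_martingale hF hB (simple_on_sub hF (hJ N) a0 ab bT).
have -> : \int[P]_w (Y w * (I b w - I a w)) =
    \int[P]_w (Y w * ((I b w - I a w) - (J N b w - J N a w))).
  rewrite -[LHS]subr0 -(e2 _ FY sY) -expB.
  - by apply: eq_Rintegral => w _; rewrite -mulrBr.
  - exact: (integrable_rvM sY (square_integrable_ito a0 ab bT)).
  - exact: integrable_rvM.
apply: (@le_trans _ _ (M * \int[P]_w `|(I b w - I a w) - (J N b w - J N a w)|)).
  have i1 := integrable_rv_norm (square_integrableE s1).
  rewrite -expZ//; apply: exp_norm_le; first exact: integrable_rvM.
    exact: integrable_rvZ.
  by move=> w; rewrite normrM ler_wpM2r.
have h1 := exp_sqr_le s1 l0.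
have h2 := simple_error_le N a0 ab bT.
have h3 : l^-1 * (4 * simple_error N 0 T) <= e / 2 / (M + 1).
  rewrite ler_pdivrMl// (le_trans (ler_wpM2l _ HN))//.
  by rewrite le_eqVlt; apply/orP; left; apply/eqP; field; rewrite gt_eqF// ltr_wpDl.
apply: (@le_trans _ _ (M * (e / (M + 1)))).
  rewrite ler_wpM2l//; apply: (le_trans h1).
  have -> : e / (M + 1) = l + e / 2 / (M + 1) by rewrite /l; field; rewrite gt_eqF// ltr_wpDl.
  apply: (lerD (lexx l)); apply: le_trans _ h3; apply: ler_wpM2l.
    by rewrite invr_ge0 ltW.
  by apply: (le_trans e1); apply: ler_wpM2l.
by rewrite mulrCA ler_piMr ?(ltW e0)// ler_pdivrMr ?mul1r ?lerDl// ltr_wpDl.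
Qed.

End ito_integral_limit.

(** * Sums along a subdivision *)

Section steps.
Context (R : realType).
Implicit Types (a b : R) (s : seq R) (f g : R -> R -> R) (Q : R -> R -> Prop).

(** A grid is a first point with the list of the following ones: gluing grids is concatenation, and
    sums over cells are handled by structural induction without indices. *)
Fixpoint steps_sum f a s : R :=
  if s is b :: s' then f a b + steps_sum f b s' else 0.

Fixpoint all_steps Q a s : Prop :=
  if s is b :: s' then Q a b /\ all_steps Q b s' else True.

Lemma all_steps_cat Q a s1 s2 :
  all_steps Q a (s1 ++ s2) <-> all_steps Q a s1 /\ all_steps Q (last a s1) s2.
Proof.
elim: s1 a => [|b s1 IH] a /=; first by split=> [|[]].
by rewrite IH; split=> [[? []]|[[]]].
Qed.

Lemma steps_sum_telescope (f : R -> R) a s :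
  steps_sum (fun a b => f b - f a) a s = f (last a s) - f a.
Proof. by elim: s a => [|b s IH] a /=; rewrite ?subrr// IH; ring. Qed.

Lemma steps_sumD f g a s :
  steps_sum (fun a b => f a b + g a b) a s = steps_sum f a s + steps_sum g a s.
Proof. by elim: s a => [|b s IH] a /=; rewrite ?addr0// IH; ring. Qed.

Lemma steps_sumZ (c : R) f a s :
  steps_sum (fun a b => c * f a b) a s = c * steps_sum f a s.
Proof. by elim: s a => [|b s IH] a /=; rewrite ?mulr0// IH; ring. Qed.

Lemma eq_steps_sum Q f g a s : all_steps Q a s ->
  (forall a b, Q a b -> f a b = g a b) -> steps_sum f a s = steps_sum g a s.
Proof. by move=> + E; elim: s a => [//|b s IH] a /= [/E -> /IH ->]. Qed.

Lemma le_steps_sum Q f g a s : all_steps Q a s ->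
  (forall a b, Q a b -> f a b <= g a b) -> steps_sum f a s <= steps_sum g a s.
Proof. by move=> + E; elim: s a => [//|b s IH] a /= [/E ? /IH ?]; exact: lerD. Qed.

Lemma steps_sum_ge0 Q f a s : all_steps Q a s ->
  (forall a b, Q a b -> 0 <= f a b) -> 0 <= steps_sum f a s.
Proof. by move=> + E; elim: s a => [//|b s IH] a /= [/E ? /IH ?]; exact: addr_ge0. Qed.

Lemma norm_steps_sum f a s :
  `|steps_sum f a s| <= steps_sum (fun a b => `|f a b|) a s.
Proof.
elim: s a => [|b s IH] a /=; first by rewrite normr0.
by rewrite (le_trans (ler_normD _ _))// lerD2l.
Qed.

End steps.

Section steps_expectation.
Context (R : realType) (d : measure_display) (Omega : measurableType d).
Variable P : probability Omega R.
Implicit Types (a b : R) (s : seq R) (Q : R -> R -> Prop) (f : R -> R -> Omega -> R).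

Lemma measurable_steps_sum Q f a s : all_steps Q a s ->
  (forall a b, Q a b -> measurable_fun setT (f a b)) ->
  measurable_fun setT (fun w => steps_sum (fun a b => f a b w) a s).
Proof.
move=> + E; elim: s a => [//|b s IH] a /= [/E ? /IH ?]; exact: measurable_funD.
Qed.

Lemma exp_steps_sum Q f a s : all_steps Q a s ->
  (forall a b, Q a b -> integrable_rv P (f a b)) ->
  integrable_rv P (fun w => steps_sum (fun a b => f a b w) a s) /\
  \int[P]_w steps_sum (fun a b => f a b w) a s =
    steps_sum (fun a b => \int[P]_w f a b w) a s.
Proof.
move=> + E; elim: s a => [|b s IH] a /=.
  by move=> _; split; [exact: integrable_rv_cst|exact: exp_cst].
move=> [/E i1 /IH [i2 e2]]; split; first exact: integrable_rvD.
by rewrite (expD i1 i2) e2.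
Qed.

End steps_expectation.

(** * Fine grids adapted to a simple integrand *)

Section grids.
Context (R : realType) (d : measure_display) (Omega : measurableType d).
Variables (T : R) (F : R -> set_system Omega) (B : R -> Omega -> R).
Hypothesis hF : filtration T F.

(** Cells of length [dl] are cut off on the left until the rest is no longer than [dl]; the
    induction is on a number of cells that suffices. *)
Lemma elementary_on_grid K (h J : R -> Omega -> R) (a b dl : R) :
  elementary_on T F B K h J a b -> 0 < dl ->
  exists s, all_steps (fun u v => elementary_on T F B K h J u v /\ v - u <= dl) a s /\
    last a s = b.
Proof.
move=> H dl0; have [[a0 ab bT] _ _ _] := H.
have [n Hn] : exists n : nat, b - a <= n%:R * dl.
  exists (Num.truncn ((b - a) / dl)).+1; rewrite -ler_pdivrMr//.
  exact/ltW/truncnS_gt.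
elim: n a H {a0} ab Hn => [|n IH] a H ab.
  by rewrite mul0r subr_le0 leNgt ab.
case: (leP (b - a) dl) => bad Hn; first by exists [:: b].
have adb : a + dl < b by rewrite -ltrBrDl.
have H1 : elementary_on T F B K h J a (a + dl).
  by apply: (elementary_on_sub H _ _ _ hF) => //; [rewrite ltrDl|exact: ltW].
have H2 : elementary_on T F B K h J (a + dl) b.
  by apply: (elementary_on_sub H _ _ _ hF) => //; rewrite lerDl ltW.
have [|s [Hs ls]] := IH _ H2 adb.
  by move: Hn; rewrite -natr1 mulrDl mul1r => Hn; rewrite opprD addrA lerBlDr.
by exists ((a + dl) :: s); split=> //=; split=> //; split=> //; rewrite addrC addKr.
Qed.

(** On each cell the integrand is constant in time, so that the simple integral increases by a
    coefficient times one Brownian increment. This is what the one-step estimates require, besides a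
    small length. *)
Lemma simple_on_grid K (h J : R -> Omega -> R) (a b dl : R) :
  simple_on T F B K h J a b -> 0 < dl ->
  exists s, all_steps (fun u v => elementary_on T F B K h J u v /\ v - u <= dl) a s /\
    last a s = b.
Proof.
move=> H dl0; elim: H => [{}a _|{}a {}b H|{}a c {}b _ [s1 [H1 l1]] _ [s2 [H2 l2]]].
- by exists [::].
- exact: elementary_on_grid.
- exists (s1 ++ s2); rewrite last_cat l1; split=> //.
  by apply/all_steps_cat; rewrite l1.
Qed.

End grids.

(** * Elementary inequalities *)

Section real_inequalities.
Context (R : realType).
Implicit Types x y z p q c l K : R.

Lemma ler_sqr_norm y K : `|y| <= K -> y ^+ 2 <= K ^+ 2.
Proof.
move=> yK; rewrite -(real_normK (num_real y)) lerXn2r ?nnegrE//.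
exact: le_trans yK.
Qed.

Lemma sqr_le_double_shift z p c : p ^+ 2 <= c -> z ^+ 2 <= 2 * (c + (z - p) ^+ 2).
Proof. by have := sqr_ge0 (z - 2 * p); nra. Qed.

(** Young's inequality multiplied by [l]; the next lemma is the case [q = p ^+ 2]. *)
Lemma mul_le_sqr_weighted p q l : l * (p * q) <= l * (l * p ^+ 2) + q ^+ 2.
Proof. by have := sqr_ge0 (2 * l * p - q); have := sqr_ge0 q; nra. Qed.

Lemma cube_le_sqr_weighted p l : l * p ^+ 3 <= l * (l * p ^+ 2) + (p ^+ 2) ^+ 2.
Proof. by have := sqr_ge0 (2 * l * p - p ^+ 2); have := sqr_ge0 (p ^+ 2); nra. Qed.

End real_inequalities.

(** * Expected increment of a smooth function over one cell *)

Section step_estimates.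
Context (R : realType) (d : measure_display) (Omega : measurableType d).
Variables (P : probability Omega R) (T : R) (F : R -> set_system Omega).
Variable B : R -> Omega -> R.
Hypothesis hF : filtration T F.
Hypothesis hB : brownian_motion P T F B.
Variables (K e a b : R) (h J : R -> Omega -> R) (DI X : Omega -> R).
Hypothesis hab : elementary_on T F B K h J a b.
Hypothesis DI_mart : forall Y M, measurable_wrt (F a) Y -> (forall w, `|Y w| <= M) ->
  \int[P]_w (Y w * DI w) = 0.
Hypothesis sDI : square_integrable P DI.
Hypothesis sDIJ : square_integrable P (fun w => DI w - (J b w - J a w)).
Hypothesis eDIJ : \int[P]_w ((DI w - (J b w - J a w)) ^+ 2) <= e.
Hypothesis FX : measurable_wrt (F a) X.
Variables (f f1 f2 f3 : R -> R) (M0 M1 M2 M3 : R).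
Hypothesis df : forall x, is_derive x (1 : R) f (f1 x).
Hypothesis df1 : forall x, is_derive x (1 : R) f1 (f2 x).
Hypotheses (fM0 : forall x, `|f x| <= M0) (f1M1 : forall x, `|f1 x| <= M1).
Hypothesis f2M2 : forall x, `|f2 x| <= M2.

Lemma is_derive_measurable (u u1 : R -> R) :
  (forall x, is_derive x (1 : R) u (u1 x)) -> measurable_fun setT u.
Proof.
move=> du; apply: continuous_measurable_fun => x.
by apply/differentiable_continuous/derivable1_diffP; exact: (@ex_derive _ _ _ _ _ _ _ (du x)).
Qed.

Let a0 : 0 <= a. Proof. by case: hab => [[]]. Qed.
Let ab : a <= b. Proof. by case: hab => [[? /ltW]]. Qed.
Let bT : b <= T. Proof. by case: hab => [[]]. Qed.
Let aT : 0 <= a <= T. Proof. by rewrite a0 (le_trans ab bT). Qed.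
Let mX : measurable_fun setT X. Proof. exact: (measurable_wrt_measurable hF aT FX). Qed.
Let mDI : measurable_fun setT DI. Proof. by case: sDI. Qed.
Let Fh : measurable_wrt (F a) (h b). Proof. by case: hab. Qed.
Let mh : measurable_fun setT (h b). Proof. exact: (measurable_wrt_measurable hF aT Fh). Qed.
Let hK w : `|h b w| <= K. Proof. by case: hab. Qed.
Let DJE w : J b w - J a w = h b w * (B b w - B a w).
Proof. by case: hab => _ _ _ H; apply: (H w b _).2; rewrite lexx ab. Qed.
Let M2_ge0 : 0 <= M2. Proof. exact: le_trans (normr_ge0 _) (f2M2 0). Qed.
Let iE2 := sDIJ.2.

Let incr := integrable_increment hF hB a0 ab bT.

Let exp_DB2 : integrable_rv P (fun w => (B b w - B a w) ^+ 2) /\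
  \int[P]_w ((B b w - B a w) ^+ 2) = b - a.
Proof.
have c1 : measurable_wrt (F a) (cst 1 : Omega -> R) by exact: (measurable_wrt_cst hF).
have [_] := exp_increment2 hF hB a0 ab bT c1 (integrable_rv_cst P 1).
rewrite exp_cst mul1r => E; split; first by case: incr.
by rewrite -[RHS]E; apply: eq_Rintegral => w _; rewrite mul1r.
Qed.

Let mf : measurable_fun setT f. Proof. exact: is_derive_measurable df. Qed.
Let mf1 : measurable_fun setT f1. Proof. exact: is_derive_measurable df1. Qed.

Let G w := f (X w + DI w) - f (X w).

Let mG : measurable_fun setT G.
Proof.
apply: measurable_funB; apply: measurableT_comp => //.
exact: measurable_funD.
Qed.

Lemma integrable_step : integrable_rv P G.
Proof.
apply: (@integrable_rv_bounded _ _ _ _ _ (M0 + M0)) => // w.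
by rewrite (le_trans (ler_normB _ _))// lerD.
Qed.

Let Y1 w := f1 (X w) * DI w.

Let FY : measurable_wrt (F a) (fun w => f1 (X w)).
Proof. exact: measurable_wrt_comp. Qed.

Let iY1 : integrable_rv P Y1.
Proof.
apply: (integrable_rvM _ sDI); apply: (square_integrable_bounded P _ (M := M1)).
  exact: measurableT_comp.
by move=> w; exact: f1M1.
Qed.

Let eY1 : \int[P]_w Y1 w = 0.
Proof. by apply: (DI_mart FY) => w; exact: f1M1. Qed.

(** The linear Taylor term has zero expectation, because [f1 (X w)] is bounded and known at time
    [a]. The square of [DI] is split into that of the simple increment and the error. This rough
    bound uses two derivatives of [f] only; it serves to bound the expected local time. *)
Lemma exp_step_order1 :
  `|\int[P]_w G w| <= 2 * M2 * (K ^+ 2 * (b - a) + e).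
Proof.
have -> : \int[P]_w G w = \int[P]_w (G w - Y1 w).
  by rewrite (expB integrable_step iY1) eY1 subr0.
have [iB eB] := exp_DB2.
have i1 := integrable_rvZ (K ^+ 2) iB.
have i2 := integrable_rvD i1 iE2.
apply: (@le_trans _ _ (\int[P]_w (2 * M2 * (K ^+ 2 * (B b w - B a w) ^+ 2 +
    (DI w - (J b w - J a w)) ^+ 2)))).
  apply: exp_norm_le.
  - exact: (integrable_rvB integrable_step iY1).
  - exact: integrable_rvZ.
  move=> w; apply: (@le_trans _ _ (M2 * `|DI w| ^+ 2)).
    exact: (@taylor_order1 _ f f1 f2).
  rewrite -[leRHS]mulrA [leRHS]mulrCA ler_wpM2l// real_normK ?num_real//.
  apply: sqr_le_double_shift.
  by rewrite DJE exprMn ler_wpM2r ?sqr_ge0// ler_sqr_norm.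
rewrite (expZ _ i2) (expD i1 iE2) (expZ _ iB) eB.
by rewrite ler_wpM2l ?mulr_ge0// lerD2l.
Qed.

Hypothesis df2 : forall x, is_derive x (1 : R) f2 (f3 x).
Hypothesis f3M3 : forall x, `|f3 x| <= M3.

Let mf2 : measurable_fun setT f2. Proof. exact: is_derive_measurable df2. Qed.
Let M3_ge0 : 0 <= M3. Proof. exact: le_trans (normr_ge0 _) (f3M3 0). Qed.

Let Y2 w := f2 (X w) * h b w ^+ 2.
Let FY2 : measurable_wrt (F a) Y2.
Proof.
apply: (measurable_wrtM hF aT); first exact: measurable_wrt_comp.
by apply: (@measurable_wrt_comp _ _ _ _ _ (fun x => x ^+ 2)) => //; exact: exprn_measurable.
Qed.

Lemma integrable_step_order2 : integrable_rv P Y2.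
Proof.
apply: (@integrable_rv_bounded _ _ _ _ _ (M2 * K ^+ 2)).
  exact: (measurable_wrt_measurable hF aT FY2).
move=> w; rewrite normrM ler_pM// normrX lerXn2r// nnegrE.
exact: le_trans (hK w).
Qed.

(** The increment is [u + eps], with [u = h * dB] the simple part. Taylor's formula has order two in
    [u] and one in [eps], and the cross term is bounded by [M2 * |u| * |eps|]. Young's inequality
    with free weights [l] and [th] leaves multiples of [u ^+ 2] that become small with the weights,
    of [eps ^+ 2], of which the sum over the cells is the approximation error, and of [u ^+ 4], of
    order [(b - a) ^+ 2]. *)
Lemma exp_step_order2 (l th : R) : 0 < l -> 0 < th ->
  `|\int[P]_w G w - 2^-1 * (\int[P]_w Y2 w * (b - a))| <=
  (M2 * l + M3 * th) * (K ^+ 2 * (b - a)) + M2 * (1 + l^-1) * e +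
  M3 * th^-1 * (K ^+ 4 * (512 * expR 2^-1 * (b - a) ^+ 2)).
Proof.
move=> l0 th0.
have [iY eY] := exp_increment2 hF hB a0 ab bT FY2 integrable_step_order2.
have iYh := integrable_rvZ 2^-1 iY.
have iGY := integrable_rvB integrable_step iY1.
have -> : \int[P]_w G w - 2^-1 * (\int[P]_w Y2 w * (b - a)) =
    \int[P]_w ((G w - Y1 w) - 2^-1 * (Y2 w * (B b w - B a w) ^+ 2)).
  by rewrite (expB iGY iYh) (expB integrable_step iY1) eY1 subr0 (expZ _ iY) eY.
have [iB eB] := exp_DB2.
have [_ _ iB4] := incr.
have eB4 := exp_increment4 hF hB a0 ab bT.
have i1 := integrable_rvZ (M2 * l + M3 * th) (integrable_rvZ (K ^+ 2) iB).
have i2 := integrable_rvZ (M2 * (1 + l^-1)) iE2.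
have i3 := integrable_rvZ (M3 * th^-1) (integrable_rvZ (K ^+ 4) iB4).
have i12 := integrable_rvD i1 i2.
apply: (@le_trans _ _ (\int[P]_w ((M2 * l + M3 * th) * (K ^+ 2 * (B b w - B a w) ^+ 2) +
   M2 * (1 + l^-1) * (DI w - (J b w - J a w)) ^+ 2 +
   M3 * th^-1 * (K ^+ 4 * (B b w - B a w) ^+ 4)))); last first.
  rewrite (expD i12 i3) (expD i1 i2) (expZ _ (integrable_rvZ (K ^+ 2) iB)) (expZ _ iB) eB.
  rewrite (expZ _ iE2) (expZ _ (integrable_rvZ (K ^+ 4) iB4)) (expZ _ iB4).
  have l1 : 0 <= 1 + l^-1 by rewrite addr_ge0// invr_ge0 ltW.
  have th1 : 0 <= th^-1 by rewrite invr_ge0 ltW.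
  have K4 : 0 <= K ^+ 4 by rewrite exprn_even_ge0.
  apply: lerD; [apply: lerD => //|].
    by apply: ler_wpM2l => //; exact: mulr_ge0.
  by apply: ler_wpM2l; [exact: mulr_ge0|apply: ler_wpM2l].
apply: (exp_norm_le (integrable_rvB iGY iYh) (integrable_rvD i12 i3)).
move=> w; rewrite /G /Y1 /Y2 DJE.
set x := X w; set y := h b w; set z := B b w - B a w; set v := DI w.
pose u := y * z; pose eps := v - u.
have t1 : `|f (x + u) - f x - f1 x * u - 2^-1 * f2 x * u ^+ 2| <= M3 * `|u| ^+ 3.
  exact: (@taylor_order2 _ f f1 f2 f3).
have t2 : `|f (x + u + eps) - f (x + u) - f1 (x + u) * eps| <= M2 * `|eps| ^+ 2.
  exact: (@taylor_order1 _ f f1 f2).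
have t3 : `|f1 (x + u) - f1 x| <= M2 * `|u|.
  by have := @mean_value_bound _ f1 f2 x (x + u) M2 df1; rewrite (addrC x) addrK; apply.
(* The derivative of [f] at [x + u] has to be exchanged for that at [x], the only one known at time
   [a]: this is the last term. *)
have -> : f (x + v) - f x - f1 x * v - 2^-1 * (f2 x * y ^+ 2 * z ^+ 2) =
    (f (x + u) - f x - f1 x * u - 2^-1 * f2 x * u ^+ 2) +
    (f (x + u + eps) - f (x + u) - f1 (x + u) * eps) + (f1 (x + u) - f1 x) * eps.
  have -> : x + u + eps = x + v by rewrite /eps; ring.
  by rewrite /eps /u; ring.
apply: le_trans (ler_normD _ _) _.
apply: le_trans (lerD (ler_normD _ _) (lexx _)) _.
rewrite [X in _ + X <= _]normrM.
have t4 := ler_wpM2r (normr_ge0 eps) t3.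
apply: le_trans (lerD (lerD t1 t2) t4) _.
have k2 : u ^+ 2 <= K ^+ 2 * z ^+ 2.
  by rewrite exprMn ler_wpM2r ?sqr_ge0//; exact/ler_sqr_norm/hK.
have k4 : u ^+ 4 <= K ^+ 4 * z ^+ 4.
  rewrite -exprMn !(exprM _ 2 2) lerXn2r ?nnegrE ?sqr_ge0//.
  by rewrite exprMn.
have am1 : `|u| * `|eps| <= l * u ^+ 2 + l^-1 * eps ^+ 2.
  rewrite -(ler_pM2l l0) mulrDr mulVKf ?gt_eqF// -[u ^+ 2]real_normK ?num_real//.
  rewrite -[eps ^+ 2]real_normK ?num_real//.
  exact: mul_le_sqr_weighted.
have am2 : `|u| ^+ 3 <= th * u ^+ 2 + th^-1 * u ^+ 4.
  rewrite -(ler_pM2l th0) mulrDr mulVKf ?gt_eqF// (exprM _ 2 2).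
  rewrite -[u ^+ 2]real_normK ?num_real//.
  exact: cube_le_sqr_weighted.
have e2 : `|eps| ^+ 2 = (v - y * z) ^+ 2 by rewrite real_normK ?num_real.
rewrite e2.
have b1 : M3 * `|u| ^+ 3 <= M3 * th * (K ^+ 2 * z ^+ 2) + M3 * th^-1 * (K ^+ 4 * z ^+ 4).
  have -> : M3 * th * (K ^+ 2 * z ^+ 2) + M3 * th^-1 * (K ^+ 4 * z ^+ 4) =
    M3 * (th * (K ^+ 2 * z ^+ 2) + th^-1 * (K ^+ 4 * z ^+ 4)) by ring.
  apply: ler_wpM2l => //; apply: (le_trans am2); apply: lerD; apply: ler_wpM2l => //.
    exact: ltW.
  by rewrite invr_ge0 ltW.
have b2 : M2 * `|u| * `|eps| <= M2 * l * (K ^+ 2 * z ^+ 2) + M2 * l^-1 * (v - y * z) ^+ 2.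
  have -> : M2 * l * (K ^+ 2 * z ^+ 2) + M2 * l^-1 * (v - y * z) ^+ 2 =
    M2 * (l * (K ^+ 2 * z ^+ 2) + l^-1 * (v - y * z) ^+ 2) by ring.
  rewrite -mulrA; apply: ler_wpM2l => //; apply: (le_trans am1); apply: lerD => //.
  by apply: ler_wpM2l => //; exact: ltW.
apply: le_trans (lerD (lerD b1 (lexx _)) b2) _.
by rewrite le_eqVlt; apply/orP; left; apply/eqP; ring.
Qed.

End step_estimates.

(** * Local time *)

Section continuous_paths_lemmas.
Context (R : realType).
Implicit Types (g : R -> R) (a b e T : R).

Lemma continuous_within_near g a b x : {within `[a, b], continuous g} -> a <= x <= b ->
  forall e, 0 < e -> exists2 dl : R, 0 < dl &
    forall y, a <= y <= b -> `|x - y| < dl -> `|g x - g y| < e.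
Proof.
move=> cg xab e e0.
have xin : `[a, b]%classic x by rewrite /= in_itv.
have : within `[a, b] (nbhs x) [set y | `|g x - g y| < e].
  by rewrite nbhs_subspace_in//; have /cvgrPdist_lt/(_ _ e0) := cg x.
move=> -[dl /= dl0 H]; exists dl => // y yab xy.
by apply: H => //=; rewrite in_itv.
Qed.

(** Heine's theorem through near-covering compactness: the property quantified over is that a
    modulus [dl] works at [x] for all [y], and it holds near each point of the segment for small
    [dl]. *)
Lemma uniform_continuity g a b : {within `[a, b], continuous g} ->
  forall e, 0 < e -> exists2 dl : R, 0 < dl &
    forall x y, a <= x <= b -> a <= y <= b -> `|x - y| <= dl -> `|g x - g y| <= e.
Proof.
move=> cg e e0.
pose Q (dl x : R) := a <= x <= b -> forall y, a <= y <= b -> `|x - y| <= dl -> `|g x - g y| <= e.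
have /compact_near_coveringP/(_ _ (0 : R)^'+ Q _) := @segment_compact R a b.
case.
  move=> x; rewrite /= in_itv/= => xab.
  have [dl dl0 H] := continuous_within_near cg xab (divr_gt0 e0 (ltr0n _ 2)).
  exists (ball x (dl / 2), [set t | t < dl / 2]).
    split; first by apply: nbhsx_ballx; rewrite divr_gt0.
    by apply: nbhs_right_lt; rewrite divr_gt0.
  move=> [x' t] /= [xx' tdl] x'ab y yab x'y.
  rewrite /ball/= in xx'.
  have h1 := H _ x'ab (lt_le_trans xx' _).
  have h2 : `|x - y| < dl.
    rewrite (splitr dl); apply: le_lt_trans (ler_distD x' _ _) _.
    by rewrite ltrD// (le_lt_trans x'y).
  have h3 := H _ yab h2.
  rewrite (splitr e); apply: le_trans (ler_distD (g x) _ _) _.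
  rewrite lerD//; last exact: ltW.
  by rewrite distrC ltW// h1// ler_pdivrMr// ler_pMr// ler1n.
move=> r /= r0 H; exists (r / 2); first by rewrite divr_gt0.
move=> x y xab yab xy.
have hb : `|0 - r / 2| < r.
  by rewrite sub0r normrN gtr0_norm ?divr_gt0// ltr_pdivrMr// ltr_pMr// ltr1n.
have hx : `[a, b]%classic x by rewrite /= in_itv.
exact: (H (r / 2) hb (divr_gt0 r0 (ltr0n _ 2)) x hx xab y yab xy).
Qed.

Lemma within_continuous_measurable g a b : {within `[a, b], continuous g} ->
  measurable_fun `[a, b] g.
Proof. by move=> cg; apply: subspace_continuous_measurable_fun. Qed.

End continuous_paths_lemmas.

Section local_time.
Context (R : realType) (d : measure_display) (Omega : measurableType d).
Variables (P : probability Omega R) (T : R).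
Variables X L : R -> Omega -> R.
Hypothesis cX : continuous_paths P T X.
Hypothesis X0 : {ae P, forall w, forall t : R, 0 <= t <= T -> 0 <= X t w}.
Hypothesis hL : local_time0 P T X L.

(** Irrelevance of the proofs packed with the function. The definition of the local time supplies
    one cumulative function for each time; being determined by the path of [Q], they are all equal,
    and so are their measures. *)
Lemma cumulative_ext (G G' : cumulative R R) : (forall r, G r = G' r) -> G = G'.
Proof.
move: G G' => [g cg] [g' cg'] /= E; have Eg : g = g' by apply/funext.
subst g'; congr Cumulative.Pack.
case: cg cg' => [[h1 h2]] [[h1' h2']].
by rewrite (Prop_irrelevance h1 h1') (Prop_irrelevance h2 h2').
Qed.

(** The approximations of the local time are integrals over [0, a] and [0, b], hence ordered. If [X]
    does not vanish on [a, b], its minimum there is positive by continuity; for [e] below the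
    minimum the indicator is 0 on ]a, b], and the approximations at both times coincide. *)
Lemma local_time_increment a b : 0 <= a -> a <= b -> b <= T ->
  {ae P, forall w, L a w <= L b w /\
    (L a w <> L b w -> exists2 r, a <= r <= b & X r w = 0)}.
Proof.
move=> a0 ab bT; have [_ _ [Q [_ HQ]]] := hL.
have aT' : 0 <= a <= T by rewrite a0 (le_trans ab).
have bT' : 0 <= b <= T by rewrite (le_trans a0 ab).
apply: filterS2 (filterI cX X0) (filterI (HQ b bT') (HQ a aT')) => w [cXw X0w].
move=> [[G [GQ Gb]] [G' [GQ' Ga]]].
have GG' : G' = G by apply: cumulative_ext => r; rewrite GQ GQ'.
rewrite {}GG' in Ga.
pose nu := lebesgue_stieltjes_measure G.
pose S e := [set r | 0 <= X r w < e].
have mS e t : 0 <= t <= T -> measurable_fun `[0, t] (fun r => (\1_(S e) r)%:E : \bar R).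
  move=> /andP[t0 tT]; apply/measurable_EFinP.
  have -> : (\1_(S e) : R -> R) = (\1_(`[0, e[%classic : set R) : R -> R) \o (X ^~ w).
    apply/funext => r; rewrite /= !indicE.
    have -> // : (r \in S e) = (X r w \in (`[0, e[%classic : set R)).
    by apply/idP/idP => /set_mem H; apply/mem_set; move: H; rewrite /S /= in_itv.
  apply: (measurableT_comp (measurable_indic _)) => //.
  apply: measurable_funS (within_continuous_measurable cXw) => //.
  by move=> r /=; rewrite !in_itv/= => /andP[-> /le_trans->].
pose I e t := (\int[nu]_(r in `[0%R, t]) (\1_(S e) r)%:E)%E.
have Iab e : (I e a <= I e b)%E.
  apply: ge0_subset_integral => //.
  - exact: mS.
  - by move=> r /=; rewrite !in_itv/= => /andP[-> /le_trans->].
split.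
  rewrite -lee_fin -(cvg_lim _ Ga)// -(cvg_lim _ Gb)//.
  apply: lee_lim; [by apply/cvg_ex; eexists; exact: Ga|by apply/cvg_ex; eexists; exact: Gb|].
  near=> e; apply: lee_wpmul2l; last exact: Iab.
  by rewrite lee_fin invr_ge0; near: e; apply: nbhs_right_ge.
move=> Lab; apply: contrapT => noz; apply: Lab.
have cXab : {within `[a, b], continuous (X ^~ w)}.
  apply: continuous_subspaceW cXw => r /=; rewrite !in_itv/= => /andP[ar rb].
  by rewrite (le_trans a0 ar) (le_trans rb bT).
have [c cab cmin] := EVT_min ab cXab.
have {}cab : a <= c <= b by move: cab; rewrite in_itv.
have Xc : 0 < X c w.
  rewrite lt_neqAle X0w ?andbT; last first.
    by case/andP: cab => ac cb; rewrite (le_trans a0 ac) (le_trans cb bT).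
  by apply/negP => /eqP Xc; apply: noz; exists c.
apply: EFin_inj; apply: (cvg_unique _ Ga) => //.
apply: cvg_trans Gb; apply: near_eq_cvg; near=> e; congr (_ * _)%E.
change (I e b = I e a); rewrite /I.
have -> : `[0, b]%classic = `[0, a]%classic `|` `]a, b]%classic :> set R.
  apply/seteqP; split=> r /=; rewrite !in_itv/=.
    by move=> /andP[r0 rb]; case: (leP r a) => ra; [left|right]; apply/andP; split.
  by case=> /andP[? ?]; apply/andP; split; lra.
rewrite ge0_integral_setU//=.
- rewrite [X in (_ + X)%E]integral0_eq ?adde0// => r; rewrite /= in_itv/= => /andP[ar rb].
  rewrite indicE memNset//; move=> /andP[_ Xe].
  have : X c w <= X r w by apply: cmin; rewrite in_itv/= (ltW ar).
  move=> /le_lt_trans/(_ Xe); apply/negP; rewrite -leNgt.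
  by near: e; apply: nbhs_right_le.
- have -> : `[0, a]%classic `|` `]a, b]%classic = `[0, b]%classic :> set R.
    apply/seteqP; split=> r /=; rewrite !in_itv/=.
      by case=> /andP[? ?]; apply/andP; split; lra.
    by move=> /andP[r0 rb]; case: (leP r a) => ra; [left|right]; apply/andP; split.
  exact: mS.
- apply/disj_setPS => r /= []; rewrite !in_itv/= => /andP[_ rc] /andP[cr _].
  by have := lt_le_trans cr rc; rewrite ltxx.
Unshelve. all: by end_near. Qed.

End local_time.

(** * Increments along a path due to the local time *)

Section path_steps.
Context (R : realType).
Variables (T : R) (x l f f1 : R -> R).
Hypothesis cx : {within `[0, T], continuous x}.
Hypothesis cl : {within `[0, T], continuous l}.
Hypothesis df : forall y, is_derive y (1 : R) f (f1 y).

(** [x] and [l] stand for single paths of the process and of its local time. The second clause is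
    the only trace that local time leaves in what follows. *)
Definition reflected_step u v := [/\ 0 <= u, u <= v & v <= T] /\
  (l u <= l v /\ (l u <> l v -> exists2 r, u <= r <= v & x r = 0)).

Lemma mean_value a b : a <= b -> exists2 c, a <= c <= b & f b - f a = f1 c * (b - a).
Proof.
move=> ab; have [|c cab E] := MVT_segment ab (fun y _ => df y).
  by apply: derivable_within_continuous => y _; exact: (@ex_derive _ _ _ _ _ _ _ (df y)).
by exists c => //; move: cab; rewrite in_itv.
Qed.

Let inc_mean u v : reflected_step u v -> exists2 c,
  x v - 2^-1 * (l v - l u) <= c <= x v &
  f (x v) - f (x v - 2^-1 * (l v - l u)) = f1 c * (2^-1 * (l v - l u)).
Proof.
move=> [_ [luv _]]; have ab : x v - 2^-1 * (l v - l u) <= x v.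
  by rewrite gerBl mulr_ge0// subr_ge0.
have [c cab E] := mean_value ab; exists c => //.
by rewrite E; congr (_ * _); rewrite opprB addrC subrK.
Qed.

Lemma reflected_step_ge0 u v : (forall y, 0 <= f1 y) -> reflected_step u v ->
  0 <= f (x v) - f (x v - 2^-1 * (l v - l u)).
Proof.
move=> f10 H; have [c _ ->] := inc_mean H; case: H => _ [luv _].
by rewrite mulr_ge0// mulr_ge0// subr_ge0.
Qed.

Lemma reflected_step_le u v M : (forall y, `|f1 y| <= M) -> reflected_step u v ->
  `|f (x v) - f (x v - 2^-1 * (l v - l u))| <= M * (l v - l u).
Proof.
move=> fM H; have [c _ ->] := inc_mean H; case: H => _ [luv _].
have l0 : 0 <= l v - l u by rewrite subr_ge0.
rewrite normrM [`|2^-1 * _|]ger0_norm ?mulr_ge0// ler_pM ?mulr_ge0//.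
by rewrite ler_piMl// invf_le1// ler1n.
Qed.

(** If [l] grows over a short interval, then [x] vanishes somewhere in it, so [x v] and the
    increment of [l] are at most [e / 2] by uniform continuity. The whole segment between the
    intermediate point and [x v] is thus close to 0. *)
Lemma reflected_step_small e : 0 < e -> exists2 dl : R, 0 < dl &
  forall u v, v - u <= dl -> reflected_step u v -> l u <> l v ->
    forall c, x v - 2^-1 * (l v - l u) <= c <= x v -> `|c| <= e.
Proof.
move=> e0; have e20 : 0 < e / 2 by rewrite divr_gt0.
have [d1 d10 H1] := uniform_continuity cx e20.
have [d2 d20 H2] := uniform_continuity cl e20.
exists (Num.min d1 d2); first by rewrite lt_min d10.
move=> u v; rewrite le_min => /andP[uv1 uv2] [[u0 uv vT] [luv zer]] /zer[r /andP[ur rv] xr] c.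
have h1 : `|x v - x r| <= e / 2.
  apply: H1; [by lra|by lra|by rewrite ger0_norm ?subr_ge0//; lra].
have h2 : `|l v - l u| <= e / 2.
  apply: H2; [by lra|by lra|by rewrite ger0_norm ?subr_ge0//; lra].
move: h1 h2; rewrite xr subr0 !ler_norml => /andP[? ?] /andP[? ?] /andP[? ?].
by apply/andP; split; lra.
Qed.

(** The constant 1/4 is the lower bound 1/2 of [f1] near 0 times the factor 1/2 in front of the
    local time. *)
Lemma reflected_step_lower : (forall y, `|y| <= 1 -> 2^-1 <= f1 y) ->
  exists2 dl : R, 0 < dl & forall u v, v - u <= dl -> reflected_step u v ->
    4^-1 * (l v - l u) <= f (x v) - f (x v - 2^-1 * (l v - l u)).
Proof.
move=> f12; have [dl dl0 H] := reflected_step_small ltr01.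
exists dl => // u v uv st; have [E|/eqP ne] := eqVneq (l u) (l v).
  by rewrite E subrr !mulr0 subr0 subrr.
have [c cuv] := inc_mean st; move=> ->.
have := f12 _ (H u v uv st ne c cuv); case: st => _ [luv _] h.
have -> : 4^-1 * (l v - l u) = 2^-1 * (2^-1 * (l v - l u)) by field.
by rewrite ler_wpM2r// mulr_ge0// subr_ge0.
Qed.

(** Here [f1] vanishes at 0, at least linearly, and the intermediate points are within [e / (C + 1)]
    of 0. If [l] does not grow, both sides are 0. *)
Lemma reflected_step_upper C e : (forall y, `|f1 y| <= C * `|y|) -> 0 < e ->
  exists2 dl : R, 0 < dl & forall u v, v - u <= dl -> reflected_step u v ->
    `|f (x v) - f (x v - 2^-1 * (l v - l u))| <= e * (l v - l u).
Proof.
move=> fC e0; have C0 : 0 <= C.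
  by have := le_trans (normr_ge0 _) (fC 1); rewrite normr1 mulr1.
have e1 : 0 < e / (C + 1) by rewrite divr_gt0// ltr_wpDl.
have [dl dl0 H] := reflected_step_small e1.
exists dl => // u v uv st; have [E|/eqP ne] := eqVneq (l u) (l v).
  by rewrite E subrr !mulr0 subr0 subrr normr0.
have [c cuv] := inc_mean st; move=> ->.
have := H u v uv st ne c cuv; case: st => _ [luv _] h.
have l0 : 0 <= l v - l u by rewrite subr_ge0.
rewrite normrM [`|2^-1 * _|]ger0_norm ?mulr_ge0// ler_pM ?mulr_ge0//; last first.
  by rewrite ler_piMl// invf_le1// ler1n.
apply: (le_trans (fC c)); apply: (le_trans (ler_wpM2l C0 h)).
rewrite mulrCA ler_piMr ?(ltW e0)// ler_pdivrMr ?mul1r ?lerDl//.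
by rewrite ltr_wpDl.
Qed.

End path_steps.

(** * Dominated convergence of expectations and almost sure properties of all cells *)

Section convergence_toolkit.
Context (R : realType) (d : measure_display) (Omega : measurableType d).
Variable P : probability Omega R.

Lemma cvg0_exp_dominated (Z : nat -> Omega -> R) (D : Omega -> R) :
  (forall n, measurable_fun setT (Z n)) -> integrable_rv P D ->
  {ae P, forall w n, `|Z n w| <= D w} ->
  {ae P, forall w, Z n w @[n --> \oo] --> (0 : R)} ->
  \int[P]_w Z n w @[n --> \oo] --> (0 : R).
Proof.
move=> mZ iD ZD cZ.
have h : (\int[P]_w (Z n w)%:E @[n --> \oo] --> \int[P]_w (cst 0 w : \bar R))%E.
  have [|||||_ _] // := @dominated_convergence _ _ _ P setT measurableT
    (fun n w => (Z n w)%:E) (cst 0%E) (fun w => (D w)%:E).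
  - by move=> n; exact/measurable_EFinP.
  - by apply: filterS cZ => w cZw _; apply: cvg_EFin => //; exact: nearW.
  - by apply: filterS ZD => w ZDw n _; rewrite /= lee_fin; exact: ZDw.
rewrite integral0 in h.
by have /fine_cvgP[] := h.
Qed.

Lemma all_steps_ae (Q : R -> R -> Prop) (G : R -> R -> Omega -> Prop) a s :
  all_steps Q a s -> (forall u v, Q u v -> {ae P, forall w, G u v w}) ->
  {ae P, forall w, all_steps (fun u v => G u v w) a s}.
Proof.
move=> + H; elim: s a => [|b s IH] a /=; first by move=> _; apply/aeW.
by move=> [/H h1 /IH h2]; apply: filterS2 h1 h2.
Qed.

End convergence_toolkit.

(** * Ito formula in expectation *)

Lemma sde_increment (R : realType) (x i j k l c : R) :
  x + i + c * k + (j - i) = x + j + c * l - c * (l - k).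
Proof. by ring. Qed.

Lemma step_bound_rearranged (R : realType) (a b m k c n x k2 e : R) :
  0 <= m -> 0 <= k -> 0 <= c -> 0 <= x -> x <= n ->
  a * (k2 * x) + b * (4 * e) + m * (k * (c * x ^+ 2)) <=
  (a * k2 + m * (k * c) * n) * x + b * 4 * e.
Proof.
move=> m0 k0 c0 x0 xn; have h : m * (k * c) * (x * x) <= m * (k * c) * (n * x).
  by rewrite ler_wpM2l ?mulr_ge0// ler_wpM2r.
by rewrite expr2; lra.
Qed.

Lemma near_mul_le (R : realType) (u : nat -> R) (c e : R) :
  u n @[n --> \oo] --> 0 -> 0 < e -> \forall n \near \oo, c * u n <= e.
Proof.
move=> u0 e0; have c1 : 0 < `|c| + 1 by rewrite ltr_wpDl.
have /cvgr0Pnorm_le/(_ _ (divr_gt0 e0 c1)) := u0; apply: filterS => n h.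
apply: (le_trans (ler_norm _)); rewrite normrM.
apply: (le_trans (ler_wpM2l (normr_ge0 c) h)).
by rewrite mulrCA ler_piMr ?(ltW e0)// ler_pdivrMr// mul1r lerDl.
Qed.

Lemma thirds_bound (R : realType) (x a b c e : R) :
  a <= e / 3 -> b <= e / 3 -> c <= e / 3 -> x = c + a + b -> x <= e.
Proof. by lra. Qed.

(** From |x^2 - y^2| <= 2 k |x - y| and Young's inequality with weight [l]. *)
Lemma sqr_diff_bound (R : realType) (x y k l : R) :
  `|x| <= k -> `|y| <= k -> 0 < l ->
  `|x ^+ 2 - y ^+ 2| <= k ^+ 2 * l + l^-1 * (x - y) ^+ 2.
Proof.
move=> xk yk l0; have k0 : 0 <= k := le_trans (normr_ge0 x) xk.
rewrite subr_sqr normrM.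
have h : `|x + y| <= 2 * k by rewrite (le_trans (ler_normD _ _))//; lra.
apply: (le_trans (ler_wpM2l (normr_ge0 _) h)).
rewrite -(ler_pM2l l0) mulrDr mulVKf ?gt_eqF// -[(x - y) ^+ 2]real_normK ?num_real//.
by have := sqr_ge0 (k * l - `|x - y|); nra.
Qed.

Lemma integrable_cst_itvoc (R : realType) (a b c : R) :
  (@lebesgue_measure R).-integrable `]a, b] (EFin \o cst c).
Proof.
apply: measurable_bounded_integrable => //; first exact: lebesgue_measure_itvoc_fin.
by exists `|c|; split; [exact: num_real|move=> x cx r _ /=; exact: ltW].
Qed.

Lemma integral_itvoc_bound (R : realType) (g : R -> R) (a b M : R) : a <= b ->
  (@lebesgue_measure R).-integrable `]a, b] (EFin \o g) ->
  (forall r, a < r <= b -> `|g r| <= M) ->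
  `|\int[@lebesgue_measure R]_(r in `]a, b]) g r| <= M * (b - a).
Proof.
move=> ab ig gM; have mI : measurable (`]a, b]%classic : set (measurableTypeR R)) by [].
apply: le_trans (le_normr_Rintegral mI ig) _.
rewrite -(lebesgue_measure_itvoc ab) -Rintegral_cst//.
apply: (le_Rintegral mI (integrable_norm ig) (integrable_cst_itvoc a b M)).
by move=> r; rewrite /= in_itv; exact: gM.
Qed.

Lemma steps_sum_error (R : realType) (Q : R -> R -> Prop) (f g e : R -> R -> R) (c x y a : R) s :
  all_steps Q a s ->
  (forall u v, Q u v -> `|f u v - c * g u v| <= x * (v - u) + y * e u v) ->
  `|steps_sum f a s - c * steps_sum g a s| <=
  x * steps_sum (fun u v => v - u) a s + y * steps_sum e a s.
Proof.
move=> H E; rewrite -!steps_sumZ -steps_sumD -mulN1r -steps_sumZ -steps_sumD.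
apply: le_trans (norm_steps_sum _ _ _) _; apply: (le_steps_sum H) => u v /E.
by rewrite mulN1r.
Qed.

Section ito_formula.
Context (R : realType) (d : measure_display) (Omega : measurableType d).
Variables (P : probability Omega R) (T : R) (F : R -> set_system Omega).
Variable B : R -> Omega -> R.
Local Notation mu := (@lebesgue_measure R).
Hypothesis hF : filtration T F.
Hypothesis hB : brownian_motion P T F B.
Hypothesis T0 : 0 < T.
Variables (K : R) (h J : nat -> R -> Omega -> R) (I H : R -> Omega -> R).
Hypothesis hJ : forall n, simple_on T F B K (h n) (J n) 0 T.
Hypothesis mI : forall t, 0 <= t <= T -> measurable_fun setT (I t).
Hypothesis cI : forall t, 0 <= t <= T ->
  cvg0_in_probability P (fun n w => `|J n t w - I t w|%:E).
Hypothesis bH : bounded_process T H K.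
Hypothesis cH : cvg0_in_probability P (fun n w =>
  (\int[mu]_(r in `]0%R, T]) ((h n r w - H r w) ^+ 2)%:E)%E).
Variables X L : R -> Omega -> R.
Hypothesis aX : adapted T F X.
Hypothesis cX : continuous_paths P T X.
Hypothesis mL : forall t, 0 <= t <= T -> measurable_fun setT (L t).
Hypothesis cL : continuous_paths P T L.
Hypothesis XIL : {ae P, forall w, forall t : R, 0 <= t <= T ->
  X t w = X 0 w + I t w + 2^-1 * L t w}.
Hypothesis XL : forall a b, 0 <= a -> a <= b -> b <= T ->
  {ae P, forall w, L a w <= L b w /\
    (L a w <> L b w -> exists2 r, a <= r <= b & X r w = 0)}.
Variables (t : R) (s : nat -> seq R).
Hypothesis tT : 0 <= t <= T.
(** The mesh of the n-th grid is tied to n, so that a single limit refines the grid and improves the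
    integrand at the same time. *)
Let step n u v := elementary_on T F B K (h n) (J n) u v /\ v - u <= n.+1%:R^-1.
Hypothesis hs : forall n, all_steps (step n) 0 (s n).
Hypothesis ls : forall n, last 0 (s n) = t.

Let err := simple_error P h H.

Let step_range n u v : step n u v -> [/\ 0 <= u, u <= v & v <= T].
Proof. by move=> [[[? /ltW ? ?] _ _ _] _]. Qed.

Let mX u : 0 <= u <= T -> measurable_fun setT (X u).
Proof. by move=> uT; apply: (measurable_wrt_measurable hF uT); exact: aX. Qed.

Let err_bound n : err n 0 T <= (K + K) ^+ 2 * T.
Proof.
have bD : bounded_process T (fun r w => (h n r w - H r w) ^+ 2) ((K + K) ^+ 2).
  apply: bounded_processX; apply: bounded_processB => //.
  exact: (simple_bounded_process hF hJ).
have [_ _ bd i] := bounded_process_section P bD (lexx 0) (ltW T0) (lexx T).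
rewrite -(exp_cst P ((K + K) ^+ 2 * T)); apply: (exp_le i (integrable_rv_cst _ _)) => w.
by apply: (le_trans (ler_norm _)); have := bd w; rewrite subr0.
Qed.

(** The error over a cell is a difference of errors counted from 0, so the sum telescopes. *)
Let err_sum n : steps_sum (err n) 0 (s n) <= err n 0 T.
Proof.
have -> : steps_sum (err n) 0 (s n) = steps_sum (fun u v => err n 0 v - err n 0 u) 0 (s n).
  apply: eq_steps_sum (hs n) _ => u v /step_range[u0 uv vT].
  by rewrite /err (simple_error_cat P hF hJ bH n (lexx 0) u0 uv vT) addrC addKr.
rewrite steps_sum_telescope ls.
have e0 : 0 <= err n 0 0 by exact: simple_error_ge0.
case/andP: tT => t0 tT'.
apply: le_trans (simple_error_le P hF hJ bH n (lexx 0) t0 tT').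
by rewrite gerBl.
Qed.

Let len_sum n : steps_sum (fun u v => v - u) 0 (s n) = t.
Proof. by rewrite (steps_sum_telescope id) ls subr0. Qed.

Let good w n u v := [/\ step n u v, reflected_step T (X ^~ w) (L ^~ w) u v &
  X u w + (I v w - I u w) = X v w - 2^-1 * (L v w - L u w)].

(** The null sets of [XL] depend on the cell, but all the grids together have countably many cells:
    one null set serves for all. *)
Let good_path : {ae P, forall w, [/\ {within `[0, T], continuous (X ^~ w)},
  {within `[0, T], continuous (L ^~ w)} & forall n, all_steps (good w n) 0 (s n)]}.
Proof.
have G n : {ae P, forall w, all_steps (fun u v => good w n u v) 0 (s n)}.
  apply: all_steps_ae (hs n) _ => u v st; have [u0 uv vT] := step_range st.
  have uT : 0 <= u <= T by rewrite u0 (le_trans uv).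
  have vT' : 0 <= v <= T by rewrite vT (le_trans u0).
  apply: filterS2 XIL (XL u0 uv vT) => w E H1; split=> //.
  by rewrite (E u uT) (E v vT'); exact: sde_increment.
by apply: filterS3 cX cL (ae_foralln G) => w ? ? ?; split.
Qed.

Section test_function.
Variables (f f1 f2 f3 : R -> R) (M0 M1 M2 M3 : R).
Hypothesis df : forall x, is_derive x (1 : R) f (f1 x).
Hypothesis df1 : forall x, is_derive x (1 : R) f1 (f2 x).
Hypotheses (fM0 : forall x, `|f x| <= M0) (f1M1 : forall x, `|f1 x| <= M1).
Hypothesis f2M2 : forall x, `|f2 x| <= M2.

Let mf : measurable_fun setT f. Proof. exact: is_derive_measurable df. Qed.
Let M2_ge0 : 0 <= M2. Proof. exact: le_trans (normr_ge0 _) (f2M2 0). Qed.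

(** Over a cell, the increment of [f] is split at [X u + (I v - I u)], the point that would be
    reached without local time. It need not lie on the path and may be negative, hence bounds on [f]
    over the whole line. *)
Definition martingale_step u v w := f (X u w + (I v w - I u w)) - f (X u w).
Definition local_time_step u v w := f (X v w) - f (X u w + (I v w - I u w)).

Let mXI u v : 0 <= u -> u <= v -> v <= T -> measurable_fun setT (fun w => X u w + (I v w - I u w)).
Proof.
move=> u0 uv vT; have uT := le_trans uv vT; have v0 := le_trans u0 uv.
apply: measurable_funD; first by apply: mX; rewrite u0.
by apply: measurable_funB; apply: mI; [rewrite v0|rewrite u0].
Qed.

Let measurable_local n : measurable_fun setT (fun w => steps_sum (fun u v => local_time_step u v w) 0 (s n)).
Proof.
apply: (measurable_steps_sum (hs n)) => u v /step_range[u0 uv vT].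
apply: measurable_funB; apply: measurableT_comp => //; last exact: mXI.
by apply: mX; rewrite vT (le_trans u0 uv).
Qed.

Let integrable_f u : 0 <= u <= T -> integrable_rv P (fun w => f (X u w)).
Proof.
move=> uT; apply: (@integrable_rv_bounded _ _ _ _ _ M0) => //.
by apply: measurableT_comp => //; exact: mX.
Qed.

Let integrable_martingale_step n u v : step n u v -> integrable_rv P (martingale_step u v).
Proof.
move=> /step_range[u0 uv vT]; apply: (@integrable_rv_bounded _ _ _ _ _ (M0 + M0)).
  apply: measurable_funB; apply: measurableT_comp => //; first exact: mXI.
  by apply: mX; rewrite u0 (le_trans uv vT).
by move=> w; apply: (le_trans (ler_normB _ _)); apply: lerD.
Qed.

Let integrable_local_step n u v : step n u v -> integrable_rv P (local_time_step u v).
Proof.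
move=> /step_range[u0 uv vT]; apply: (@integrable_rv_bounded _ _ _ _ _ (M0 + M0)).
  apply: measurable_funB; apply: measurableT_comp => //; last exact: mXI.
  by apply: mX; rewrite vT (le_trans u0 uv).
by move=> w; apply: (le_trans (ler_normB _ _)); apply: lerD.
Qed.

Let exp_split n :
  \int[P]_w f (X t w) - \int[P]_w f (X 0 w) =
  \int[P]_w steps_sum (fun u v => local_time_step u v w) 0 (s n) +
  steps_sum (fun u v => \int[P]_w martingale_step u v w) 0 (s n).
Proof.
have [i1 e1] := exp_steps_sum (hs n) (@integrable_martingale_step n).
have [i2 _] := exp_steps_sum (hs n) (@integrable_local_step n).
rewrite -e1 -(expD i2 i1).
have z0 : 0 <= (0 : R) <= T by rewrite lexx (ltW T0).
rewrite -(expB (integrable_f tT) (integrable_f z0)); apply: eq_Rintegral => w _.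
rewrite -steps_sumD -(ls n) -(steps_sum_telescope (fun u => f (X u w))).
apply: eq_steps_sum (hs n) _ => u v _.
by rewrite /local_time_step /martingale_step addrA subrK.
Qed.

Let exp_martingale_step n u v : step n u v ->
  `|\int[P]_w martingale_step u v w| <= 2 * M2 * (K ^+ 2 * (v - u) + 4 * err n u v).
Proof.
move=> st; have [u0 uv vT] := step_range st; have uT := le_trans uv vT.
have [s1 e1] := exp_ito_approx hF hB T0 hJ mI cI bH cH n u0 uv vT.
have s2 := square_integrable_ito hF hB T0 hJ mI cI bH cH u0 uv vT.
have FX : measurable_wrt (F u) (X u) by apply: aX; rewrite u0.
have mart Y M : measurable_wrt (F u) Y -> (forall w, `|Y w| <= M) ->
    \int[P]_w (Y w * (I v w - I u w)) = 0.
  exact: (exp_ito_martingale hF hB T0 hJ mI cI bH cH).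
exact: (exp_step_order1 hF hB st.1 mart s2 s1 e1 FX df df1 fM0 f1M1 f2M2).
Qed.

(** Uniform in n: the lengths of the cells sum up to [t] and their errors to at most the global
    error, itself bounded. *)
Let exp_martingale_bound n :
  `|steps_sum (fun u v => \int[P]_w martingale_step u v w) 0 (s n)| <=
  2 * M2 * (K ^+ 2 * T + 4 * ((K + K) ^+ 2 * T)).
Proof.
apply: (le_trans (norm_steps_sum _ _ _)).
apply: (le_trans (le_steps_sum (hs n) (@exp_martingale_step n))).
rewrite steps_sumZ steps_sumD !steps_sumZ len_sum ler_wpM2l ?mulr_ge0//.
apply: lerD; first by rewrite ler_wpM2l ?sqr_ge0//; case/andP: tT.
by rewrite ler_wpM2l//; exact: le_trans (err_sum n) (err_bound n).
Qed.

Let sumL w n : steps_sum (fun u v => L v w - L u w) 0 (s n) = L t w - L 0 w.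
Proof. by rewrite (steps_sum_telescope (L ^~ w)) ls. Qed.

Let localE w n u v : good w n u v ->
  local_time_step u v w = f (X v w) - f (X v w - 2^-1 * (L v w - L u w)).
Proof. by case=> _ _ E; rewrite /local_time_step E. Qed.

Let mesh_small (dl : R) : 0 < dl -> \forall n \near \oo, n.+1%:R^-1 <= dl.
Proof.
move=> dl0; have := @cvg_harmonic R => /cvgr0Pnorm_le/(_ dl dl0).
by apply: filterS => n; rewrite /= ger0_norm ?invr_ge0.
Qed.

(* An increasing bounded f turns the bound on E (f (X t) - f (X 0)) into a bound
   on E (L t - L 0), by Fatou's lemma. *)
Lemma integrable_local_time : (forall x, 0 <= f1 x) ->
  (forall x, `|x| <= 1 -> 2^-1 <= f1 x) ->
  integrable_rv P (fun w => Num.max 0 (L t w - L 0 w)).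
Proof.
move=> f10 f12; have z0 : 0 <= (0 : R) <= T by rewrite lexx (ltW T0).
pose Z n w := steps_sum (fun u v => local_time_step u v w) 0 (s n).
have mD : measurable_fun setT (fun w => Num.max 0 (L t w - L 0 w)).
  by apply: measurable_maxr => //; apply: measurable_funB; exact: mL.
pose Y w := 4^-1 * Num.max 0 (L t w - L 0 w).
have [iY _] : integrable_rv P Y /\
    \int[P]_w Y w <= M0 + M0 + 2 * M2 * (K ^+ 2 * T + 4 * ((K + K) ^+ 2 * T)).
  apply: (@fatou_eventually _ _ _ P Y Z).
  - exact: measurable_funM.
  - exact: measurable_local.
  - by move=> w; rewrite /Y mulr_ge0// le_max lexx.
  - by move=> n; have [] := exp_steps_sum (hs n) (@integrable_local_step n).
  - apply: filterS good_path => w [cXw cLw G] n; apply: (steps_sum_ge0 (G n)) => u v g.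
    by rewrite (localE g); case: g => _ g _; exact: (reflected_step_ge0 df f10 g).
  - move=> n; have := exp_split n; have := exp_martingale_bound n.
    set S := steps_sum (fun u v => \int[P]_w martingale_step u v w) 0 (s n).
    rewrite -/(Z n); set C := 2 * M2 * _ => SC E.
    have -> : \int[P]_w Z n w = (\int[P]_w f (X t w) - \int[P]_w f (X 0 w)) - S.
      by rewrite E addrK.
    have b1 u : 0 <= u <= T -> `|\int[P]_w f (X u w)| <= M0.
      move=> uT; rewrite -(exp_cst P M0); apply: (exp_norm_le (integrable_f uT)) => //.
      exact: integrable_rv_cst.
    apply: (le_trans (ler_norm _)); apply: (le_trans (ler_normB _ _)); apply: lerD => //.
    by apply: (le_trans (ler_normB _ _)); apply: lerD; exact: b1.
  - apply: filterS good_path => w [cXw cLw G].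
    have [dl dl0 Hdl] := reflected_step_lower cXw cLw df f12.
    have := mesh_small dl0; apply: filterS => n ndl.
    have E1 : steps_sum (fun u v => 4^-1 * (L v w - L u w)) 0 (s n) = 4^-1 * (L t w - L 0 w).
      by rewrite steps_sumZ sumL.
    have L0 : 0 <= L t w - L 0 w.
      by rewrite -(sumL w n); apply: (steps_sum_ge0 (G n)) => u v [_ [_ [? _]] _]; rewrite subr_ge0.
    rewrite /Y max_r// -E1; apply: (le_steps_sum (G n)) => u v g.
    by rewrite (localE g); case: g => -[_ uv] g _; apply: (Hdl _ _ _ g); exact: le_trans ndl.
have := integrable_rvZ 4 iY; congr (integrable_rv P).
by apply/funext => w; rewrite /Y mulrA divff ?mul1r// pnatr_eq0.
Qed.

Hypothesis iL : integrable_rv P (fun w => Num.max 0 (L t w - L 0 w)).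
Hypothesis f10 : exists C, forall x, `|f1 x| <= C * `|x|.

(** On a fixed path, each increment is at most a small multiple of that of [L] once the mesh is
    below a threshold depending on the path; the sum is then a small multiple of [L t - L 0]. The
    variable [M1 * (L t - L 0)] dominates, which is where its integrability enters. *)
Let cvg_exp_local :
  \int[P]_w steps_sum (fun u v => local_time_step u v w) 0 (s n) @[n --> \oo] --> (0 : R).
Proof.
have [C fC] := f10.
pose Z n w := steps_sum (fun u v => local_time_step u v w) 0 (s n).
apply: (@cvg0_exp_dominated _ _ _ P Z (fun w => M1 * Num.max 0 (L t w - L 0 w))).
- exact: measurable_local.
- exact: integrable_rvZ.
- apply: filterS good_path => w [cXw cLw G] n.
  have L0 : 0 <= L t w - L 0 w.
    by rewrite -(sumL w n); apply: (steps_sum_ge0 (G n)) => u v [_ [_ [? _]] _]; rewrite subr_ge0.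
  rewrite max_r// -(sumL w n) -steps_sumZ.
  apply: (le_trans (norm_steps_sum _ _ _)); apply: (le_steps_sum (G n)) => u v g.
  by rewrite (localE g); case: g => _ g _; exact: (reflected_step_le df f1M1 g).
- apply: filterS good_path => w [cXw cLw G]; apply/cvgr0Pnorm_le => e e0.
  have L0 : 0 <= L t w - L 0 w.
    rewrite -(sumL w 0%N); apply: (steps_sum_ge0 (G 0%N)) => u v [_ [_ [? _]] _].
    by rewrite subr_ge0.
  have c0 : 0 < e / (L t w - L 0 w + 1) by rewrite divr_gt0// ltr_wpDl.
  have [dl dl0 Hdl] := reflected_step_upper cXw cLw df fC c0.
  have := mesh_small dl0; apply: filterS => n ndl.
  apply: (@le_trans _ _ (e / (L t w - L 0 w + 1) * (L t w - L 0 w))).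
    rewrite -[X in _ <= _ * X](sumL w n) -steps_sumZ.
    apply: (le_trans (norm_steps_sum _ _ _)); apply: (le_steps_sum (G n)) => u v g.
    by rewrite (localE g); case: g => -[_ uv] g _; apply: (Hdl _ _ _ g); exact: le_trans ndl.
  rewrite mulrAC ler_pdivrMr ?ltr_wpDl//.
  by rewrite ler_wpM2l ?(ltW e0)// lerDl.
Qed.

Hypothesis df2 : forall x, is_derive x (1 : R) f2 (f3 x).
Hypothesis f3M3 : forall x, `|f3 x| <= M3.

Let M3_ge0 : 0 <= M3. Proof. exact: le_trans (normr_ge0 _) (f3M3 0). Qed.

Let quadratic_step n u v := \int[P]_w (f2 (X u w) * h n v w ^+ 2) * (v - u).

(** Both weights are taken equal to [l], and one factor [v - u] of the fourth moment term is bounded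
    by the mesh. *)
Let exp_martingale_step2 n u v l : 0 < l -> step n u v ->
  `|\int[P]_w martingale_step u v w - 2^-1 * quadratic_step n u v| <=
  ((M2 * l + M3 * l) * K ^+ 2 + M3 * l^-1 * (K ^+ 4 * (512 * expR 2^-1)) * n.+1%:R^-1) * (v - u) +
  M2 * (1 + l^-1) * 4 * err n u v.
Proof.
move=> l0 st; have [u0 uv vT] := step_range st; have uT := le_trans uv vT.
have [s1 e1] := exp_ito_approx hF hB T0 hJ mI cI bH cH n u0 uv vT.
have s2 := square_integrable_ito hF hB T0 hJ mI cI bH cH u0 uv vT.
have FX : measurable_wrt (F u) (X u) by apply: aX; rewrite u0.
have mart Y M : measurable_wrt (F u) Y -> (forall w, `|Y w| <= M) ->
    \int[P]_w (Y w * (I v w - I u w)) = 0.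
  exact: (exp_ito_martingale hF hB T0 hJ mI cI bH cH).
apply: (le_trans (exp_step_order2 hF hB st.1 mart s2 s1 e1 FX df df1 fM0 f1M1 f2M2 df2 f3M3 l0 l0)).
have c0 : 0 <= 512 * expR (2^-1 : R) := mulr_ge0 (ler0n _ _) (expR_ge0 _).
have K4 : 0 <= K ^+ 4 by rewrite exprn_even_ge0.
have l1 : 0 <= M3 * l^-1 by rewrite mulr_ge0// invr_ge0 ltW.
have uv0 : 0 <= v - u by rewrite subr_ge0.
exact: (step_bound_rearranged _ _ _ _ l1 K4 c0 uv0 st.2).
Qed.


Let cvg_martingale : steps_sum (fun u v => \int[P]_w martingale_step u v w) 0 (s n) -
  2^-1 * steps_sum (quadratic_step n) 0 (s n) @[n --> \oo] --> (0 : R).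
Proof.
apply/cvgr0Pnorm_le => e e0; have e3 : 0 < e / 3 by rewrite divr_gt0.
have t0 : 0 <= t by case/andP: tT.
pose c := (M2 + M3) * K ^+ 2 * t.
have c0 : 0 <= c := mulr_ge0 (mulr_ge0 (addr_ge0 M2_ge0 M3_ge0) (sqr_ge0 K)) t0.
have c1 : 0 < c + 1 by rewrite ltr_wpDl.
(* The weight is fixed before n: it makes the part that does not vanish with n at most [e / 3],
   after which the mesh term and the error term are made small, with constants that involve
   [l^-1]. *)
pose l := e / 3 / (c + 1); have l0 : 0 < l by rewrite divr_gt0.
pose m := M3 * l^-1 * (K ^+ 4 * (512 * expR 2^-1)).
have n1 := near_mul_le (m * t) (@cvg_harmonic R) e3.
have n2 := near_mul_le (M2 * (1 + l^-1) * 4) (cvg_simple_error hF T0 hJ bH cH) e3.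
apply: filterS2 n1 n2 => n h1 h2.
have := steps_sum_error (hs n) (fun u v => @exp_martingale_step2 n u v l l0).
rewrite len_sum => /le_trans; apply.
have h3 : M2 * (1 + l^-1) * 4 * steps_sum (err n) 0 (s n) <= e / 3.
  apply: le_trans h2; apply: ler_wpM2l; last exact: err_sum.
  by rewrite !mulr_ge0// addr_ge0// invr_ge0 ltW.
have h4 : c * l <= e / 3.
  by rewrite /l mulrCA ler_piMr ?(ltW e3)// ler_pdivrMr// mul1r lerDl.
apply: (thirds_bound h1 h3 h4).
by rewrite /c /m; ring.
Qed.

Variable Xt : R -> Omega -> R.
Hypothesis mXt : measurable_fun (`]0, T]%classic `*` [set: Omega])
  (fun z : measurableTypeR R * Omega => Xt z.1 z.2).
Hypothesis XtX : {ae P, forall w, forall r : R, 0 <= r <= T -> Xt r w = X r w}.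

Let Psi r w := f2 (Xt r w).

Let mf2 : measurable_fun setT f2. Proof. exact: is_derive_measurable df2. Qed.

Let bPsi : bounded_process T Psi M2.
Proof. by split=> [|r w _]; [exact: measurableT_comp|exact: f2M2]. Qed.

Let bh n : bounded_process T (fun r w => h n r w ^+ 2) (K ^+ 2).
Proof. by apply: bounded_processX; exact: (simple_bounded_process hF hJ). Qed.

Let bcst u : 0 <= u <= T -> bounded_process T (fun _ w => f2 (X u w)) M2.
Proof.
move=> uT; split=> [|r w _]; last exact: f2M2.
have m : measurable_fun setT (fun w => f2 (X u w)) by exact: measurableT_comp (mX uT).
by apply: (measurable_funTS (f := fun z : measurableTypeR R * Omega => f2 (X u z.2))); exact: (measurableT_comp m measurable_snd).
Qed.

(** Error made by freezing [f2] of the process at the left end of a cell. *)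
Let gap n u := fun r w => (f2 (X u w) - Psi r w) * h n r w ^+ 2.

Let bgap n u : 0 <= u <= T -> bounded_process T (gap n u) ((M2 + M2) * K ^+ 2).
Proof. by move=> uT; apply: bounded_processM => //; apply: bounded_processB => //; exact: bcst. Qed.

Let gap_step n u v : step n u v -> integrable_rv P (fun w => \int[mu]_(r in `]u, v]) gap n u r w).
Proof.
move=> /step_range[u0 uv vT]; have uT : 0 <= u <= T by rewrite u0 (le_trans uv).
by have [] := bounded_process_section P (bgap n uT) u0 uv vT.
Qed.

Let Psi_step n u v : step n u v ->
  integrable_rv P (fun w => \int[mu]_(r in `]u, v]) (Psi r w * h n r w ^+ 2)).
Proof.
move=> /step_range[u0 uv vT].
by have [] := bounded_process_section P (bounded_processM bPsi (bh n)) u0 uv vT.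
Qed.

Let quadratic_stepE n u v : step n u v -> quadratic_step n u v =
  \int[P]_w \int[mu]_(r in `]u, v]) gap n u r w +
  \int[P]_w \int[mu]_(r in `]u, v]) (Psi r w * h n r w ^+ 2).
Proof.
move=> st; have [u0 uv vT] := step_range st; have uT : 0 <= u <= T by rewrite u0 (le_trans uv).
have [i1 _ _ _] := bounded_process_section P (bgap n uT) u0 uv vT.
have [i2 _ _ _] := bounded_process_section P (bounded_processM bPsi (bh n)) u0 uv vT.
rewrite -(expD (gap_step st) (Psi_step st)).
have FX : measurable_wrt (F u) (X u) by apply: aX.
rewrite /quadratic_step mulrC -(expZ _ (integrable_step_order2 P hF st.1 FX f2M2 df2)).
apply: eq_Rintegral => w _; rewrite -RintegralD//.
have mI' : measurable (`]u, v]%classic : set (measurableTypeR R)) by [].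
transitivity (\int[mu]_(r in `]u, v]) (f2 (X u w) * h n v w ^+ 2)).
  by rewrite Rintegral_cst// lebesgue_measure_itvoc// mulrC.
apply: eq_Rintegral => r; rewrite inE/= in_itv/= => /andP[ur rv].
rewrite /gap -mulrDl subrK; case: st => -[_ _ _ H'] _.
have urv : u <= r <= v by rewrite (ltW ur).
by rewrite ((H' w r urv).1 ur).
Qed.

Let W n w := steps_sum (fun u v => \int[mu]_(r in `]u, v]) gap n u r w) 0 (s n).

(** On each continuous path, uniform continuity and the Lipschitz bound [M3] of [f2] make the
    freezing error uniformly small; it is also bounded by a constant. *)
Let cvg_W : \int[P]_w W n w @[n --> \oo] --> (0 : R).
Proof.
have t0 : 0 <= t by case/andP: tT.
have K2 : 0 <= K ^+ 2 by exact: sqr_ge0.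
apply: (@cvg0_exp_dominated _ _ _ P W (cst ((M2 + M2) * K ^+ 2 * t))).
- move=> n; apply: (measurable_steps_sum (hs n)) => u v st.
  exact: (integrable_rv_measurable (gap_step st)).
- exact: integrable_rv_cst.
- apply: aeW => w n; apply: (le_trans (norm_steps_sum _ _ _)).
  rewrite /= -[X in _ <= _ * X](len_sum n) -steps_sumZ; apply: (le_steps_sum (hs n)) => u v.
  move=> /step_range[u0 uv vT]; have uT : 0 <= u <= T by rewrite u0 (le_trans uv).
  by have [_ _ + _] := bounded_process_section P (bgap n uT) u0 uv vT; apply.
- apply: filterS2 cX XtX => w cXw E; apply/cvgr0Pnorm_le => e e0.
  pose c := M3 * K ^+ 2 * t; have c0 : 0 <= c := mulr_ge0 (mulr_ge0 M3_ge0 K2) t0.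
  have e1 : 0 < e / (c + 1) by rewrite divr_gt0// ltr_wpDl.
  have [dl dl0 Hdl] := uniform_continuity cXw e1.
  have := mesh_small dl0; apply: filterS => n ndl.
  apply: (@le_trans _ _ (M3 * (e / (c + 1)) * K ^+ 2 * t)).
    apply: (le_trans (norm_steps_sum _ _ _)).
    rewrite -[X in _ <= _ * X](len_sum n) -steps_sumZ; apply: (le_steps_sum (hs n)) => u v st.
    have [u0 uv vT] := step_range st; have uT : 0 <= u <= T by rewrite u0 (le_trans uv).
    have [i _ _ _] := bounded_process_section P (bgap n uT) u0 uv vT.
    apply: (integral_itvoc_bound uv (i w)) => r /andP[ur rv].
    have rT : 0 <= r <= T by rewrite (le_trans u0 (ltW ur)) (le_trans rv vT).
    rewrite /gap normrM ler_pM//; last first.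
      by have [_ +] := bh n; apply; rewrite (le_lt_trans u0 ur) (le_trans rv vT).
    rewrite /Psi E//; apply: (le_trans (mean_value_bound df2 (fun y _ => f3M3 y))).
    rewrite ler_wpM2l//; apply: (Hdl _ _ uT rT) => //.
    rewrite distrC ger0_norm ?subr_ge0 ?(ltW ur)//; apply: le_trans (le_trans st.2 ndl).
    by rewrite lerD2r.
  have -> : M3 * (e / (c + 1)) * K ^+ 2 * t = e * (c / (c + 1)) by rewrite /c; ring.
  by rewrite ler_piMr ?(ltW e0)// ler_pdivrMr ?mul1r ?lerDl// ltr_wpDl.
Qed.

Let q n := \int[P]_w \int[mu]_(r in `]0, t]) (Psi r w * h n r w ^+ 2).

Let sum_quadratic n : steps_sum (quadratic_step n) 0 (s n) = \int[P]_w W n w + q n.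
Proof.
have bp := bounded_processM bPsi (bh n).
have Psi_sum w : steps_sum (fun u v => \int[mu]_(r in `]u, v]) (Psi r w * h n r w ^+ 2)) 0 (s n) =
    \int[mu]_(r in `]0, t]) (Psi r w * h n r w ^+ 2).
  pose g v := \int[mu]_(r in `]0, v]) (Psi r w * h n r w ^+ 2).
  transitivity (steps_sum (fun u v => g v - g u) 0 (s n)).
    apply: eq_steps_sum (hs n) _ => u v /step_range[u0 uv vT].
    by rewrite /g (bounded_process_cat P w bp (lexx 0) u0 uv vT) addrC addKr.
  by rewrite steps_sum_telescope ls /g set_itvoc0 Rintegral_set0 subr0.
have [i1 e1] := exp_steps_sum (hs n) (@gap_step n).
have [i2 e2] := exp_steps_sum (hs n) (@Psi_step n).
have -> : q n = \int[P]_w steps_sum (fun u v => \int[mu]_(r in `]u, v]) (Psi r w * h n r w ^+ 2)) 0 (s n).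
  by apply: eq_Rintegral => w _; rewrite Psi_sum.
rewrite e1 e2 -steps_sumD; apply: eq_steps_sum (hs n) _ => u v.
exact: quadratic_stepE.
Qed.

Let qH := \int[P]_w \int[mu]_(r in `]0, t]) (Psi r w * H r w ^+ 2).

(** The squares of the integrands converge in L^1: [sqr_diff_bound] reduces this to the simple
    error, with a weight chosen before n. *)
Let cvg_q : q n - qH @[n --> \oo] --> (0 : R).
Proof.
have t0 : 0 <= t by case/andP: tT.
have tT' : t <= T by case/andP: tT.
have bqH := bounded_processM bPsi (bounded_processX bH).
have [iH _ _ jH] := bounded_process_section P bqH (lexx 0) t0 tT'.
apply/cvgr0Pnorm_le => e e0; have e2 : 0 < e / 2 by rewrite divr_gt0.
pose c := M2 * K ^+ 2 * t.
have c0 : 0 <= c := mulr_ge0 (mulr_ge0 M2_ge0 (sqr_ge0 K)) t0.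
pose l := e / 2 / (c + 1); have l0 : 0 < l by rewrite divr_gt0// ltr_wpDl.
have n2 := near_mul_le (M2 * l^-1) (cvg_simple_error hF T0 hJ bH cH) e2.
apply: filterS n2 => n h2.
have [ih _ _ jh] := bounded_process_section P (bounded_processM bPsi (bh n)) (lexx 0) t0 tT'.
have bD : bounded_process T (fun r w => (h n r w - H r w) ^+ 2) ((K + K) ^+ 2).
  apply: bounded_processX; apply: bounded_processB => //.
  exact: (simple_bounded_process hF hJ).
have [iD _ _ jD] := bounded_process_section P bD (lexx 0) t0 tT'.
rewrite /q /qH -(expB jh jH).
have M2l : 0 <= M2 * l^-1 by rewrite mulr_ge0// invr_ge0 ltW.
apply: (@le_trans _ _ (\int[P]_w (cst (M2 * K ^+ 2 * l * t) w +
    M2 * l^-1 * \int[mu]_(r in `]0, t]) ((h n r w - H r w) ^+ 2)))).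
  apply: (exp_norm_le (integrable_rvB jh jH)).
    exact: (integrable_rvD (integrable_rv_cst _ _) (integrable_rvZ _ jD)).
  move=> w; have mI' : measurable (`]0, t]%classic : set (measurableTypeR R)) by [].
  rewrite -(RintegralB mI' (ih w) (iH w)) -(RintegralZl _ mI' (iD w)).
  have -> : cst (M2 * K ^+ 2 * l * t) w = \int[mu]_(r in `]0, t]) (M2 * K ^+ 2 * l).
    by rewrite Rintegral_cst// lebesgue_measure_itvoc// subr0.
  have icst : mu.-integrable `]0, t] (EFin \o cst (M2 * K ^+ 2 * l)).
    by apply: integrable_cst_itvoc.
  have iDl := integrableZl mI' (M2 * l^-1) (iD w).
  rewrite -(RintegralD mI' icst iDl).
  apply: (le_trans (le_normr_Rintegral mI' (integrableB mI' (ih w) (iH w)))).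
  apply: (le_Rintegral mI' (integrable_norm (integrableB mI' (ih w) (iH w))) (integrableD mI' icst iDl)).
  move=> r; rewrite /= in_itv/= => /andP[r0 rt].
  rewrite -mulrBr normrM.
  have rT : 0 < r <= T by rewrite r0 (le_trans rt).
  have HK : `|H r w| <= K by have [_] := bH; apply.
  have hK : `|h n r w| <= K by have [_] := simple_bounded_process hF hJ n; apply.
  rewrite (_ : M2 * K ^+ 2 * l + M2 * l^-1 * _ = M2 * (K ^+ 2 * l + l^-1 * (h n r w - H r w) ^+ 2)).
    by rewrite ler_pM//; [exact: f2M2|exact: sqr_diff_bound].
  by rewrite mulrDr !mulrA.
rewrite (expD (integrable_rv_cst _ _) (integrable_rvZ _ jD)) exp_cst (expZ _ jD) -/(simple_error P h H n 0 t).
have h3 : M2 * l^-1 * simple_error P h H n 0 t <= e / 2.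
  by apply: le_trans h2; exact: (ler_wpM2l M2l (simple_error_le P hF hJ bH n (lexx 0) t0 tT')).
have h4 : M2 * K ^+ 2 * l * t <= e / 2.
  have -> : M2 * K ^+ 2 * l * t = e / 2 * (c / (c + 1)) by rewrite /c /l; ring.
  by rewrite ler_piMr ?(ltW e2)// ler_pdivrMr ?mul1r ?lerDl// ltr_wpDl.
by rewrite (splitr e); exact: lerD.
Qed.

Lemma exp_ito_formula_grid :
  \int[P]_w f (X t w) - \int[P]_w f (X 0 w) = 2^-1 * qH.
Proof.
apply/eqP; rewrite -subr_eq0; apply/eqP; set A := (LHS).
(* The defect [A] does not depend on n and is a sum of vanishing terms: local time, Taylor
   remainder, freezing, approximation of the integrand. *)
have E : (fun _ : nat => A) = (fun n =>
    \int[P]_w steps_sum (fun u v => local_time_step u v w) 0 (s n) +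
    (steps_sum (fun u v => \int[P]_w martingale_step u v w) 0 (s n) -
     2^-1 * steps_sum (quadratic_step n) 0 (s n)) +
    2^-1 * (\int[P]_w W n w + (q n - qH))).
  apply/funext => n; rewrite /A (exp_split n) sum_quadratic.
  by move: (\int[P]_w _) (steps_sum _ _ _) (\int[P]_w _) (q n) qH => ? ? ? ? ?; ring.
suff c : (fun _ : nat => A) @ \oo --> (0 : R) by exact: (cvg_unique _ (@cvg_cst _ A _ _ _) c).
have c1 : \int[P]_w W n w + (q n - qH) @[n --> \oo] --> (0 : R).
  by rewrite -[X in _ --> X](addr0 0); exact: (cvgD cvg_W cvg_q).
have c2 : 2^-1 * (\int[P]_w W n w + (q n - qH)) @[n --> \oo] --> (0 : R).
  by rewrite -[X in _ --> X](mulr0 2^-1); apply: cvgM => //; exact: cvg_cst.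
have c3 := cvgD (cvgD cvg_exp_local cvg_martingale) c2; rewrite !addr0 in c3.
by rewrite E; exact: c3.
Qed.

End test_function.
End ito_formula.

(** * Bounds on the derivatives of the arctangent *)

Section arctangent.
Context (R : realType).
Implicit Type x : R.

Let den x : 0 < 1 + x ^+ 2. Proof. by rewrite ltr_pwDl// sqr_ge0. Qed.

Lemma is_derive_atan_derive x :
  is_derive x (1 : R) (fun y : R => (1 + y ^+ 2)^-1) (- (2 * x) * (1 + x ^+ 2) ^- 2).
Proof.
have dn : (1 + x ^+ 2) != 0 by rewrite gt_eqF.
have dg : is_derive x (1 : R) (fun y : R => 1 + y ^+ 2) (2 * x).
  by apply: is_derive_eq; rewrite /GRing.scale/=; ring.
by apply: is_derive_eq; rewrite /GRing.scale/=; ring.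
Qed.

Lemma atan_derive_lower x : `|x| <= 1 -> 2^-1 <= (1 + x ^+ 2)^-1.
Proof.
move=> x1; rewrite lef_pV2 ?posrE//.
have : x ^+ 2 <= 1 by rewrite -(expr1n _ 2); exact: ler_sqr_norm.
by lra.
Qed.

Lemma atan_derive_bound x : `|(1 + x ^+ 2)^-1| <= 1.
Proof.
rewrite ger0_norm; first by rewrite invf_le1 ?den// lerDl sqr_ge0.
by rewrite invr_ge0 ltW.
Qed.

Lemma atan_derive2_bound x : `|- (2 * x) * (1 + x ^+ 2) ^- 2| <= 1.
Proof.
rewrite normrM normrN normfV [`|_ ^+ 2|]ger0_norm ?sqr_ge0//.
rewrite ler_pdivrMr ?exprn_gt0// mul1r ler_norml.
by have := sqr_ge0 (1 + x); have := sqr_ge0 (1 - x); have := sqr_ge0 (x ^+ 2);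
  have := sqr_ge0 x; rewrite !expr2; nra.
Qed.

End arctangent.

(** * The formula for the reflected equation *)

Section ito_formula_reflected.
Context (R : realType) (d : measure_display) (Omega : measurableType d).
Variables (P : probability Omega R) (T : R) (F : R -> set_system Omega).
Variable B : R -> Omega -> R.
Local Notation mu := (@lebesgue_measure R).
Hypothesis hF : filtration T F.
Hypothesis hB : brownian_motion P T F B.
Hypothesis T0 : 0 < T.
Variables (K : R) (H Hb I X L Xt : R -> Omega -> R).
Hypothesis K0 : 0 <= K.
Hypothesis hI : ito_integral P T F B H I.
Hypothesis HK : {ae P, forall w, measurable_fun `[0, T] (H ^~ w) /\
  {ae mu, forall r, 0 <= r <= T -> `|H r w| <= K}}.
Hypothesis bHb : bounded_process T Hb K.
Hypothesis HHb : {ae P, forall w, forall r : R, 0 <= r <= T -> Hb r w = clip K (H r w)}.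
Hypothesis aX : adapted T F X.
Hypothesis cX : continuous_paths P T X.
Hypothesis X0 : {ae P, forall w, forall t : R, 0 <= t <= T -> 0 <= X t w}.
Hypothesis hL : local_time0 P T X L.
Hypothesis XIL : {ae P, forall w, forall t : R, 0 <= t <= T ->
  X t w = X 0 w + I t w + 2^-1 * L t w}.
Hypothesis mXt : measurable_fun (`]0, T]%classic `*` [set: Omega])
  (fun z : measurableTypeR R * Omega => Xt z.1 z.2).
Hypothesis XtX : {ae P, forall w, forall r : R, 0 <= r <= T -> Xt r w = X r w}.
Variables (f f1 f2 f3 : R -> R) (M0 M1 M2 M3 : R).
Hypothesis df : forall x, is_derive x (1 : R) f (f1 x).
Hypothesis df1 : forall x, is_derive x (1 : R) f1 (f2 x).
Hypothesis df2 : forall x, is_derive x (1 : R) f2 (f3 x).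
Hypotheses (fM0 : forall x, `|f x| <= M0) (f1M1 : forall x, `|f1 x| <= M1).
Hypotheses (f2M2 : forall x, `|f2 x| <= M2) (f3M3 : forall x, `|f3 x| <= M3).
Hypothesis f10 : exists C, forall x, `|f1 x| <= C * `|x|.

Lemma exp_ito_formula t : 0 <= t <= T ->
  \int[P]_w f (X t w) - \int[P]_w f (X 0 w) =
  2^-1 * \int[P]_w \int[mu]_(r in `]0, t]) (f2 (Xt r w) * Hb r w ^+ 2).
Proof.
move=> tT; have [t0 tT'] := andP tT.
have [h [J [hJ cI cH0]]] := ito_simple_approximation hF hB T0 K0 hI HK.
have [mI _ _] := hI; have [mL cL _] := hL.
(* [Hb] agrees with the clipped integrand outside of a null set only, which convergence in
   probability ignores. *)
have cH : cvg0_in_probability P (fun n w =>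
    (\int[mu]_(r in `]0%R, T]) ((h n r w - Hb r w) ^+ 2)%:E)%E).
  apply: cvg0_probability_le cH0 => e e0; exists e => // n.
  apply: filterS HHb => w E; congr (_ <= _)%E; apply: eq_integral => r.
  by rewrite inE/= in_itv/= => /andP[r0 rT]; rewrite E// (ltW r0).
have XL a b := local_time_increment cX X0 hL (a := a) (b := b).
have grid n : exists s, all_steps (fun u v => elementary_on T F B K (h n) (J n) u v /\
    v - u <= n.+1%:R^-1) 0 s /\ last 0 s = t.
  by apply: (simple_on_grid hF (simple_on_sub hF (hJ n) (lexx 0) t0 tT')); rewrite invr_gt0.
have [s hs] := choice grid.
have hs1 n := (hs n).1; have hs2 n := (hs n).2.
have datan x : is_derive x (1 : R) (@atan R) (1 + x ^+ 2)^-1 by exact: is_derive1_atan.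
have atanb x : `|@atan R x| <= pi / 2 by rewrite ler_norml !ltW ?atan_gtNpi2 ?atan_ltpi2.
have iL : integrable_rv P (fun w => Num.max 0 (L t w - L 0 w)).
  apply: (integrable_local_time hF hB T0 hJ mI cI bHb cH aX cX mL cL XIL XL tT hs1 hs2
    datan (@is_derive_atan_derive R) atanb (@atan_derive_bound R) (@atan_derive2_bound R)).
    by move=> x; rewrite invr_ge0 addr_ge0// sqr_ge0.
  exact: atan_derive_lower.
exact: (exp_ito_formula_grid hF hB T0 hJ mI cI bHb cH aX cX cL XIL XL tT hs1 hs2
  df df1 fM0 f1M1 f2M2 iL f10 df2 f3M3 mXt XtX).
Qed.

End ito_formula_reflected.

(** * Space-time measurability and null sets *)

Section measurable_version.
Context (R : realType).
Implicit Types c r : R.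

(** The cells are open on the left, so they partition ]0, +oo[ and the cell of a positive time is
    unique. *)
Lemma grid_cell c r : 0 < c -> 0 < r -> exists i : nat, i%:R * c < r <= i.+1%:R * c.
Proof.
move=> c0 r0; have ex : exists i : nat, r <= i.+1%:R * c.
  exists (Num.truncn (r / c)); rewrite -ler_pdivrMr//.
  exact/ltW/truncnS_gt.
have := ex_minnP ex; case=> -[|i] ri imin; first by exists 0%N; rewrite mul0r r0.
exists i.+1; rewrite ri andbT ltNge; apply/negP => h.
by have := imin _ h; rewrite ltnn.
Qed.

Lemma grid_cell_inj c r (i j : nat) : 0 < c ->
  i%:R * c < r <= i.+1%:R * c -> j%:R * c < r <= j.+1%:R * c -> i = j.
Proof.
move=> c0 /andP[i1 i2] /andP[j1 j2].
have := lt_le_trans i1 j2; have := lt_le_trans j1 i2.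
rewrite !ltr_pM2r// !ltr_nat !ltnS => ji ij.
by apply/eqP; rewrite eqn_leq ij.
Qed.

Lemma sum_grid_indic c r (m i : nat) (a : nat -> R) : 0 < c ->
  i%:R * c < r <= i.+1%:R * c -> (i < m)%N ->
  \sum_(j < m) \1_(`]j%:R * c, j.+1%:R * c]%classic : set R) r * a j = a i.
Proof.
move=> c0 ri im; rewrite (bigD1 (Ordinal im))//= big1 ?addr0.
  by rewrite indicE mem_set ?mul1r//= in_itv.
move=> j ji; rewrite indicE memNset ?mul0r//= in_itv/= => rj.
by move/eqP: ji; apply; apply: val_inj => /=; exact: grid_cell_inj rj ri.
Qed.

Context (d : measure_display) (Omega : measurableType d).
Variables (P : probability Omega R) (T : R).

(* X is only adapted, with paths continuous outside of a null set: joint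
   measurability requires to kill X on that set. *)
Lemma measurable_version (X : R -> Omega -> R) : 0 < T ->
  (forall t, 0 <= t <= T -> measurable_fun setT (X t)) ->
  continuous_paths P T X ->
  {ae P, forall w, forall t : R, 0 <= t <= T -> 0 <= X t w} ->
  exists Xt : R -> Omega -> R,
  [/\ measurable_fun (`]0, T]%classic `*` [set: Omega])
        (fun z : measurableTypeR R * Omega => Xt z.1 z.2),
      forall t, 0 <= t <= T -> measurable_fun setT (Xt t),
      forall r w, 0 <= r <= T -> 0 <= Xt r w &
      {ae P, forall w, forall r : R, 0 <= r <= T -> Xt r w = X r w}].
Proof.
move=> T0 mX cX X0.
have [N [mN N0 HN]] := filterI cX X0.
pose Xt r w := \1_(~` N) w * X r w.
have mXt t : 0 <= t <= T -> measurable_fun setT (Xt t).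
  move=> tT; apply: measurable_funM; last exact: mX.
  by apply: measurable_indic; exact: measurableC.
have good w : ~ N w -> {within `[0, T], continuous (X ^~ w)} /\
    forall t : R, 0 <= t <= T -> 0 <= X t w.
  by move=> nN; apply: contrapT => ng; exact/nN/HN.
exists Xt; split => //; last 2 first.
- move=> r w rT; rewrite /Xt indicE; have [|_] := boolP (w \in ~` N); last by rewrite mul0r.
  by rewrite inE mul1r => nN; apply: (good w nN).2.
- exists N; split=> // w /= H; apply: contrapT => nN; apply: H => r rT.
  by rewrite /Xt indicE mem_set ?mul1r.
pose c n : R := T / n.+1%:R.
have c0 n : 0 < c n by rewrite divr_gt0.
(* The process is read at the right end of each cell, a time of [0, T]; no adaptedness is at stake
   in joint measurability. *)
pose Y n (z : measurableTypeR R * Omega) := \sum_(j < n.+1)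
  \1_(`]j%:R * c n, j.+1%:R * c n]%classic : set R) z.1 * Xt (j.+1%:R * c n) z.2.
have jcT n (j : nat) : (j < n.+1)%N -> 0 <= j.+1%:R * c n <= T.
  move=> jn; rewrite mulr_ge0 ?(ltW (c0 n))//= /c mulrCA ger_pMr//.
  by rewrite ler_pdivrMr// mul1r ler_nat.
apply: (@measurable_fun_cvg _ _ _ _ Y).
  move=> n; apply: measurable_funTS; apply: measurable_sum => j.
  apply: measurable_funM.
    exact: (measurableT_comp (measurable_indic _) measurable_fst).
  by apply: (measurableT_comp (mXt _ (jcT n j (ltn_ord j)))) measurable_snd.
move=> [r w] [/=]; rewrite in_itv/= => /andP[r0 rT] _.
have [nN|Nw] := pselect (~ N w); last first.
  have XN t : Xt t w = 0 by rewrite /Xt indicE memNset ?mul0r//= => /(_ (contrapT _ Nw)).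
  rewrite XN; apply: cvg_near_cst; apply: nearW => n.
  by rewrite /Y big1// => j _; rewrite /= XN mulr0.
have [cXw _] := good w nN.
have XE t : Xt t w = X t w by rewrite /Xt indicE mem_set// mul1r.
apply/cvgrPdist_le => e e0.
have [dl dl0 Hdl] := uniform_continuity cXw e0.
have := near_mul_le T (@cvg_harmonic R) dl0; apply: filterS => n hn.
have [i ri] := grid_cell (c0 n) r0.
have im : (i < n.+1)%N.
  rewrite -(ltr_nat R) -(ltr_pM2r (c0 n)); case/andP: ri => ri _.
  by apply: (lt_le_trans ri); rewrite /c mulrCA divff ?mulr1// pnatr_eq0.
rewrite /Y (sum_grid_indic (fun j => Xt (j.+1%:R * c n) w) (c0 n) ri im) !XE.
have rT' : 0 <= r <= T by rewrite (ltW r0).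
apply: (Hdl _ _ rT' (jcT _ _ im)); apply: le_trans hn; case/andP: ri => r1 r2.
rewrite distrC ger0_norm ?subr_ge0// lerBlDr.
rewrite (_ : _.+1%:R * _ = c n + i%:R * c n); last by rewrite -natr1 mulrDl mul1r addrC.
by rewrite /c/= lerD2l ltW.
Qed.

End measurable_version.

Lemma measurable_fun_pair_on (R : realType) (d : measure_display) (S : measurableType d)
    (D : set S) (f g : S -> measurableTypeR R) : measurable D ->
  measurable_fun D f -> measurable_fun D g -> measurable_fun D (fun x => (f x, g x)).
Proof.
move=> mD mf mg.
have mf' : measurable_fun setT (f \_ D) by apply/(measurable_restrictT _ _).1.
have mg' : measurable_fun setT (g \_ D) by apply/(measurable_restrictT _ _).1.
apply: (eq_measurable_fun (fun x => ((f \_ D) x, (g \_ D) x))).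
  by move=> x xD; rewrite !patchE xD.
by apply: measurable_funTS; exact: measurable_fun_pair.
Qed.

(** * Null sets of space-time seen along the paths *)

Section product_null_sets.
Context (R : realType).
Local Notation mu := (@lebesgue_measure R).

Lemma ae_lebesgueS2 (A B C : R -> Prop) : (forall r, A r -> B r -> C r) ->
  {ae mu, forall r, A r} -> {ae mu, forall r, B r} -> {ae mu, forall r, C r}.
Proof.
move=> ABC [N [mN N0 AN]] [M [mM M0 BM]]; exists (N `|` M); split.
- exact: measurableU.
- exact: null_set_setU.
- move=> r /= nC; apply: contrapT => /not_orP[nN nM].
  by apply: nC; apply: ABC; apply: contrapT => ?; [exact/nN/AN|exact/nM/BM].
Qed.

Lemma null_product_section (N : set (measurableTypeR R * measurableTypeR R)) :
  measurable N -> (mu \x mu)%E N = 0%E -> {ae mu, forall s, mu (xsection N s) = 0%E}.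
Proof.
move=> mN N0.
have mf := measurable_fun_xsection mu mN.
have : ae_eq mu setT (mu \o xsection N) (cst 0%E).
  apply/ae_eq_integral_abs => //; rewrite -[RHS]N0.
  by apply: eq_integral => x _; rewrite gee0_abs.
by apply: filterS => s /(_ I).
Qed.

Context (d : measure_display) (Omega : measurableType d).
Variables (P : probability Omega R) (T : R) (Xt : R -> Omega -> R).
Hypothesis mXt : measurable_fun (`]0, T]%classic `*` [set: Omega])
  (fun z : measurableTypeR R * Omega => Xt z.1 z.2).
Hypothesis mXr : forall r, 0 < r <= T -> measurable_fun setT (Xt r).
Hypothesis acX : forall r, 0 < r <= T -> forall C : set R, measurable C ->
  mu C = 0%E -> P (Xt r @^-1` C) = 0%E.

Lemma measurable_process_pair :
  measurable_fun (`]0, T]%classic `*` [set: Omega])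
    (fun z : measurableTypeR R * Omega => (z.1, Xt z.1 z.2) : measurableTypeR R * measurableTypeR R).
Proof.
apply: measurable_fun_pair_on => //; first exact: measurableX.
by apply: (measurable_funTS (f := fst)); exact: measurable_fst.
Qed.

(** Fubini's theorem twice. Almost every time section of the exceptional set is Lebesgue null, hence
    null for the law of [Xt r]; so the expected time that the path spends in the exceptional set is
    0. This transfers the bound on [chi] to the integrand of the stochastic integral. *)
Lemma ae_process (A : R * R -> Prop) : {ae (mu \x mu)%E, forall z, A z} ->
  {ae P, forall w, {ae mu, forall r, 0 < r <= T -> A (r, Xt r w)}}.
Proof.
move=> [N [mN N0 HN]].
pose g r w : R := \1_N (r, Xt r w).
(* The times in [N'], where the section of [N] may have positive measure, are removed from [I]: the
   expectation of [g r] is then 0 at every time left. *)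
have [N' [mN' N'0 HN']] := null_product_section mN N0.
pose I := (`]0, T]%classic : set (measurableTypeR R)) `\` N'.
have mI : measurable I by exact: measurableD.
have fI : (mu I < +oo)%E.
  apply: le_lt_trans (lebesgue_measure_itvoc_fin 0 T).
  by apply: le_measure; rewrite ?inE//; exact: subDsetl.
have mg : measurable_fun (I `*` [set: Omega])
    (fun z : measurableTypeR R * Omega => g z.1 z.2).
  have m : measurable_fun (`]0, T]%classic `*` [set: Omega]) (fun z : measurableTypeR R * Omega => g z.1 z.2).
    exact: (measurableT_comp (measurable_indic mN) measurable_process_pair).
  apply: measurable_funS m; first exact: measurableX.
  by move=> z [[? _] ?].
have gM (r : measurableTypeR R) w : I r -> `|g r w| <= 1.
  by move=> _; rewrite /g indicE; case: (_ \in _); rewrite ?normr1 ?normr0.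
have g0 r w : 0 <= g r w by rewrite /g indicE.
have ig w := integrable_section mI fI mg gM w.
have h0 : (\int[P]_w (\int[mu]_(r in I) g r w)%:E = 0)%E.
  rewrite (exp_integral_section P mI fI mg gM); apply: integral0_eq => r [/=].
  rewrite in_itv/= => rT nN'.
  have mC : measurable (xsection N r) by exact: measurable_xsection.
  have C0 : mu (xsection N r) = 0%E by apply: contrapT => ?; exact/nN'/HN'.
  have mp : measurable (Xt r @^-1` xsection N r).
    by rewrite -[X in measurable X]setTI; exact: mXr.
  transitivity (\int[P]_w (\1_(Xt r @^-1` xsection N r) w)%:E)%E; last first.
    by rewrite integral_indic// setIT; exact: (acX rT mC C0).
  apply: eq_integral => w _; congr EFin; rewrite /g !indicE.
  have -> // : ((r, Xt r w) \in N) = (w \in Xt r @^-1` xsection N r).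
  by apply/idP/idP; rewrite !inE /xsection/= inE.
have mG := measurable_integral_section P mI fI mg gM.
have : ae_eq P setT (fun w => (\int[mu]_(r in I) g r w)%:E) (cst 0%E).
  apply/ae_eq_integral_abs => //; first exact/measurable_EFinP.
  rewrite -[RHS]h0; apply: eq_integral => w _; rewrite gee0_abs// lee_fin.
  exact: Rintegral_ge0.
apply: filterS => w Hw; have {Hw} w0 : \int[mu]_(r in I) g r w = 0 by apply: EFin_inj; exact: Hw.
have : ae_eq mu I (fun r => (g r w)%:E) (cst 0%E).
  apply/ae_eq_integral_abs => //; first exact: measurable_int (ig w).
  rewrite -[RHS]/(0%:E) -w0 /Rintegral fineK; last by apply: integrable_fin_num => //; exact: ig.
  by apply: eq_integral => r _; rewrite gee0_abs ?lee_fin.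
move=> h1; have h2 : {ae mu, forall r, ~ N' r} by exists N'; split=> // r /contrapT.
apply: (ae_lebesgueS2 _ h1 h2) => r /= gr nN' rT.
have Ir : I r by split; rewrite //= in_itv.
have grw : g r w = 0 by apply: EFin_inj; exact: gr.
apply: contrapT => nA; move: grw; rewrite /g indicE mem_set; last exact: HN.
by move/eqP; rewrite oner_eq0.
Qed.

End product_null_sets.

(** * The graph of beta *)

Section monotone_graph.
Context (R : realType) (beta : R -> R) (c : R).
Hypothesis beta0 : forall x, 0 <= x -> 0 <= beta x.
Hypothesis beta_nd : {in `[0, +oo[ &, {homo beta : x y / x <= y}}.
Hypothesis betaZ : beta 0 = 0.
Hypothesis betac : forall x, 0 <= x -> `|beta x| <= c * x.

Lemma linear_growth_ge0 : 0 <= c.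
Proof. by have := le_trans (normr_ge0 _) (betac ler01); rewrite mulr1. Qed.

Let beta_le x : 0 <= x -> beta x <= c * x.
Proof. by move=> x0; exact: le_trans (ler_norm _) (betac x0). Qed.

Lemma is_cvg_beta_right x : 0 <= x -> cvg (beta z @[z --> x^'+]).
Proof.
move=> x0; apply: nondecreasing_at_right_is_cvgr.
  near=> y => u v; rewrite !in_itv/= => /andP[xu _] /andP[xv _].
  by apply: beta_nd; rewrite in_itv/= andbT (le_trans x0)// ltW.
near=> y; exists 0 => _ /= [z + <-]; rewrite in_itv/= => /andP[xz _].
by apply: beta0; rewrite (le_trans x0)// ltW.
Unshelve. all: by end_near. Qed.

Lemma is_cvg_beta_left x : 0 < x -> cvg (beta z @[z --> x^'-]).
Proof.
move=> x0; apply: nondecreasing_at_left_is_cvgr.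
  near=> y => u v; rewrite !in_itv/= => /andP[yu _] /andP[yv _].
  have y0 : 0 <= y by near: y; exact: nbhs_left_ge.
  by apply: beta_nd; rewrite in_itv/= andbT (le_trans y0)// ltW.
near=> y; exists (beta x) => _ /= [z + <-]; rewrite in_itv/= => /andP[yz zx].
have y0 : 0 <= y by near: y; exact: nbhs_left_ge.
by apply: beta_nd; rewrite ?in_itv/= ?andbT ?ltW// (le_lt_trans y0).
Unshelve. all: by end_near. Qed.

(** The right limit of [beta] at [x] is at most c z for every z > x, hence at most c x; the left end
    of the gap is nonnegative, at 0 because it is read as [beta 0]. *)
Lemma beta_graph_bound x y : beta_graph beta x y -> 0 <= y <= c * x.
Proof.
move=> [x0 yl yr]; apply/andP; split.
  apply: le_trans yl; case: eqVneq => [_|xN0]; first by rewrite betaZ.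
  have {}x0 : 0 < x by rewrite lt_neqAle eq_sym xN0.
  apply: limr_ge; first exact: is_cvg_beta_left.
  near=> z; apply: beta0; near: z; exact: nbhs_left_ge.
apply: (le_trans yr); apply/ler_addgt0Pl => e e0.
have c1 : 0 < c + 1 by rewrite ltr_wpDl// linear_growth_ge0.
apply: limr_le; first exact: is_cvg_beta_right.
near=> z; have xz : x < z by near: z; exact: nbhs_right_gt.
have zx : z < x + e / (c + 1) by near: z; apply: nbhs_right_lt; rewrite ltrDl divr_gt0.
apply: (le_trans (beta_le (le_trans x0 (ltW xz)))).
apply: (le_trans (ler_wpM2l linear_growth_ge0 (ltW zx))).
rewrite mulrDr addrC lerD2r mulrCA ler_piMr ?(ltW e0)//.
by rewrite ler_pdivrMr// mul1r lerDl.
Unshelve. all: by end_near. Qed.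

Lemma beta_graph00 : beta_graph beta 0 0.
Proof.
split=> //; first by rewrite eqxx betaZ.
apply: limr_ge; first exact: is_cvg_beta_right.
by near=> z; apply: beta0; near: z; exact: nbhs_right_ge.
Unshelve. all: by end_near. Qed.

Lemma Phi_pos_bound x p : Phi_pos beta x p -> 0 <= p <= Num.sqrt c.
Proof.
move=> [x0 [y /beta_graph_bound/andP[y0 ycx] ->]].
by rewrite sqrtr_ge0 ler_wsqrtr// ler_pdivrMr.
Qed.

(** At 0, the bounds hold for the whole graph on ]0, +oo[, so in the upper and lower limits the
    neighbourhood may be taken to be the full set. *)
Lemma Phi_bound x p : Phi beta x p -> 0 <= p <= Num.sqrt c.
Proof.
rewrite /Phi; case: eqVneq => [_|_]; last exact: Phi_pos_bound.
move=> [pl pr]; apply/andP; split; rewrite -lee_fin.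
  apply: le_trans pl; apply: le_ereal_sup_tmp.
  exists (ereal_inf (EFin @` \bigcup_(x in setT) Phi_pos beta x)).
    by exists setT => //; exact: filterT.
  apply: le_ereal_inf_tmp => _ [q [z _ /Phi_pos_bound/andP[q0 _]] <-].
  by rewrite lee_fin.
apply: (le_trans pr); apply: ge_ereal_inf.
exists (ereal_sup (EFin @` \bigcup_(x in setT) Phi_pos beta x)).
  by exists setT => //; exact: filterT.
apply: ge_ereal_sup => _ [q [z _ /Phi_pos_bound/andP[_ qc]] <-].
by rewrite lee_fin.
Qed.

(** At [x = 0] the value of [p] is irrelevant, since the product is 0 and 0 belongs to the graph
    there. For [x > 0] the square root is undone. *)
Lemma Phi_beta_graph x p : 0 <= x -> Phi beta x p -> beta_graph beta x (p ^+ 2 * x).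
Proof.
rewrite le_eqVlt => /predU1P[<- _|x0]; first by rewrite mulr0; exact: beta_graph00.
rewrite /Phi gt_eqF// => -[_ [y yb ->]].
have /andP[y0 _] := beta_graph_bound yb.
by rewrite sqr_sqrtr ?divr_ge0 ?(ltW x0)// divfK// gt_eqF.
Qed.

End monotone_graph.

(** * Derivatives of test functions *)

Section test_functions.
Context (R : realType).

Lemma compact_support_bounded (g : R -> R) (A : set R) : continuous g ->
  compact A -> (forall x, ~ A x -> g x = 0) -> exists M, forall x, `|g x| <= M.
Proof.
move=> cg cA gA.
have [M [_ HM]] := compact_bounded (continuous_compact (continuous_subspaceT cg) cA).
exists (Num.max (M + 1) 0) => x; have [Ax|/gA ->] := pselect (A x); last first.
  by rewrite normr0 le_max lexx orbT.
rewrite le_max; apply/orP; left; apply: (HM (M + 1)); first by rewrite ltrDl.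
by exists x.
Qed.

(** The complement of [A] is open, so near each of its points [g] coincides with the zero
    function. *)
Lemma derive_closed_support (g g' : R -> R) (A : set R) : closed A ->
  (forall x, is_derive x (1 : R) g (g' x)) ->
  (forall x, ~ A x -> g x = 0) -> forall x, ~ A x -> g' x = 0.
Proof.
move=> cA dg gA x nAx.
have nb : nbhs x (~` A) by apply: open_nbhs_nbhs; split=> //; exact: closed_openC.
have : is_derive x (1 : R) (cst 0 : R -> R) (g' x).
  by apply: near_eq_is_derive (dg x); apply: filterS nb => y /gA ->.
by move=> [_ <-]; rewrite derive_cst.
Qed.

Lemma test_functionP (phi : R -> R) : test_function phi ->
  [/\ forall n x, is_derive x (1 : R) (phi^`(n))%classic ((phi^`(n.+1))%classic x),
      exists2 A, compact A & forall n x, ~ A x -> (phi^`(n))%classic x = 0 &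
      forall n, exists M, forall x, `|(phi^`(n))%classic x| <= M].
Proof.
move=> [dphi cpt].
have dn n x : is_derive x (1 : R) (phi^`(n))%classic ((phi^`(n.+1))%classic x).
  by rewrite derive1nS derive1E; apply: DeriveDef.
pose A := closure [set x | phi x != 0].
have A0 n x : ~ A x -> (phi^`(n))%classic x = 0.
  elim: n x => [x nA|n IH].
    rewrite derive1n0; apply: contrapT => /eqP nz; apply: nA.
    exact: subset_closure.
  by apply: (derive_closed_support _ (dn n) IH); exact: closed_closure.
split=> //; first by exists A.
move=> n; apply: (compact_support_bounded _ cpt (A0 n)) => x.
by apply/differentiable_continuous/derivable1_diffP.
Qed.

End test_functions.

(** * End points of intervals and the space-time domain *)

Section lebesgue_intervals.
Context (R : realType).
Local Notation mu := (@lebesgue_measure R).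

Lemma integral_itvcc_itvoc (F : R -> \bar R) (a b : R) : a <= b ->
  measurable_fun (`]a, b]%classic : set (measurableTypeR R)) F ->
  (\int[mu]_(r in `[a, b]) F r = \int[mu]_(r in `]a, b]) F r)%E.
Proof.
move=> ab mF.
have E : `[a, b]%classic = [set a] `|` `]a, b]%classic :> set (measurableTypeR R).
  apply/seteqP; split=> r /=; rewrite !in_itv/=.
    by move=> /andP[]; rewrite le_eqVlt => /predU1P[->|ar rb]; [left|right; rewrite ar].
  by move=> [->|/andP[ar ->]]; rewrite ?lexx ?ab// (ltW ar).
have mF' : measurable_fun (`[a, b]%classic : set (measurableTypeR R)) F.
  by rewrite E; apply/measurable_funU => //; split=> //; exact: measurable_fun_set1.
rewrite integral_mkcond [RHS]integral_mkcond; apply: ae_eq_integral => //.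
- by apply/(measurable_restrictT _ _).1.
- by apply/(measurable_restrictT _ _).1.
exists [set a]; split=> //; first exact: lebesgue_measure_set1.
move=> r /= nE; apply: contrapT => ra; apply: nE => _.
rewrite !patchE E in_setU; have -> // : (r \in [set a]) = false.
exact: memNset.
Qed.

Lemma ae_lebesgue_neq (a : R) : {ae mu, forall r : R, r <> a}.
Proof.
exists [set a]; split=> //; first exact: lebesgue_measure_set1.
by move=> r /contrapT.
Qed.

Lemma half_lineE (x : R) : half_line x = (0 <= x) :> Prop.
Proof. by rewrite /half_line/= in_itv/= andbT. Qed.

Lemma measurable_half_line : measurable (@half_line R : set (measurableTypeR R)).
Proof. exact: measurable_itv. Qed.

Lemma measurable_space_time (T : R) :
  measurable (space_time T : set (measurableTypeR R * measurableTypeR R)).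
Proof. by apply: measurableX; [exact: measurable_itv|exact: measurable_half_line]. Qed.

End lebesgue_intervals.

(** * Laws with a density on the half-line *)

Section half_line_law.
Context (R : realType) (d : measure_display) (Omega : measurableType d).
Variable P : probability Omega R.
Local Notation mu := (@lebesgue_measure R).

Lemma probability_ae_eq (Y Z : Omega -> R) (C : set R) : measurable_fun setT Y ->
  measurable_fun setT Z -> {ae P, forall w, Y w = Z w} -> measurable C ->
  P (Y @^-1` C) = P (Z @^-1` C).
Proof.
move=> mY mZ YZ mC.
have m (U : Omega -> R) : measurable_fun setT U -> measurable (U @^-1` C).
  by move=> mU; rewrite -[X in measurable X]setTI; exact: mU.
transitivity (\int[P]_w (\1_(Y @^-1` C) w)%:E)%E.
  by rewrite integral_indic// ?setIT//; exact: m.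
transitivity (\int[P]_w (\1_(Z @^-1` C) w)%:E)%E; last first.
  by rewrite integral_indic// ?setIT//; exact: m.
apply: ae_eq_integral => //.
- by apply/measurable_EFinP; apply: measurable_indic; exact: m.
- by apply/measurable_EFinP; apply: measurable_indic; exact: m.
apply: filterS YZ => w E _; rewrite !indicE.
have -> // : (w \in Y @^-1` C) = (w \in Z @^-1` C).
by apply/idP/idP; rewrite !inE /= E.
Qed.

Variables (Y : Omega -> R) (g : R -> R).
Hypothesis mY : measurable_fun setT Y.
Hypothesis hg : density_on_half_line g.
Hypothesis Yg : forall C : set R, measurable C ->
  (P (Y @^-1` C) = \int[mu]_(x in C `&` @half_line R) (g x)%:E)%E.

Let mg : measurable_fun (@half_line R : set (measurableTypeR R)) g.
Proof. by case: hg. Qed.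

Lemma half_line_law_null (C : set R) : measurable C -> mu C = 0%E -> P (Y @^-1` C) = 0%E.
Proof.
move=> mC C0; rewrite Yg//; apply: null_set_integral.
- exact: measurableI mC (@measurable_half_line R).
- apply/measurable_EFinP; apply: measurable_funS mg; first exact: measurable_half_line.
  exact: subIsetr.
- apply: subset_measure0 C0 => //.
  exact: measurableI mC (@measurable_half_line R).
Qed.

Lemma integral_half_line_law (f : R -> R) : measurable_fun setT f ->
  (\int[P]_w (f (Y w))%:E = \int[mu]_(x in @half_line R) (f x * g x)%:E)%E.
Proof.
(* The density is measurable on the half-line and nonnegative almost everywhere there; [gp] is a
   version that is measurable and nonnegative on the whole line. *)
move=> mf; pose gp := (fun x => Num.max 0 (g x)) \_ (@half_line R).
have mgp : measurable_fun setT gp.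
  apply/(measurable_restrictT _ _).1; first exact: measurable_half_line.
  exact: measurable_maxr.
have gp0 x : 0 <= gp x by rewrite /gp patchE; case: ifP => // _; rewrite le_max lexx.
have gE : {ae mu, forall x, @half_line R x -> gp x = g x}.
  case: hg => _ g0 _; apply: (ae_lebesgueS _ g0) => x gx xl.
  rewrite /gp patchE mem_set// max_r//; apply: gx.
  by move: xl; rewrite /half_line/= in_itv/= andbT.
have law C : measurable C -> P (Y @^-1` C) = (\int[mu]_(x in C) (gp x)%:E)%E.
  move=> mC; rewrite Yg// [RHS](_ : _ = (\int[mu]_(x in C) (((EFin \o gp) \_ (@half_line R)) x))%E); last first.
    by apply: eq_integral => x _; rewrite /gp /= !patchE /= patchE; case: (x \in _).
  rewrite -integral_mkcondr; apply: ae_eq_integral.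
  - exact: measurableI mC (@measurable_half_line R).
  - apply/measurable_EFinP; apply: measurable_funS mg; first exact: measurable_half_line.
    exact: subIsetr.
  - by apply/measurable_EFinP; exact: measurable_funTS.
  - by apply: (ae_lebesgueS _ gE) => x /= E [_ xl]; rewrite E.
rewrite (integral_law_density mY mgp gp0 law mf).
rewrite [RHS]integral_mkcond; apply: ae_eq_integral => //.
- by apply/measurable_EFinP; exact: measurable_funM.
- apply/(measurable_restrictT _ _).1; first exact: measurable_half_line.
  by apply/measurable_EFinP; apply: measurable_funM => //; exact: measurable_funTS.
- apply: (ae_lebesgueS _ gE) => x E _; rewrite patchE; case: ifPn => [|].
    by rewrite inE => /E ->.
  by move=> /negbTE xl; rewrite /gp patchE xl mulr0.
Qed.

End half_line_law.

(** * The density as a function of time and space *)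

Section space_time_density.
Context (R : realType) (T : R) (v : R * R -> R).
Local Notation mu := (@lebesgue_measure R).
Hypothesis T0 : 0 < T.
Hypothesis mv : measurable_fun (space_time T) v.
Hypothesis dv : forall t, 0 <= t <= T -> density_on_half_line (fun x => v (t, x)).

Let V := v \_ (space_time T).

Let mV : measurable_fun setT (V : measurableTypeR R * measurableTypeR R -> R).
Proof. by apply/(measurable_restrictT _ _).1; first exact: measurable_space_time. Qed.

(** Nonnegativity is given time by time, with a null set depending on the time. Joint measurability
    makes the set where [v] is negative measurable, and its sections are null. *)
Lemma space_time_density_ge0 :
  {ae (mu \x mu)%E, forall z, space_time T z -> 0 <= v z}.
Proof.
pose N : set (measurableTypeR R * measurableTypeR R) := V @^-1` `]-oo, 0[%classic.
have mN : measurable N by rewrite -[N]setTI; exact: mV.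
exists N; split=> //; last first.
  move=> z /= /not_implyP[zs vz]; rewrite /N/= in_itv/= /V patchE mem_set//.
  by rewrite ltNge; apply/negP.
rewrite /product_measure1; apply: integral0_eq => s _ /=.
have [sT|sT] := boolP (0 <= s <= T); last first.
  rewrite (_ : xsection N s = set0) ?measure0//.
  apply/seteqP; split=> // x; rewrite /xsection/= inE /N/= in_itv/= /V patchE.
  case: ifPn; rewrite ?ltxx// inE => -[/=]; rewrite in_itv/= => sT'.
  by rewrite sT' in sT.
have [_ [M [mM M0 HM]] _] := dv sT.
apply: (subset_measure0 (B := M)) => //; first exact: measurable_xsection.
move=> x; rewrite /xsection/= inE /N/= in_itv/= /V patchE.
case: ifPn; rewrite ?ltxx// inE => -[_ /=]; rewrite /half_line/= in_itv/= andbT => x0 vx.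
by apply: HM => /= /(_ x0); rewrite leNgt vx.
Qed.

(** At each time of [0, T] the space integral of |v| is 1, so the double integral is at most [T]. *)
Lemma integrable_space_time_density : (mu \x mu)%E.-integrable (space_time T) (EFin \o v).
Proof.
apply/(integrable_mkcond _ (@measurable_space_time R T)).2.
have -> : (EFin \o v) \_ (space_time T) = EFin \o V.
  by apply/funext => z; rewrite /V/= !patchE; case: ifP.
apply/integrable12ltyP; first exact/measurable_EFinP.
apply: (@le_lt_trans _ _ (\int[mu]_s (\1_(`[0, T]%classic : set (measurableTypeR R)) s)%:E)%E); last first.
  by rewrite integral_indic// setIT/= lebesgue_measure_itv/= lte_fin T0 -EFinD ltry.
apply: ge0_le_integral => //.
- by move=> s _; exact: integral_ge0.
- apply: (@measurable_fun_fubini_tonelli_F _ _ _ _ _ mu (fun z => `|(EFin \o V) z|)%E).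
    by apply: measurableT_comp => //; exact/measurable_EFinP.
  by move=> z; exact: abse_ge0.
- by apply/measurable_EFinP; exact: measurable_indic.
move=> s _; rewrite indicE; have [|sT] := boolP (s \in _).
  rewrite inE/= in_itv/= => sT; have [ms v0 v1] := dv sT.
  have mVs : measurable_fun setT (fun x : measurableTypeR R => V (s, x)).
    exact: (measurableT_comp mV (pair1_measurable _)).
  rewrite -v1 [leRHS]integral_mkcond le_eqVlt; apply/orP; left; apply/eqP.
  apply: ae_eq_integral => //.
  - apply/measurable_EFinP; exact: (measurableT_comp (@normr_measurable R _) mVs).
  - apply/(measurable_restrictT _ _).1; first exact: measurable_half_line.
    by apply/measurable_EFinP; exact: ms.
  apply: (ae_lebesgueS _ v0) => x v0x _; rewrite /V /= !patchE.
  have -> : ((s, x) \in space_time T) = (x \in @half_line R).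
    by apply/idP/idP; rewrite !inE; [move=> []|move=> xl; split; rewrite //= in_itv].
  case: ifPn; rewrite ?normr0// inE /half_line/= in_itv/= andbT => x0.
  by rewrite ger0_norm// v0x.
rewrite integral0_eq// => x _; rewrite /V/= patchE ifF ?normr0//.
by apply/negP; rewrite inE => -[/= sT' _]; move: sT; rewrite mem_set.
Qed.

End space_time_density.

(** * The weak formulation *)

Section weak_formulation.
Context (R : realType) (T : R) (beta u0 : R -> R).
Context (d : measure_display) (Omega : measurableType d).
Variables (P : probability Omega R) (F : R -> set_system Omega).
Variables (B X : R -> Omega -> R) (v chi : R * R -> R).
Local Notation mu := (@lebesgue_measure R).
Hypothesis T0 : 0 < T.
Hypothesis h1 : assumption1 beta u0.
Hypothesis hX : solution_in_law P T beta u0 F B X v chi.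
Variable c : R.
Hypothesis betac : forall x, 0 <= x -> `|beta x| <= c * x.

Let K := Num.sqrt c.

(* This is a.e. chi ^ 2 * v; thanks to the clipping, K ^ 2 * |v| bounds it
   everywhere. *)
Definition flux (z : R * R) : R := clip K (chi z) ^+ 2 * v z.

Let K0 : 0 <= K. Proof. exact: sqrtr_ge0. Qed.
Let hF := sol_filtration hX.
Let hB := sol_brownian hX.

Lemma ae_product_imply2 (A1 A2 A3 : R * R -> Prop) :
  (forall z, A1 z -> A2 z -> A3 z) ->
  {ae (mu \x mu)%E, forall z, A1 z} -> {ae (mu \x mu)%E, forall z, A2 z} ->
  {ae (mu \x mu)%E, forall z, A3 z}.
Proof.
move=> A123 [N [mN N0 AN]] [M [mM M0 AM]]; exists (N `|` M); split.
- exact: measurableU.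
- exact: null_set_setU.
- move=> z /= nC; apply: contrapT => /not_orP[nN nM].
  by apply: nC; apply: A123; apply: contrapT => ?; [exact/nN/AN|exact/nM/AM].
Qed.

Let Phi_chi z : Phi beta (v z) (chi z) -> `|chi z| <= K.
Proof.
move=> /(Phi_bound (beta_ge0 h1) (beta_nondecreasing h1) (beta_at0 h1) betac)/andP[p0 pc].
by rewrite ger0_norm.
Qed.

(** Where [chi z] belongs to [Phi beta (v z)], it is bounded by [K] and the clipping is inactive. *)
Lemma flux_graph :
  {ae (mu \x mu)%E, forall z, space_time T z -> beta_graph beta (v z) (flux z)}.
Proof.
have v0 := space_time_density_ge0 (sol_v_measurable hX) (fun t tT => (sol_density hX tT).1).
apply: (ae_product_imply2 _ (sol_chi_Phi hX) v0) => z Pz vz zs.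
rewrite /flux (clip_id (Phi_chi (Pz zs))).
apply: (Phi_beta_graph (beta_ge0 h1) (beta_nondecreasing h1) (beta_at0 h1) betac); first exact: vz.
exact: Pz.
Qed.

Lemma integrable_v : (mu \x mu)%E.-integrable (space_time T) (EFin \o v).
Proof.
exact: (integrable_space_time_density T0 (sol_v_measurable hX) (fun t tT => (sol_density hX tT).1)).
Qed.

Let measurable_clip_chi : measurable_fun (space_time T) (fun z => clip K (chi z)).
Proof. exact: (measurableT_comp (@measurable_clip R K) (sol_chi_measurable hX)). Qed.

Lemma integrable_flux : (mu \x mu)%E.-integrable (space_time T) (EFin \o flux).
Proof.
have mST := @measurable_space_time R T.
have i := integrableZl mST (K ^+ 2) integrable_v.
apply: (le_integrable mST _ _ i).
  apply/measurable_EFinP; apply: measurable_funM; last exact: sol_v_measurable hX.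
  exact: measurable_funX.
move=> z _; rewrite /= lee_fin /flux normrM [leRHS]normrM; apply: ler_wpM2r => //.
by rewrite !normrX lerXn2r ?nnegrE// [leRHS]ger0_norm//; exact: norm_clip_le.
Qed.

Let mX t : 0 <= t <= T -> measurable_fun setT (X t).
Proof.
move=> tT; have [aX _ _] := sol_semimartingale hX.
exact: (measurable_wrt_measurable hF tT (aX t tT)).
Qed.

(** The formula in expectation, rewritten with the densities: at fixed times through the law of [X],
    and in the second order term after exchanging expectation and time integral. It holds at every
    time. *)
Lemma generator_identity (phi : R -> R) (t : R) : test_function phi ->
  (phi^`())%classic 0 = 0 -> 0 <= t <= T ->
  (\int[mu]_(x in @half_line R) (phi x * v (t, x))%:E =
   \int[mu]_(x in @half_line R) (phi x * u0 x)%:E +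
   (2^-1)%:E * \int[mu]_(s in `[0%R, t])
     \int[mu]_(x in @half_line R) ((phi^`(2))%classic x * flux (s, x))%:E)%E.
Proof.
move=> tphi phi0 tT; have [t0 tT'] := andP tT.
have [dphi _ bphi] := test_functionP tphi.
have [M0 fM0] := bphi 0%N; have [M1 fM1] := bphi 1%N.
have [M2 fM2] := bphi 2%N; have [M3 fM3] := bphi 3%N.
have mphi n : measurable_fun setT (phi^`(n))%classic := is_derive_measurable (dphi n).
have [aX cX _] := sol_semimartingale hX.
have X0 := sol_ge0 hX.
have [Xt [mXt mXr Xt0 XtX]] := measurable_version T0 mX cX X0.
have law r (rT : 0 <= r <= T) := sol_density hX rT.
have XtXr r : 0 <= r <= T -> {ae P, forall w, Xt r w = X r w}.
  by move=> rT; apply: filterS XtX => w; apply.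
have lawt r (rT : 0 <= r <= T) (C : set R) : measurable C ->
    (P (Xt r @^-1` C) = \int[mu]_(x in C `&` @half_line R) (v (r, x))%:E)%E.
  move=> mC; rewrite -((law r rT).2 C mC).
  exact: (probability_ae_eq (mXr r rT) (mX rT) (XtXr r rT) mC).
have oc r : 0 < r <= T -> 0 <= r <= T by move=> /andP[/ltW -> ->].
pose Hb r w := clip K (chi (r, Xt r w)).
have mpair := measurable_process_pair mXt.
have mHb : measurable_fun (`]0, T]%classic `*` [set: Omega])
    (fun z : measurableTypeR R * Omega => Hb z.1 z.2).
  apply: (measurable_comp (@measurable_space_time R T) _ measurable_clip_chi mpair).
  move=> _ [[r w] [/= + _] <-]; rewrite in_itv/= => rT; split; rewrite /= ?half_lineE ?in_itv/=.
    exact: oc.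
  by apply: Xt0; exact: oc.
have bHb : bounded_process T Hb K by split=> // r w _; exact: norm_clip_le.
have HHb : {ae P, forall w, forall r : R, 0 <= r <= T -> Hb r w = clip K (chi (r, X r w))}.
  by apply: filterS XtX => w E r rT; rewrite /Hb E.
have chiK : {ae (mu \x mu)%E, forall z, space_time T z -> `|chi z| <= K}.
  apply: (ae_product_imply2 _ (sol_chi_Phi hX) (sol_chi_Phi hX)) => z Pz _ zs.
  exact/Phi_chi/Pz.
have acX r : 0 < r <= T -> forall C : set R, measurable C -> mu C = 0%E -> P (Xt r @^-1` C) = 0%E.
  move=> rT C; apply: half_line_law_null; first exact: (law r (oc r rT)).1.
  exact: (lawt r (oc r rT)).
have HK : {ae P, forall w, measurable_fun `[0, T] (fun r => chi (r, X r w)) /\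
    {ae mu, forall r, 0 <= r <= T -> `|chi (r, X r w)| <= K}}.
  have H1 := ae_process mXt (fun r rT => mXr r (oc r rT)) acX chiK.
  apply: filterS2 (filterI cX X0) (filterI XtX H1) => w [cXw X0w] [E H2]; split.
    have mp : measurable_fun (`[0, T]%classic : set (measurableTypeR R))
        (fun r : measurableTypeR R => (r, X r w) : measurableTypeR R * measurableTypeR R).
      apply: measurable_fun_pair_on => //; exact: (within_continuous_measurable cXw).
    apply: (measurable_comp (@measurable_space_time R T) _ (sol_chi_measurable hX) mp).
    move=> _ [r /= + <-]; rewrite in_itv/= => rT; split; rewrite /= ?half_lineE ?in_itv//=.
    exact: X0w.
  (* The control along paths is available on ]0, T]; time 0 is a null set. *)
  apply: (ae_lebesgueS2 _ H2 (ae_lebesgue_neq 0)) => r H3 r0 rT.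
  have r0' : 0 < r by rewrite lt_neqAle eq_sym; case/andP: rT => -> _; rewrite andbT; apply/eqP.
  have rT' : 0 < r <= T by rewrite r0'; case/andP: rT.
  rewrite -E//; apply: H3 => //; split; rewrite /= ?half_lineE ?in_itv//=.
  exact: Xt0.
have [I [L [hI hL XIL]]] := sol_equation hX.
(* The Neumann condition on the test function enters here: [phi'] vanishes at 0 and is Lipschitz
   with constant [M2]. *)
have f10 : exists C, forall x, `|(phi^`(1))%classic x| <= C * `|x|.
  exists M2 => x; have := mean_value_bound (dphi 1%N) (a := 0) (b := x) (fun y _ => fM2 y).
  by rewrite derive1n1 phi0 !subr0.
have ito := exp_ito_formula hF hB T0 K0 hI HK bHb HHb aX cX X0 hL XIL mXt XtX
  (dphi 0%N) (dphi 1%N) (dphi 2%N) fM0 fM1 fM2 fM3 f10 tT.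
have E1 r : 0 <= r <= T -> (\int[mu]_(x in @half_line R) (phi x * v (r, x))%:E =
    (\int[P]_w phi (X r w))%:E)%E.
  move=> rT; rewrite -(integral_half_line_law (mX rT) (law r rT).1 (law r rT).2 (mphi 0%N)).
  have i : integrable_rv P (fun w => phi (X r w)).
    apply: (integrable_rv_bounded P _ (fun w => fM0 (X r w))).
    exact: measurableT_comp (mphi 0%N) (mX rT).
  by rewrite /Rintegral fineK//; apply: integrable_fin_num.
have z0 : 0 <= (0 : R) <= T by rewrite lexx (ltW T0).
have E0 : (\int[mu]_(x in @half_line R) (phi x * u0 x)%:E =
    \int[mu]_(x in @half_line R) (phi x * v (0%R, x))%:E)%E.
  have [mu0 _ _] := u0_density h1; have [mv0 _ _] := (law 0 z0).1.
  apply: ae_eq_integral.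
  - exact: measurable_half_line.
  - by apply/measurable_EFinP; apply: measurable_funM => //; exact: measurable_funTS (mphi 0%N).
  - by apply/measurable_EFinP; apply: measurable_funM => //; exact: measurable_funTS (mphi 0%N).
  apply: (ae_lebesgueS _ (sol_initial hX)) => x E xl; rewrite E//.
  by rewrite -half_lineE.
pose g r w := (phi^`(2))%classic (Xt r w) * Hb r w ^+ 2.
have bg : bounded_process T g (M2 * K ^+ 2).
  apply: bounded_processM; last exact: bounded_processX.
  by split=> [|r w _]; [exact: (measurableT_comp (mphi 2%N) mXt)|exact: fM2].
have [_ _ _ jg] := bounded_process_section P bg (lexx 0) t0 tT'.
have mI : measurable (`]0, t]%classic : set (measurableTypeR R)) by [].
have fI := lebesgue_measure_itvoc_fin 0 t.
have [mg gM] := bg.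
have subT (r : measurableTypeR R) : `]0, t]%classic r -> 0 < r <= T.
  by rewrite /= in_itv/= => /andP[-> /le_trans->].
have mg' : measurable_fun (`]0, t]%classic `*` [set: Omega])
    (fun z : measurableTypeR R * Omega => g z.1 z.2).
  apply: measurable_funS mg; first exact: measurableX.
  by move=> -[r w] [/= rt _]; split=> //=; rewrite in_itv/=; exact: subT.
have gM' (r : measurableTypeR R) w : `]0, t]%classic r -> `|g r w| <= M2 * K ^+ 2.
  by move=> rt; apply: gM; exact: subT.
have E3 r : 0 < r <= T -> (\int[P]_w (g r w)%:E =
    \int[mu]_(x in @half_line R) ((phi^`(2))%classic x * flux (r, x))%:E)%E.
  move=> rT; have rT' := oc r rT.
  (* [chi] is measurable on the space-time domain only, hence the extension by zero. It does not
     change the expectation, because [Xt r] is nonnegative everywhere. *)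
  pose f := (fun x => (phi^`(2))%classic x * clip K (chi (r, x)) ^+ 2) \_ (@half_line R).
  have mchi : measurable_fun (@half_line R : set (measurableTypeR R)) (fun x => clip K (chi (r, x))).
    have mp := measurable_funTS (D := @half_line R) (@pair1_measurable _ _ (measurableTypeR R) (measurableTypeR R) r).
    apply: (measurable_comp (@measurable_space_time R T) _ measurable_clip_chi mp).
    by move=> _ [x /= xl <-]; split; rewrite //= in_itv.
  have mf : measurable_fun setT f.
    apply/(measurable_restrictT _ _).1; first exact: measurable_half_line.
    apply: measurable_funM; first exact: measurable_funTS (mphi 2%N).
    exact: measurable_funX.
  transitivity (\int[P]_w (f (Xt r w))%:E)%E.
    apply: eq_integral => w _; rewrite /f patchE mem_set//.
    by rewrite half_lineE; exact: Xt0.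
  rewrite (integral_half_line_law (mXr r rT') (law r rT').1 (lawt r rT') mf).
  apply: eq_integral => x xl; congr EFin.
  by rewrite /f patchE xl /flux mulrA.
have E2 : ((\int[P]_w \int[mu]_(r in `]0%R, t]) g r w)%:E = \int[mu]_(s in `[0%R, t])
     \int[mu]_(x in @half_line R) ((phi^`(2))%classic x * flux (s, x))%:E)%E.
  rewrite /Rintegral fineK; last by apply: integrable_fin_num => //; exact: jg.
  rewrite (exp_integral_section P mI fI mg' gM').
  have E4 (r : measurableTypeR R) : r \in (`]0, t]%classic : set (measurableTypeR R)) ->
      (\int[P]_w (g r w)%:E =
       \int[mu]_(x in @half_line R) ((phi^`(2))%classic x * flux (r, x))%:E)%E.
    by rewrite inE => /subT; exact: E3.
  (* The weak formulation integrates over [0, t], the stochastic side over ]0, t], where the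
     modification is jointly measurable. *)
  rewrite integral_itvcc_itvoc//.
    exact: eq_integral.
  apply: eq_measurable_fun E4 _; exact: (measurable_exp_section P mI fI mg' gM').
rewrite E0 !E1// -E2 -EFinM -EFinD; congr EFin.
by rewrite -ito addrC subrK.
Qed.

End weak_formulation.

Theorem proposition12 (R : realType) (T : R) (hT : 0 < T)
    (beta u0 : R -> R)
    (h1 : assumption1 beta u0) (h2 : assumption2 beta u0)
    (d : measure_display) (Omega : measurableType d) (P : probability Omega R)
    (F : R -> set (set Omega)) (B X : R -> Omega -> R) (v chi : R * R -> R)
    (hX : solution_in_law P T beta u0 F B X v chi) :
  generalized_solution T beta u0 v.
Proof.
have [c betac] := beta_linear h1.
split; first exact: (integrable_v hT hX).
exists (flux v chi c); split.
- exact: (integrable_flux hT hX c).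
- exact: (flux_graph h1 hX betac).
- move=> phi tphi phi0; apply: aeW => t tT.
  exact: (generator_identity hT h1 hX betac tphi phi0 tT).
Qed.
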